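(* Let $M=(M_1,\ldots,M_r)$ be $0$-$1$-matrices over a finite alphabet $B$ satisfying the Robertson–Steger conditions (H0)–(H3) listed in the context, and let $O_M$ be the corresponding higher rank Cuntz–Krieger algebra with canonical shift maps $\Phi^p$, $p\in\mathbb{Z}_+^r$. Then for every $p=(p_1,\ldots,p_r)\in\mathbb{Z}_+^r$ Voiculescu's topological (approximation) entropy of $\Phi^p$ is $$\mathrm{ht}(\Phi^p)=\log\mathrm{r}\big(M_1^{p_1}M_2^{p_2}\cdots M_r^{p_r}\big),$$ where $\mathrm{r}$ denotes the spectral radius. Moreover, the topological entropy of $\Phi_j:=\Phi^{e_j}$ is equal to $\log\mathrm{r}(M_j)$ for every $j\in\{1,\ldots,r\}$.
   Context: Orders on $\mathbb{Z}_+^r$ ($\mathbb{Z}_+=\{0,1,2,\ldots\}$) are coordinatewise; $e_1,\dots,e_r$ is the standard basis; $[m,n]=\{l\in\mathbb{Z}_+^r: m\le l\le n\}$. Let $B$ be a finite alphabet and $M_1,\ldots,M_r:B\times B\to\{0,1\}$ matrices. For $m\in\mathbb{Z}_+^r$ let $W_m$ be the set of maps (''words of shape $m$'') $w:[0,m]\to B$ such that $M_j(w(l),w(l+e_j))=1$ whenever $l,l+e_j\in[0,m]$; $W=\bigcup_m W_m$ with $W_0=B$, $\sigma(w)=m$ for $w\in W_m$, $o(w)=w(0)$, $t(w)=w(\sigma(w))$. The conditions are: (H0) each $M_j$ is a nonzero $\{0,1\}$-matrix; (H1) if $u\in W_m$, $v\in W_n$ and $t(u)=o(v)$, there is a unique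 $w\in W_{m+n}$ with $w|_{[0,m]}=u$ and $w(m+l)=v(l)$ for $l\in[0,n]$ (this $w$ is the product $uv$); (H2) the directed graph with vertex set $B$ and an edge from $a$ to $b$ for each $j$ with $M_j(a,b)=1$ is irreducible (any vertex can be reached from any other by a directed path); (H3) for every nonzero $p\in\mathbb{Z}^r$ there is $w\in W$ which is not $p$-periodic, where $w\in W_m$ is $p$-periodic if $w(l)=w(l-p)$ whenever both $l$ and $l-p$ lie in $[0,m]$. Then $W$ is a rank-$r$ graph. The higher rank Cuntz–Krieger algebra $O_M$ is the graph $C^*$-algebra of $W$: the universal $C^*$-algebra generated by operators $s_u$, $u\in W$, such that: (1) $\{s_a:a\in B\}$ are pairwise orthogonal projections; (2) $s_{uv}=s_us_v$ if $t(u)=o(v)$; (3) $s_u^*s_u=s_{t(u)}$; (4) $s_a=\sum_{\sigma(u)=n,\,o(u)=a}s_us_u^*$ for all $a\in B$, $n\in\mathbb{Z}_+^r$. It is unital and nuclear. The canonical shift map is the unital completely positive (ucp) map $\Phi^p(Y)=\sum_{w\in W_p}s_wYs_w^*$. Approximation entropy. For a nuclear unital $C^*$-algebra $A$, a finite set $\Omega\subset A$ and $\varepsilon>0$, $CPA(A,\Omega,\varepsilon)$ is the set of triples $(\phi,\psi,C)$ with $C$ a finite-dimensional $C^*$-algebra and $\phi:C\to A$, $\psi:A\to C$ ucp with $\|\phi\circ\psi(a)-a\|<\varepsilon$ for all $a\in\Omega$; $\mathrm{rcp}(\Omega,\varepsilon)=\min\{\mathrm{rank}\,C:(\phi,\psi,C)\in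 CPA(A,\Omega,\varepsilon)\}$, where $\mathrm{rank}\,C$ is the dimension of a maximal abelian subalgebra of $C$. For a ucp map $\theta:A\to A$, with $\Omega^{(n)}=\bigcup_{j=0}^n\theta^j(\Omega)$, $$\mathrm{ht}(\theta)=\sup_{\varepsilon>0,\ \Omega\subset A\text{ finite}}\ \limsup_{n\to\infty}\frac1n\log\mathrm{rcp}(\Omega^{(n)},\varepsilon).$$ *)

(* Defs.v *)
From HB Require Import structures.
From mathcomp Require Import all_boot all_order all_algebra.
From mathcomp Require Import complex.
From mathcomp Require Import all_classical all_reals all_analysis.

Set Implicit Arguments.
Unset Strict Implicit.
Unset Printing Implicit Defensive.

Import Order.TTheory GRing.Theory Num.Theory.
Import numFieldNormedType.Exports.

Local Open Scope classical_set_scope.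
Local Open Scope complex_scope.
Local Open Scope ring_scope.

(** * Unital C*-algebras *)

(* Nonzero unital complex C*-algebras, with a real-valued norm.  The norm is
   part of the structure because the hierarchy of the library has no join of
   rings and normed modules above its ordered rings. *)
HB.mixin Record isCStarAlgebra (R : realType) A of GRing.Algebra R[i] A := {
  star : A -> A ;
  cnorm : A -> R ;
  starK : involutive star ;
  starD : {morph star : x y / x + y} ;
  starZ : forall (c : R[i]) x, star (c *: x) = c^* *: star x ;
  starM : forall x y, star (x * y) = star y * star x ;
  cnorm0_eq0 : forall x, cnorm x = 0 -> x = 0 ;
  cnormD_le : forall x y, cnorm (x + y) <= cnorm x + cnorm y ;
  cnormZ : forall (c : R[i]) x, cnorm (c *: x) = complex.Re `|c| * cnorm x ;
  cnormM_le : forall x y, cnorm (x * y) <= cnorm x * cnorm y ;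
  cnorm_star_mul : forall x, cnorm (star x * x) = cnorm x ^+ 2 ;
  cnorm_complete : forall u : nat -> A,
    (forall eps : R, 0 < eps -> exists N : nat, forall m n : nat,
       (N <= m)%N -> (N <= n)%N -> cnorm (u m - u n) < eps) ->
    exists l : A, (fun n => cnorm (u n - l)) @ \oo --> (0 : R)
}.

#[short(type="cstarAlgType")]
HB.structure Definition CStarAlgebra (R : realType) :=
  {A of GRing.Algebra R[i] A & isCStarAlgebra R A}.

Section CStar.
Variable R : realType.
Implicit Types A D C : cstarAlgType R.

(* Not required to contain the unit of [A]. *)
Definition star_subalgebra A (S : set A) : Prop :=
  [/\ S 0,
      forall x y, S x -> S y -> S (x + y),
      forall (c : R[i]) x, S x -> S (c *: x),
      forall x y, S x -> S y -> S (x * y)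
    & forall x, S x -> S (star x)].

Definition norm_closed A (S : set A) : Prop :=
  forall (u : nat -> A) (l : A), (forall n, S (u n)) ->
    (fun n => cnorm (u n - l)) @ \oo --> (0 : R) -> S l.

Definition star_hom A D (f : {linear A -> D}) : Prop :=
  {morph f : x y / x * y} /\ {morph f : x / star x}.

Definition mx_star A n (X : 'M[A]_n) : 'M[A]_n :=
  \matrix_(i, j) star (X j i).

(* The positive elements of the C*-algebra [M_n(A)] are those of the form
   [X^* X]. *)
Definition positive_mx A n (P : 'M[A]_n) : Prop :=
  exists X : 'M[A]_n, P = mx_star X *m X.

Definition completely_positive A D (f : {linear A -> D}) : Prop :=
  forall n (P : 'M[A]_n), positive_mx P -> positive_mx (map_mx f P).

Definition ucp A D (f : {linear A -> D}) : Prop :=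
  f 1 = 1 /\ completely_positive f.

Definition spans A (S : set A) k (e : 'I_k -> A) : Prop :=
  forall x, S x <-> exists c : 'I_k -> R[i], x = \sum_i c i *: e i.

Definition linearly_independent A k (e : 'I_k -> A) : Prop :=
  forall c : 'I_k -> R[i], \sum_i c i *: e i = 0 -> forall i, c i = 0.

Definition has_dim A (S : set A) (k : nat) : Prop :=
  exists2 e : 'I_k -> A, spans S e & linearly_independent e.

Definition finite_dimensional A : Prop := exists k, has_dim [set: A] k.

Definition abelian_subalgebra A (S : set A) : Prop :=
  star_subalgebra S /\ forall x y, S x -> S y -> x * y = y * x.

(* "Subalgebra" means C*-subalgebra; in the finite-dimensional algebras for
   which this is used, all linear subspaces are closed. *)
Definition maximal_abelian A (S : set A) : Prop :=
  abelian_subalgebra S /\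
  forall T : set A, abelian_subalgebra T -> S `<=` T -> T = S.

(* [rank C = k]; all maximal abelian subalgebras of a finite-dimensional
   C*-algebra have the same dimension. *)
Definition has_rank C (k : nat) : Prop :=
  exists2 S : set C, maximal_abelian S & has_dim S k.

(** * Approximation entropy *)

Definition CPA A (Omega : set A) (eps : R) C
    (phi : {linear C -> A}) (psi : {linear A -> C}) : Prop :=
  [/\ finite_dimensional C, ucp phi, ucp psi
    & forall a, Omega a -> cnorm (phi (psi a) - a) < eps].

(* The least rank of a triple in [CPA A Omega eps], as an extended real;
   it is [+oo] if there is no such triple, which does not happen when [A] is
   nuclear and [Omega] is finite. *)
Definition rcp A (Omega : set A) (eps : R) : \bar R :=
  ereal_inf [set x | exists C (phi : {linear C -> A}) (psi : {linear A -> C}) k,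
    [/\ CPA Omega eps phi psi, has_rank C k & x = (k%:R)%:E]].

Definition orbit_upto A (theta : A -> A) (Omega : set A) (n : nat) : set A :=
  \bigcup_(j in [set j | (j <= n)%N]) (iter j theta @` Omega).

Definition ht A (theta : A -> A) : \bar R :=
  ereal_sup [set x | exists (eps : R) (Omega : set A),
    [/\ 0 < eps, finite_set Omega
      & x = limn_esup (fun n : nat =>
          ((n%:R^-1 : R)%:E * lne (rcp (orbit_upto theta Omega n) eps))%E)]].

End CStar.

(** * Words *)

Definition degree (r : nat) := {ffun 'I_r -> nat}.

Definition degree0 r : degree r := [ffun=> 0%N].
Definition degreeD r (m n : degree r) : degree r := [ffun i => (m i + n i)%N].
Definition degree_basis r (j : 'I_r) : degree r := [ffun i => (i == j) : nat].
Definition degree_le r (m n : degree r) : bool := [forall i, (m i <= n i)%N].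

(* The order interval [[0, m]]. *)
Definition box r (m : degree r) := {dffun forall i : 'I_r, 'I_(m i).+1}.

Definition box_degree r (m : degree r) (l : box m) : degree r :=
  [ffun i => l i : nat].

Section Words.
Variables (r : nat) (B : finType) (M : 'I_r -> rel B).

Definition is_word (m : degree r) (w : {ffun box m -> B}) : bool :=
  [forall l : box m, forall l' : box m, forall j : 'I_r,
    (box_degree l' == degreeD (box_degree l) (degree_basis j)) ==>
    M j (w l) (w l')].

Definition word (m : degree r) := {w : {ffun box m -> B} | is_word w}.

(* The letter [w(l)]; meaningful only for [l] in [[0, m]]. *)
Definition letter m (w : word m) (l : degree r) : B :=
  val w [ffun i => inord (l i)].

Definition origin m (w : word m) : B := letter w (degree0 r).
Definition terminus m (w : word m) : B := letter w m.

Definition is_product m n (u : word m) (v : word n) (w : word (degreeD m n)) :=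
  (forall l, degree_le l m -> letter w l = letter u l) /\
  (forall l, degree_le l n -> letter w (degreeD m l) = letter v l).

Definition is_periodic (p : 'I_r -> int) m (w : word m) : Prop :=
  forall l l' : degree r, degree_le l m -> degree_le l' m ->
    (forall i, (l' i)%:Z = (l i)%:Z - p i) -> letter w l = letter w l'.

Definition RS_H0 : Prop := forall j, exists a b, M j a b.

Definition RS_H1 : Prop :=
  forall m n (u : word m) (v : word n), terminus u = origin v ->
    exists! w : word (degreeD m n), is_product u v w.

Definition RS_H2 : Prop :=
  forall a b, connect (fun x y => [exists j, M j x y]) a b.

Definition RS_H3 : Prop :=
  forall p : 'I_r -> int, (exists i, p i != 0) ->
    exists m (w : word m), ~ is_periodic p w.

(* No two points of [[0, 0]] differ by a basis vector. *)
Lemma is_word_const (a : B) : is_word [ffun _ : box (degree0 r) => a].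
Proof.
apply/forallP => l; apply/forallP => l'; apply/forallP => j.
apply/implyP => /eqP /ffunP /(_ j).
have z (k : box (degree0 r)) : (k j : nat) = 0%N.
  by move: (ltn_ord (k j)); rewrite [X in (_ < X.+1)%N]ffunE ltnS leqn0 => /eqP.
by rewrite /degreeD ffunE z ffunE [degree_basis j j]ffunE eqxx addn1.
Qed.

Definition vertex (a : B) : word (degree0 r) :=
  exist (@is_word (degree0 r)) _ (is_word_const a).

(** * Higher rank Cuntz-Krieger algebras *)

Section Algebra.
Variable R : realType.

Definition CK_relations (A : cstarAlgType R) (s : forall m, word m -> A) :=
  [/\ (forall a, star (s _ (vertex a)) = s _ (vertex a) /\
                 s _ (vertex a) * s _ (vertex a) = s _ (vertex a)) /\
      (forall a b, a != b -> s _ (vertex a) * s _ (vertex b) = 0),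
      forall m n (u : word m) (v : word n) (w : word (degreeD m n)),
        terminus u = origin v -> is_product u v w ->
        s _ w = s _ u * s _ v,
      forall m (u : word m), star (s _ u) * s _ u = s _ (vertex (terminus u))
    & forall a (n : degree r),
        s _ (vertex a) =
        \sum_(u : word n | origin u == a) s _ u * star (s _ u)].

(* [A] is the universal C*-algebra generated by elements satisfying the
   relations.  Homomorphisms need not be unital, and [D] may be taken unital
   because a nonunital [D] can be replaced by its unitization; together with
   generation this determines [A] up to isomorphism. *)
Definition is_CK_algebra (A : cstarAlgType R) (s : forall m, word m -> A) :=
  [/\ CK_relations s,
      forall S : set A, star_subalgebra S -> norm_closed S ->
        (forall m (u : word m), S (s _ u)) -> S = [set: A]
    & forall (D : cstarAlgType R) (t : forall m, word m -> D),
        CK_relations t ->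
        exists f : {linear A -> D},
          star_hom f /\ forall m (u : word m), f (s _ u) = t _ u].

Definition shift_map (A : cstarAlgType R) (s : forall m, word m -> A)
    (p : degree r) (Y : A) : A :=
  \sum_(w : word p) s _ w * Y * star (s _ w).

End Algebra.
End Words.

(** * Spectral radius *)

Definition spectral_radius (R : realType) n (X : 'M[R[i]]_n) : R :=
  sup [set complex.Re `|z| | z in [set z : R[i] | eigenvalue X z]].

Definition rel_mx (R : realType) (B : finType) (e : rel B) : 'M[R[i]]_#|B| :=
  \matrix_(i, j) (e (enum_val i) (enum_val j))%:R.
Arguments rel_mx R {B} e.

(* Main.v *)
(** Write [Q w = s_w s_w^*] and let [N n] be the number of words of shape [n p].
    Both bounds compare the rank with [N n], and [N n] is the sum of the entries
    of the [n]-th power of the product of the [M_j ^ p_j].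

    Lower bound: let [(phi, psi, C)] approximate the orbit of the projections
    [Q b], [b] of shape [p], up to [eps].  A word [u] of shape [n p] is
    determined by its [n] blocks of shape [p], and each state through an infinite
    path beginning with [u], composed with [phi], recognizes every block from
    the elements [psi (Phi^(j p) (Q b))] with error [eps].  Decomposing the unit
    of a maximal abelian subalgebra of [C] of dimension [k] into minimal
    projections, the Cauchy-Schwarz inequality and Hamming-weighted vectors give
    [N n e^(- t n eps) <= k (1 + N 1 e^(-t))^n] for all [t >= 0].

    Upper bound: compress to the matrix algebra indexed by the words of the
    degrees [m + g], [g] in a large box, by means of a gauge-invariant weight, and
    expand back through partial isometries with orthogonal ranges, which exist
    because (H3) makes the number of words with a given end unbounded.  On the
    shifted monomials the composition is multiplication by a Folner ratio of the
    box, which tends to 1, and the matrix size is at most a constant times [N n]. *)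

From HB Require Import structures.
Require Import Defs.
From mathcomp Require Import all_boot all_order all_algebra fingroup perm.
From mathcomp Require Import complex.
From mathcomp Require Import all_classical all_reals all_analysis.
From mathcomp Require Import ring lra zify.

Set Implicit Arguments.
Unset Strict Implicit.
Unset Printing Implicit Defensive.

Import Order.TTheory GRing.Theory Num.Theory.
Import numFieldNormedType.Exports.

Local Open Scope classical_set_scope.
Local Open Scope complex_scope.
Local Open Scope ring_scope.

(** * Norm and involution *)

(** Functional calculus enters only through the square root of [1 - h] for self-adjoint [h] of norm
    below 1, and positivity of [a] is expressed by [|t - a| <= t]. Integration over the gauge torus
    becomes a mean over finitely many gauge automorphisms: one torus point acting on a monomial by
    [-1] already annihilates it.

    The obstacle in the lower bound is that an error [eps] is granted for each block separately, so
    about [n eps] of the blocks of a word may be misread. The penalty [e^(-t d)] at Hamming distance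
    [d] tolerates this. First [t] is taken so large that [N 1 e^(-t)] is small, then [eps] so small
    that [t eps] is.

    The obstacle in the upper bound is a monomial whose two words have different shapes: it carries
    words of one degree to words of another, so no single degree suffices. The size of the box
    depends only on the given elements and on [eps], not on [n], which is why it costs no more than
    a constant factor. *)

Section StarAdditive.
Variables (R : realType) (A : cstarAlgType R).

Lemma star_is_zmod_morphism : zmod_morphism (@star R A).
Proof.
move=> x y; rewrite starD; congr (_ + _).
rewrite -scaleN1r starZ.
have -> : ((-1 : R[i])^*)%R = -1 by rewrite rmorphN rmorph1.
by rewrite scaleN1r.
Qed.

HB.instance Definition _ :=
  GRing.isZmodMorphism.Build A A (@star R A) star_is_zmod_morphism.

Lemma star0 : star (0 : A) = 0.
Proof. exact: raddf0. Qed.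

Lemma starN (x : A) : star (- x) = - star x.
Proof. exact: raddfN. Qed.

Lemma starB (x y : A) : star (x - y) = star x - star y.
Proof. exact: star_is_zmod_morphism. Qed.

Lemma star_sum (I : Type) (s : seq I) (P : pred I) (F : I -> A) :
  star (\sum_(i <- s | P i) F i) = \sum_(i <- s | P i) star (F i).
Proof. exact: raddf_sum. Qed.

Lemma star1 : star (1 : A) = 1.
Proof.
have := starM (star (1 : A)) 1.
by rewrite mulr1 !starK mulr1.
Qed.

Lemma starX (x : A) n : star (x ^+ n) = star x ^+ n.
Proof.
elim: n => [|n IHn]; first by rewrite !expr0 star1.
by rewrite exprS starM IHn exprSr.
Qed.

End StarAdditive.

Section Norm.
Variables (R : realType) (A : cstarAlgType R).
Implicit Types (x y h a : A) (c : R[i]) (t eps : R).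

(** The modulus as an element of [R], since [|c|] itself lies in [R[i]]. *)
Definition nrmc (c : R[i]) : R := complex.Re `|c|.

Lemma nrmcE c : (nrmc c)%:C = `|c|.
Proof. by rewrite /nrmc RRe_real // realE normr_ge0. Qed.

Lemma nrmc_ge0 c : 0 <= nrmc c.
Proof. by rewrite -(@lecR R) nrmcE normr_ge0. Qed.

Lemma nrmcR t : nrmc t%:C = `|t|.
Proof. by apply: (@complexI R); rewrite nrmcE normc_def /= expr0n addr0 sqrtr_sqr. Qed.

Lemma nrmcM c d : nrmc (c * d) = nrmc c * nrmc d.
Proof. by apply: (@complexI R); rewrite rmorphM /= !nrmcE normrM. Qed.

Lemma nrmcD c d : nrmc (c + d) <= nrmc c + nrmc d.
Proof. by rewrite -(@lecR R) rmorphD /= !nrmcE ler_normD. Qed.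

Lemma cnorm0 : cnorm (0 : A) = 0.
Proof. by rewrite -(scale0r (0 : A)) cnormZ normr0 /= mul0r. Qed.

Lemma cnormZE c x : cnorm (c *: x) = nrmc c * cnorm x.
Proof. exact: cnormZ. Qed.

Lemma cnormZr t x : cnorm (t%:C *: x) = `|t| * cnorm x.
Proof. by rewrite cnormZE nrmcR. Qed.

Lemma cnormN x : cnorm (- x) = cnorm x.
Proof.
have -> : - x = (-1 : R)%:C *: x by rewrite rmorphN /= scaleN1r.
by rewrite cnormZr normrN normr1 mul1r.
Qed.

Lemma cnorm_distC x y : cnorm (x - y) = cnorm (y - x).
Proof. by rewrite -cnormN opprB. Qed.

Lemma cnorm_ge0 x : 0 <= cnorm x.
Proof.
have := cnormD_le x (- x); rewrite subrr cnorm0 cnormN => h.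
by lra.
Qed.

Lemma cnormB_le x y : cnorm (x - y) <= cnorm x + cnorm y.
Proof. by rewrite (le_trans (cnormD_le _ _)) // cnormN. Qed.

Lemma cnorm_sum_le (I : Type) (s : seq I) (P : pred I) (F : I -> A) :
  cnorm (\sum_(i <- s | P i) F i) <= \sum_(i <- s | P i) cnorm (F i).
Proof.
elim/big_rec2: _ => [|i y x _ le]; first by rewrite cnorm0.
by rewrite (le_trans (cnormD_le _ _)) // lerD2l.
Qed.

Lemma cnorm1 : cnorm (1 : A) = 1.
Proof.
have := cnorm_star_mul (1 : A); rewrite star1 mulr1 => h.
have nz : cnorm (1 : A) != 0.
  by apply/eqP => /cnorm0_eq0 e; move: (oner_neq0 A); rewrite e eqxx.
by apply: (mulfI nz); rewrite mulr1 -expr2 -h.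
Qed.

Lemma cnorm_star_le x : cnorm x <= cnorm (star x).
Proof.
have [->|nz] := eqVneq (cnorm x) 0; first exact: cnorm_ge0.
have pos : 0 < cnorm x by rewrite lt_def nz cnorm_ge0.
rewrite -(ler_pM2r pos) -expr2 -cnorm_star_mul; exact: cnormM_le.
Qed.

Lemma cnorm_star x : cnorm (star x) = cnorm x.
Proof.
apply/eqP; rewrite eq_le cnorm_star_le andbT.
by have := cnorm_star_le (star x); rewrite starK.
Qed.

Lemma cnorm_mul_star x : cnorm (x * star x) = cnorm x ^+ 2.
Proof. by rewrite -[X in X * _]starK cnorm_star_mul cnorm_star. Qed.

Lemma starZr t x : star (t%:C *: x) = t%:C *: star x.
Proof. by rewrite starZ conj_Creal // complex_real. Qed.

Lemma cnorm_selfadj x : star x = x -> cnorm (x * x) = cnorm x ^+ 2.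
Proof. by move=> e; rewrite -cnorm_star_mul e. Qed.

Lemma cnormX_le x n : cnorm (x ^+ n) <= cnorm x ^+ n.
Proof.
elim: n => [|n IHn]; first by rewrite !expr0 cnorm1.
rewrite !exprS (le_trans (cnormM_le _ _)) // ler_wpM2l //; exact: cnorm_ge0.
Qed.

(** Each use of the C*-identity doubles the exponent, hence the powers of 2. This takes the place of
    the spectral radius formula in [spectral_radius_bound]. *)
Lemma cnormX_selfadj x n : star x = x -> cnorm (x ^+ (2 ^ n)) = cnorm x ^+ (2 ^ n).
Proof.
move=> e; elim: n => [|n IHn]; first by rewrite expn0 !expr1.
rewrite expnSr !exprM expr2 cnorm_selfadj; last by rewrite starX e.
by rewrite IHn.
Qed.

Lemma cnorm_eq0P x : (forall eps, 0 < eps -> cnorm x <= eps) -> x = 0.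
Proof.
move=> h; apply: cnorm0_eq0; apply/eqP; rewrite eq_le cnorm_ge0 andbT.
by apply/ler_addgt0Pr => e e0; rewrite add0r h.
Qed.

End Norm.

Lemma subrBACA (V : zmodType) (a b c d : V) : a - b - (c - d) = (a - c) - (b - d).
Proof. by rewrite !opprB addrACA [RHS]addrACA [- b + _]addrC. Qed.

(** * Square roots and the positive cone *)

Section Convergence.
Variables (R : realType) (A : cstarAlgType R).
Implicit Types (x y h a : A) (c : R[i]) (t eps : R).

Definition ctends (u : nat -> A) (l : A) :=
  forall eps, 0 < eps -> exists N, forall n, (N <= n)%N -> cnorm (u n - l) < eps.

Lemma ctendsE u l :
  ((fun n => cnorm (u n - l)) @ \oo --> (0 : R)) <-> ctends u l.
Proof.
split=> [/cvgrPdist_lt h e e0|h].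
  have [N _ hN] := h e e0; exists N => n Nn.
  by have := hN n Nn; rewrite /= sub0r normrN ger0_norm // cnorm_ge0.
apply/cvgrPdist_lt => e e0; have [N hN] := h e e0; exists N => // n Nn /=.
by rewrite sub0r normrN ger0_norm ?cnorm_ge0 // hN.
Qed.

Lemma geometric_small (K q eps : R) : 0 <= q < 1 -> 0 < eps ->
  exists N, K * q ^+ N < eps.
Proof.
move=> /andP[q0 q1] e0.
have : (geometric K q) @ \oo --> (0 : R) by apply: cvg_geometric; rewrite ger0_norm.
move=> /cvgrPdist_lt /(_ _ e0) [N _ /(_ N (leqnn N))] /=.
by rewrite sub0r normrN; exists N; apply: le_lt_trans (ler_norm _) _.
Qed.

Lemma geometric_cauchy (u : nat -> A) (K q : R) : 0 <= q < 1 -> 0 <= K ->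
  (forall n, cnorm (u n.+1 - u n) <= K * q ^+ n) -> exists l, ctends u l.
Proof.
move=> /andP[q0 q1] K0 hu.
(* The partial geometric sum, multiplied through by [1 - q] so that the induction involves no
   division. *)
have step n k : cnorm (u (n + k)%N - u n) * (1 - q) <= K * q ^+ n * (1 - q ^+ k).
  elim: k => [|k IHk].
    by rewrite addn0 subrr cnorm0 mul0r expr0 subrr mulr0.
  have -> : u (n + k.+1)%N - u n = (u (n + k).+1 - u (n + k)%N) + (u (n + k)%N - u n).
    by rewrite addrA subrK addnS.
  have h1 := cnormD_le (u (n + k).+1 - u (n + k)%N) (u (n + k)%N - u n).
  have h2 := hu (n + k)%N.
  have {}h1 := le_trans h1 (lerD h2 (lexx _)).
  have q1' : 0 <= 1 - q by lra.
  have := ler_wpM2r q1' h1 => h3; apply: le_trans h3 _.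
  rewrite mulrDl exprS exprD.
  apply: le_trans (lerD (lexx _) IHk) _.
  by rewrite le_eqVlt; apply/orP; left; apply/eqP; ring.
have bnd n k : cnorm (u (n + k)%N - u n) <= K / (1 - q) * q ^+ n.
  have q1' : 0 < 1 - q by lra.
  rewrite -(ler_pM2r q1') (le_trans (step n k)) //.
  have -> : K / (1 - q) * q ^+ n * (1 - q) = K * q ^+ n by field; lra.
  have : 0 <= q ^+ k by rewrite exprn_ge0.
  have : 0 <= K * q ^+ n by rewrite mulr_ge0 // exprn_ge0.
  by move=> h1 h2; rewrite ler_piMr //; lra.
have [] := @cnorm_complete R A u; last by move=> l /ctendsE; exists l.
move=> e e0.
have e20 : 0 < e / 2 by lra.
have [|N hN] := @geometric_small (K / (1 - q)) q _ _ e20; first by rewrite q0.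
have bN n : (N <= n)%N -> cnorm (u n - u N) < e / 2.
  by move=> /subnKC <-; apply: le_lt_trans (bnd _ _) hN.
exists N => m n Nm Nn.
have -> : u m - u n = (u m - u N) - (u n - u N) by rewrite opprB addrA subrK.
apply: le_lt_trans (cnormB_le _ _) _.
by have := bN _ Nm; have := bN _ Nn; lra.
Qed.

(* The limit y of y_(n+1) = (h + y_n^2) / 2 satisfies (1 - y)^2 = 1 - h. *)
Lemma sqrt_one_sub h : star h = h -> cnorm h < 1 ->
  exists c : A, [/\ star c = c, c * c = 1 - h
    & forall z, z * h = h * z -> z * c = c * z].
Proof.
move=> hs h1.
pose half : R[i] := (2^-1 : R)%:C.
pose f y : A := half *: (h + y * y).
pose u n := iter n f 0.
have uS n : u n.+1 = f (u n) by [].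
have h0 := cnorm_ge0 h.
have half2 (x : A) : half *: x + half *: x = x.
  rewrite -scalerDl -rmorphD /=.
  by have -> : (2^-1 + 2^-1 : R) = 1; [field | rewrite rmorph1 scale1r].
have half_norm x : cnorm (half *: x) = 2^-1 * cnorm x.
  by rewrite cnormZr ger0_norm // invr_ge0.
(* On the ball of radius [|h| < 1] the map [f] is Lipschitz with constant [|h|]; the iterates stay
   in this ball. *)
have ub n : cnorm (u n) <= cnorm h.
  elim: n => [|n IHn]; first by rewrite cnorm0.
  rewrite uS half_norm.
  have := cnormD_le h (u n * u n); have := cnormM_le (u n) (u n).
  have : cnorm (u n) * cnorm (u n) <= cnorm h * 1.
    by apply: ler_pM; rewrite ?cnorm_ge0 //; apply: le_trans IHn _; lra.
  by lra.
have sqB x y : x * x - y * y = x * (x - y) + (x - y) * y.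
  by rewrite mulrBr mulrBl addrA subrK.
have fB x y : cnorm (f x - f y) <= 2^-1 * ((cnorm x + cnorm y) * cnorm (x - y)).
  rewrite -scalerBr opprD addrACA subrr add0r half_norm ler_wpM2l ?invr_ge0 //.
  rewrite sqB (le_trans (cnormD_le _ _)) // [X in _ <= X]mulrDl.
  apply: lerD; first exact: cnormM_le.
  by rewrite [X in _ <= X]mulrC cnormM_le.
have [l hl] : exists l, ctends u l.
  apply: (@geometric_cauchy u (cnorm h) (cnorm h)); rewrite ?h0 //.
  elim=> [|n IHn].
    by rewrite expr0 mulr1 subr0.
  rewrite uS [X in f X - _]uS -!uS.
  apply: le_trans (fB _ _) _.
  have a1 := ub n.+1; have a2 := ub n; have a3 := cnorm_ge0 (u n.+1 - u n).
  rewrite exprS mulrCA.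
  apply: (@le_trans _ _ (cnorm h * cnorm (u n.+1 - u n))); last exact: ler_wpM2l.
  by rewrite mulrA ler_wpM2r //; lra.
have lb : cnorm l <= cnorm h.
  apply/ler_addgt0Pr => e e0; have [N /(_ N (leqnn N)) hN] := hl e e0.
  have -> : l = u N - (u N - l) by rewrite opprB addrC subrK.
  have := cnormB_le (u N) (u N - l); have := ub N; lra.
(* Every property needed of [l] is the vanishing of some [g] that is Lipschitz on the ball: the
   fixed-point equation, self-adjointness, and commutation with [z]. *)
have lim_eq (g : A -> A) : (exists K : R, forall x y, cnorm x <= cnorm h ->
    cnorm y <= cnorm h -> cnorm (g x - g y) <= K * cnorm (x - y)) ->
    (forall eps : R, 0 < eps -> exists N, forall n, (N <= n)%N -> cnorm (g (u n)) < eps) ->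
    g l = 0.
  move=> [K gK] gu; apply: cnorm_eq0P => e e0.
  have K1 : 0 < `|K| + 1 by have := normr_ge0 K; lra.
  have e20 : 0 < e / 2 by lra.
  have e2 : 0 < e / 2 / (`|K| + 1) by rewrite divr_gt0.
  have [N hN] := hl _ e2; have [N' hN'] := gu _ e20.
  have {}hN := hN (maxn N N') (leq_maxl _ _).
  have {}hN' := hN' (maxn N N') (leq_maxr _ _).
  set n := maxn N N' in hN hN'.
  have -> : g l = g (u n) - (g (u n) - g l) by rewrite opprB addrC subrK.
  have gn := gK _ _ (ub n) lb.
  have : K * cnorm (u n - l) <= (`|K| + 1) * cnorm (u n - l).
    by rewrite ler_wpM2r ?cnorm_ge0 //; have := ler_norm K; lra.
  have : (`|K| + 1) * cnorm (u n - l) < e / 2 by rewrite mulrC -ltr_pdivlMr.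
  have := cnormB_le (g (u n)) (g (u n) - g l); lra.
have lfix : l = f l.
  apply/eqP; rewrite -subr_eq0; apply/eqP; apply: (lim_eq (fun y => y - f y)).
    exists 2 => x y xh yh.
    have -> : x - f x - (y - f y) = (x - y) - (f x - f y) by exact: subrBACA.
    have := cnormB_le (x - y) (f x - f y); have := fB x y => q1 q2.
    have : (cnorm x + cnorm y) * cnorm (x - y) <= 2 * cnorm (x - y).
      by rewrite ler_wpM2r ?cnorm_ge0 //; lra.
    lra.
  move=> e e0; have e20 : 0 < e / 2 by lra.
  have [N hN] := hl _ e20; exists N => n Nn; rewrite -uS.
  have -> : u n - u n.+1 = (u n - l) - (u n.+1 - l) by rewrite opprB addrA subrK.
  have := cnormB_le (u n - l) (u n.+1 - l).
  by have := hN _ Nn; have := hN n.+1 (leqW Nn); lra.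
have us n : star (u n) = u n.
  elim: n => [|n IHn]; first by rewrite raddf0.
  by rewrite uS /f starZr starD starM hs IHn.
have ls : star l = l.
  apply/eqP; rewrite -subr_eq0; apply/eqP; apply: (lim_eq (fun y => star y - y)).
    exists 2 => x y _ _.
    have -> : star x - x - (star y - y) = star (x - y) - (x - y).
      by rewrite (raddfB (@star R A)) subrBACA.
    by have := cnormB_le (star (x - y)) (x - y); rewrite cnorm_star; lra.
  by move=> e e0; exists 0%N => n _; rewrite us subrr cnorm0.
exists (1 - l); split.
- by rewrite (raddfB (@star R A)) /= star1 ls.
- rewrite mulrBl mul1r mulrBr mulr1 opprB addrA.
  have -> : l * l = (l + l) - h.
    by apply/eqP; rewrite -subr_eq opprK addrC -[h + _]half2 -/(f l) -lfix.
  by rewrite -!addrA; congr (_ + _); rewrite !addrA addNr add0r addrC addKr.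
move=> z zh; rewrite mulrBr mulrBl mulr1 mul1r; congr (_ - _).
have zu n : z * u n = u n * z.
  elim: n => [|n IHn]; first by rewrite mulr0 mul0r.
  rewrite uS /f -scalerAr -scalerAl mulrDr mulrDl zh; congr (_ *: (_ + _)).
  by rewrite mulrA IHn -mulrA IHn mulrA.
apply/eqP; rewrite -subr_eq0; apply/eqP; apply: (lim_eq (fun y => z * y - y * z)).
  exists (2 * cnorm z) => x y _ _.
  have -> : z * x - x * z - (z * y - y * z) = z * (x - y) - (x - y) * z.
    by rewrite mulrBr mulrBl subrBACA.
  have := cnormB_le (z * (x - y)) ((x - y) * z).
  by have := cnormM_le z (x - y); have := cnormM_le (x - y) z; lra.
by move=> e e0; exists 0%N => n _; rewrite zu subrr cnorm0.
Qed.

End Convergence.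

Section Contraction.
Variables (R : realType).
Implicit Types (A D : cstarAlgType R) (c : R[i]) (t eps : R).

Lemma scale_half_double A (x : A) : (2^-1 : R)%:C *: (x + x) = x.
Proof.
rewrite scalerDr -scalerDl -rmorphD /=.
by have -> : (2^-1 + 2^-1 : R) = 1; [field | rewrite rmorph1 scale1r].
Qed.

(* a is the real part of u = a + i b, which satisfies u^* u = a^2 + b^2. *)
Lemma cnorm_real_part A (a b : A) t : 0 <= t ->
  star a = a -> star b = b -> a * b = b * a ->
  a * a + b * b = t%:C *: 1 -> cnorm a ^+ 2 <= t.
Proof.
move=> t0 sa sb ab abt.
pose u : A := a + 'i *: b.
have su : star u = a - 'i *: b.
  by rewrite starD starZ sa sb -scaleNr conjCi.
have uu : star u * u = t%:C *: 1.
  rewrite su /u mulrBl !mulrDr -!scalerAl -!scalerAr scalerA -abt -ab.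
  have -> : ('i * 'i : R[i]) = -1 by exact: sqrCi.
  by rewrite scaleN1r addrKA opprK.
have nu : cnorm u ^+ 2 = t by rewrite -cnorm_star_mul uu cnormZr cnorm1 mulr1 ger0_norm.
have ha : (2^-1 : R)%:C *: (u + star u) = a.
  by rewrite su /u addrACA subrr addr0 scale_half_double.
have na : cnorm a <= cnorm u.
  rewrite -ha cnormZr ger0_norm ?invr_ge0 //.
  by have := cnormD_le u (star u); rewrite cnorm_star; lra.
by rewrite -nu lerXn2r ?nnegrE ?cnorm_ge0.
Qed.

(** For [|y| < 1] and [h = y^* y], the square root [c] of [1 - h^2] yields an element [d] with
    [f(h)^2 + d^2 = 1] commuting with [f(h)], and [cnorm_real_part] bounds [f(h)]. *)
Lemma star_hom_contractive A D (f : {linear A -> D}) (x : A) :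
  star_hom f -> cnorm (f x) <= cnorm x.
Proof.
move=> [fM fS].
have small (y : A) : cnorm y < 1 -> cnorm (f y) <= 1.
  move=> y1; pose h := star y * y.
  have hs : star h = h by rewrite starM starK.
  have y0 := cnorm_ge0 y.
  have h1 : cnorm h < 1 by rewrite cnorm_star_mul expr_lt1.
  have hh1 : cnorm (h * h) < 1 by rewrite cnorm_selfadj // expr_lt1 // cnorm_ge0.
  have hhs : star (h * h) = h * h by rewrite starM hs.
  have [c [cs cc cC]] := sqrt_one_sub hhs hh1.
  have hc : h * c = c * h by apply: cC; rewrite mulrA.
  (* Since [f] need not preserve the unit, [c = (c - 1) + 1] is mapped by the unital extension of
     [f]. *)
  pose d := f (c - 1) + 1.
  have ds : star d = d by rewrite starD -fS starB cs !star1.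
  have dd : d * d = 1 - f h * f h.
    have k : (c - 1) * (c - 1) + (c - 1) + (c - 1) = - (h * h).
      by rewrite mulrBl mul1r subrK mulrBr mulr1 addrA subrK cc addrAC subrr add0r.
    rewrite /d; set e := f (c - 1).
    have {}k : e * e + e + e = - (f h * f h) by rewrite -!fM -!linearD k linearN.
    by rewrite mulrDl mul1r mulrDr mulr1 addrA k addrC.
  have fhd : f h * d = d * f h.
    by rewrite /d mulrDr mulrDl mulr1 mul1r -!fM mulrBr mulrBl mulr1 mul1r hc.
  have fhs : star (f h) = f h by rewrite -fS hs.
  have := @cnorm_real_part _ (f h) d 1 ler01 fhs ds fhd.
  rewrite dd addrCA subrr addr0 rmorph1 scale1r => /(_ erefl).
  rewrite expr_le1 ?cnorm_ge0 // /h fM fS cnorm_star_mul expr_le1 ?cnorm_ge0 //.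
apply/ler_addgt0Pr => e e0.
have t0 : 0 < cnorm x + e by have := cnorm_ge0 x; lra.
have := small ((cnorm x + e)^-1%:C *: x).
rewrite linearZ /= !cnormZr ger0_norm ?invr_ge0 ?(ltW t0) //.
rewrite ![_^-1 * _]mulrC ltr_pdivrMr // ler_pdivrMr // !mul1r; apply; lra.
Qed.

(** The bound [|t - a| <= t] expresses positivity of [a]; adding [eps] makes the norm of
    [(t - a) / (t + eps)] strictly less than 1, as [sqrt_one_sub] requires. *)
Lemma sqrt_cone A (a : A) t eps : star a = a -> 0 <= t -> 0 < eps ->
  cnorm (t%:C *: 1 - a) <= t ->
  exists c : A, [/\ star c = c, c * c = a + eps%:C *: 1
    & forall z, z * a = a * z -> z * c = c * z].
Proof.
move=> sa t0 e0 hn.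
have te : 0 < t + eps by lra.
pose h : A := (t + eps)^-1%:C *: (t%:C *: 1 - a).
have hs : star h = h by rewrite starZr starB starZr star1 sa.
have h1 : cnorm h < 1.
  by rewrite cnormZr ger0_norm ?invr_ge0 ?(ltW te) // mulrC ltr_pdivrMr // mul1r; lra.
have [c [cs cc cC]] := sqrt_one_sub hs h1.
pose q := Num.sqrt (t + eps).
have qq : q%:C * q%:C = (t + eps)%:C by rewrite -rmorphM -expr2 sqr_sqrtr // ltW.
exists (q%:C *: c); split.
- by rewrite starZr cs.
- rewrite -scalerAl -scalerAr scalerA qq cc scalerBr /h scalerA -rmorphM /= divff ?gt_eqF //.
  by rewrite rmorph1 scale1r opprB addrCA rmorphD /= scalerDl [X in _ + X]addrAC subrr add0r.
move=> z za; rewrite -scalerAr -scalerAl; congr (_ *: _); apply: cC.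
by rewrite /h -scalerAr -scalerAl mulrBr mulrBl -scalerAr -scalerAl mulr1 mul1r za.
Qed.

(* The positive cone is proper: a + eps and - a + eps have commuting square
   roots, whose squares add up to 2 eps. *)
Lemma cone_proper A (a : A) t t' : star a = a -> 0 <= t -> 0 <= t' ->
  cnorm (t%:C *: 1 - a) <= t -> cnorm (t'%:C *: 1 + a) <= t' -> a = 0.
Proof.
move=> sa t0 t'0 h h'; apply: cnorm_eq0P => e e0.
have e3 : 0 < e / 3 by lra.
have [m [ms mm mC]] := sqrt_cone sa t0 e3 h.
have sNa : star (- a) = - a by rewrite starN sa.
rewrite -[a in _ + a]opprK in h'.
have [l [ls ll lC]] := sqrt_cone sNa t'0 e3 h'.
have ml : m * l = l * m.
  by apply: lC; rewrite mulrN mulNr; congr (- _); apply/esym/mC.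
have := @cnorm_real_part _ m l (e / 3 + e / 3) _ ms ls ml.
rewrite mm ll addrACA subrr add0r -(scalerDl 1) rmorphD => /(_ _ erefl) hm.
have {}hm : cnorm m ^+ 2 <= e / 3 + e / 3 by apply: hm; lra.
have : cnorm (m * m) <= cnorm m ^+ 2 by rewrite expr2 cnormM_le.
rewrite mm => h1.
have -> : a = (a + (e / 3)%:C *: 1) - (e / 3)%:C *: 1 by rewrite addrK.
apply: le_trans (cnormB_le _ _) _.
rewrite [X in _ + X]cnormZr cnorm1 ger0_norm; lra.
Qed.

(** The left side equals [|x|^2] to the power [2^n], so a factor [K] independent of [n] disappears
    on taking roots. *)
Lemma spectral_radius_bound A (x : A) (K t : R) : 0 <= t ->
  (forall n, cnorm ((star x * x) ^+ (2 ^ n)) <= K * (t ^+ 2) ^+ (2 ^ n)) -> cnorm x <= t.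
Proof.
move=> t0 hK.
have hs : star (star x * x) = star x * x by rewrite starM starK.
have x0 := cnorm_ge0 x.
have [//|tx] := lerP (cnorm x) t.
have xp : 0 < cnorm x by lra.
pose q := (t / cnorm x) ^+ 2.
have q1 : 0 <= q < 1.
  by rewrite /q exprn_ge0 ?divr_ge0 //= expr_lt1 ?divr_ge0 // ltr_pdivrMr // mul1r.
have [N hN] := @geometric_small R K q 1 q1 ltr01.
have [q0 q1'] := andP q1.
have := hK N; rewrite cnormX_selfadj // cnorm_star_mul.
have p0 : 0 < (cnorm x ^+ 2) ^+ (2 ^ N) by rewrite !exprn_gt0.
have -> : t ^+ 2 = q * cnorm x ^+ 2 by rewrite /q exprMn exprVn mulfVK // expf_neq0 // gt_eqF.
rewrite [(q * _) ^+ _]exprMn mulrA -[X in X <= _]mul1r ler_pM2r //.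
have qN : q ^+ (2 ^ N) <= q ^+ N by rewrite ler_wiXn2l ?(ltW q1') // ltnW // ltn_expl.
have [K0|K0] := lerP 0 K.
  by have := ler_wpM2l K0 qN; lra.
by have : 0 <= q ^+ (2 ^ N); [rewrite exprn_ge0|nra].
Qed.

End Contraction.

(** * Words and infinite paths *)

Section Degrees.
Variable r : nat.
Implicit Types (k l m n : degree r) (j : 'I_r).

Definition degree_sub (k m : degree r) : degree r := [ffun i => (k i - m i)%N].

Lemma degree_leP m n : reflect (forall i, m i <= n i)%N (degree_le m n).
Proof. exact: forallP. Qed.

Lemma degreeDC m n : degreeD m n = degreeD n m.
Proof. by apply/ffunP => i; rewrite !ffunE addnC. Qed.

Lemma degreeDA m n k : degreeD m (degreeD n k) = degreeD (degreeD m n) k.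
Proof. by apply/ffunP => i; rewrite !ffunE addnA. Qed.

Lemma degree0D m : degreeD (degree0 r) m = m.
Proof. by apply/ffunP => i; rewrite !ffunE add0n. Qed.

Lemma degreeD0 m : degreeD m (degree0 r) = m.
Proof. by rewrite degreeDC degree0D. Qed.

Lemma degree_subKC m k : degree_le m k -> k = degreeD m (degree_sub k m).
Proof. by move=> /degree_leP h; apply/ffunP => i; rewrite !ffunE subnKC. Qed.

Lemma degree_le0 m : degree_le (degree0 r) m.
Proof. by apply/degree_leP => i; rewrite ffunE. Qed.

Lemma degree_le_refl m : degree_le m m.
Proof. exact/degree_leP. Qed.

Lemma degree_le_trans n m k : degree_le m n -> degree_le n k -> degree_le m k.
Proof.
by move=> /degree_leP a /degree_leP b; apply/degree_leP => i; exact: leq_trans (a i) (b i).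
Qed.

Lemma degree_leDl m n : degree_le m (degreeD m n).
Proof. by apply/degree_leP => i; rewrite ffunE leq_addr. Qed.

Lemma degree_leDr m n : degree_le n (degreeD m n).
Proof. by rewrite degreeDC degree_leDl. Qed.

Lemma degree_le_add2l x m n : degree_le (degreeD x m) (degreeD x n) = degree_le m n.
Proof. by apply: eq_forallb => i; rewrite !ffunE leq_add2l. Qed.

Lemma degree_ind (P : degree r -> Prop) : P (degree0 r) ->
  (forall j m, P m -> P (degreeD (degree_basis j) m)) -> forall m, P m.
Proof.
move=> P0 PS m; have [s] := ubnP (\sum_i m i)%N.
elim: s m => // s IHs m ms.
have [/forallP z|/forallPn [j jn]] := boolP [forall i, m i == 0%N].
  by have -> : m = degree0 r by apply/ffunP => i; rewrite ffunE; apply/eqP.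
have e : m = degreeD (degree_basis j) (degree_sub m (degree_basis j)).
  apply: degree_subKC; apply/degree_leP => i; rewrite ffunE.
  by case: eqP => // ->; rewrite lt0n.
rewrite e; apply: PS; apply: IHs.
rewrite [in X in (X < _)%N]e in ms.
move: ms; under eq_bigr do rewrite ffunE.
rewrite big_split /= (bigD1 j) //= ffunE eqxx add1n addSn ltnS.
by apply: leq_trans; rewrite ltnS leq_addl.
Qed.

End Degrees.

Section Words.
Variables (r : nat) (B : finType) (M : 'I_r -> rel B).
Implicit Types (k l m n x : degree r) (j : 'I_r) (a b : B).
Local Notation word := (word M).

Lemma letter_box m (w : word m) (l : box m) : letter w (box_degree l) = val w l.
Proof.
rewrite /letter; congr (fun_of_fin (val w) _); apply/ffunP => i.
by rewrite !ffunE inord_val.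
Qed.

Lemma box_of_degree m l : degree_le l m ->
  exists2 b : box m, box_degree b = l & (forall w : word m, letter w l = val w b).
Proof.
move=> /degree_leP h; exists [ffun i => inord (l i)] => //.
by apply/ffunP => i; rewrite !ffunE inordK // ltnS.
Qed.

Lemma box_degree_le m (l : box m) : degree_le (box_degree l) m.
Proof. by apply/degree_leP => i; rewrite ffunE -ltnS. Qed.

Lemma word_ext m (w w' : word m) :
  (forall l, degree_le l m -> letter w l = letter w' l) -> w = w'.
Proof.
move=> h; apply/val_inj/ffunP => l; rewrite -!letter_box; apply: h; exact: box_degree_le.
Qed.

Lemma letter_edge m (w : word m) l j : degree_le (degreeD l (degree_basis j)) m ->
  M j (letter w l) (letter w (degreeD l (degree_basis j))).
Proof.
move=> h; have [b' eb' lb'] := box_of_degree h.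
have [b eb lb] := box_of_degree (degree_le_trans (degree_leDl _ _) h).
rewrite lb' lb; have /forallP/(_ b)/forallP/(_ b')/forallP/(_ j)/implyP := valP w.
by apply; rewrite eb eb'.
Qed.

Lemma word_of_fun m (f : degree r -> B) :
  (forall l j, degree_le (degreeD l (degree_basis j)) m ->
    M j (f l) (f (degreeD l (degree_basis j)))) ->
  exists w : word m, forall l, degree_le l m -> letter w l = f l.
Proof.
move=> h; pose g : {ffun box m -> B} := [ffun b => f (box_degree b)].
have gw : is_word M g.
  apply/forallP => b; apply/forallP => b'; apply/forallP => j; apply/implyP => /eqP e.
  rewrite !ffunE e; apply: h; rewrite -e; exact: box_degree_le.
exists (exist _ g gw) => l lm; have [b eb ->] := box_of_degree lm.
by rewrite /= ffunE eb.
Qed.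

Lemma subword_ex k (w : word k) x n : degree_le (degreeD x n) k ->
  exists u : word n, forall l, degree_le l n -> letter u l = letter w (degreeD x l).
Proof.
move=> h; apply: word_of_fun => l j lj; rewrite degreeDA; apply: letter_edge.
by rewrite -degreeDA; apply: degree_le_trans h; rewrite degree_le_add2l.
Qed.

(** The shape [k] is a variable tied to [m + n] by an equation, so that factorizations of one word
    along [m + n] and along [n + m] can be compared without casts. *)
Definition is_cat m n k (u : word m) (v : word n) (w : word k) :=
  [/\ k = degreeD m n, forall l, degree_le l m -> letter w l = letter u l
    & forall l, degree_le l n -> letter w (degreeD m l) = letter v l].

Lemma is_cat_origin m n k (u : word m) (v : word n) (w : word k) :
  is_cat u v w -> origin w = origin u.
Proof. by move=> [_ h _]; rewrite /origin h // degree_le0. Qed.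

Lemma is_cat_terminus m n k (u : word m) (v : word n) (w : word k) :
  is_cat u v w -> terminus w = terminus v.
Proof. by move=> [e _ h]; rewrite /terminus -h ?degree_le_refl // -e. Qed.

Lemma is_cat_mid m n k (u : word m) (v : word n) (w : word k) :
  is_cat u v w -> origin v = terminus u.
Proof.
move=> [e h1 h2]; rewrite /origin /terminus -h1 ?degree_le_refl //.
by rewrite -h2 ?degree_le0 // degreeD0.
Qed.

Lemma cat_split k m n (w : word k) : k = degreeD m n ->
  exists (u : word m) (v : word n), is_cat u v w.
Proof.
move=> e; have [|u hu] := @subword_ex k w (degree0 r) m.
  by rewrite degree0D e degree_leDl.
have [|v hv] := @subword_ex k w m n; first by rewrite e degree_le_refl.
exists u, v; split=> // l lm; last by rewrite hv.
by rewrite hu // degree0D.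
Qed.

Lemma is_cat_inj m n k (u u' : word m) (v v' : word n) (w : word k) :
  is_cat u v w -> is_cat u' v' w -> u = u' /\ v = v'.
Proof.
move=> [_ a b] [_ a' b']; split; apply: word_ext => l h.
  by rewrite -a // -a'.
by rewrite -b // -b'.
Qed.

Lemma is_cat_uniq m n k (u : word m) (v : word n) (w w' : word k) :
  RS_H1 M -> is_cat u v w -> is_cat u v w' -> w = w'.
Proof.
move=> H1 c c'; have mid := is_cat_mid c; case: c c' => e; subst k.
move=> a b [_ a' b']; have [z [_ zu]] := H1 m n u v (esym mid).
by rewrite -(zu w) // -(zu w').
Qed.

Lemma cat_ex m n k (u : word m) (v : word n) : RS_H1 M -> k = degreeD m n ->
  origin v = terminus u -> exists w : word k, is_cat u v w.
Proof.
by move=> H1 -> e; have [w [[a b] _]] := H1 m n u v (esym e); exists w.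
Qed.

Lemma vertex_letter a l : letter (vertex M a) l = a.
Proof. by rewrite /letter /= ffunE. Qed.

Lemma origin_vertex a : origin (vertex M a) = a.
Proof. exact: vertex_letter. Qed.

Lemma terminus_vertex a : terminus (vertex M a) = a.
Proof. exact: vertex_letter. Qed.

Lemma word0E (w : word (degree0 r)) : w = vertex M (origin w).
Proof.
apply: word_ext => l /degree_leP h; rewrite vertex_letter /origin.
congr letter; apply/ffunP => i; have := h i; rewrite !ffunE leqn0 => /eqP //.
Qed.

Lemma is_cat_vertexl m (w : word m) : is_cat (vertex M (origin w)) w w.
Proof.
split; first by rewrite degree0D.
  move=> l /degree_leP h; rewrite vertex_letter; congr letter; apply/ffunP => i.
  by have := h i; rewrite !ffunE leqn0 => /eqP.
by move=> l _; rewrite degree0D.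
Qed.

Lemma is_cat_vertexr m (w : word m) : is_cat w (vertex M (terminus w)) w.
Proof.
split; [by rewrite degreeD0 | by [] |].
move=> l /degree_leP h; rewrite vertex_letter; congr letter; apply/ffunP => i.
by have := h i; rewrite !ffunE leqn0 => /eqP ->; rewrite addn0.
Qed.

Lemma edge_word j a b : M j a b ->
  exists2 w : word (degree_basis j), origin w = a & terminus w = b.
Proof.
move=> jab; have [|w hw] := @word_of_fun (degree_basis j)
    (fun l => if l == degree0 r then a else b).
  move=> l i /degree_leP h.
  have ij : i = j.
    have := h i; rewrite !ffunE eqxx addn1; case: eqP => //.
  subst i; have -> : l = degree0 r.
    apply/ffunP => i; have := h i; rewrite !ffunE; case: eqP => [->|] /=; lia.
  rewrite eqxx; case: eqP => // /ffunP /(_ j).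
  by rewrite !ffunE eqxx.
exists w; first by rewrite /origin hw ?degree_le0 // eqxx.
rewrite /terminus hw ?degree_le_refl //; case: eqP => // /ffunP /(_ j).
by rewrite !ffunE eqxx.
Qed.

Lemma word_edge j (w : word (degree_basis j)) : M j (origin w) (terminus w).
Proof.
have := @letter_edge _ w (degree0 r) j.
by rewrite degree0D degree_le_refl => /(_ isT).
Qed.

Lemma edge_word_inj j (w w' : word (degree_basis j)) :
  origin w = origin w' -> terminus w = terminus w' -> w = w'.
Proof.
move=> o t; apply: word_ext => l /degree_leP h.
have [->|->] : l = degree0 r \/ l = degree_basis j; [|exact: o|exact: t].
case e : (l j) => [|s]; [left|right]; apply/ffunP => i; have := h i; rewrite !ffunE;
  case: eqP => [->|] /=; have := h j; rewrite ?ffunE ?eqxx; lia.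
Qed.

(** By the two halves of (H1), uniqueness and existence, factorization is injective and reaches
    every composable pair. *)
Lemma cat_reindex (V : nmodType) m n k (F : word k -> V) (G : word m -> word n -> V) :
  RS_H1 M -> k = degreeD m n ->
  (forall u v w, is_cat u v w -> F w = G u v) ->
  \sum_w F w = \sum_u \sum_(v | origin v == terminus u) G u v.
Proof.
move=> H1 e FG.
have sp (w : word k) : {uv : word m * word n | is_cat uv.1 uv.2 w}.
  apply: cid; have [u [v c]] := cat_split w e; by exists (u, v).
pose h w := sval (sp w).
have hc w : is_cat (h w).1 (h w).2 w := svalP (sp w).
have hi : injective h.
  by move=> w w' ee; apply: (is_cat_uniq H1 (hc w)); rewrite ee.
rewrite pair_big_dep /= [RHS](eq_bigl (mem (h @: [set: word k]%SET))).
  rewrite big_imset /=; last by move=> ? ? _ _ /hi.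
  by apply: eq_big => [w|w _]; rewrite ?inE //; exact: FG.
move=> [u v] /=; apply/eqP/imsetP => [ouv|[w _ ww]].
  have [w c] := cat_ex H1 e ouv; exists w => //.
  by have [] := is_cat_inj c (hc w); case: (h w) => /= ? ? -> ->.
by have := is_cat_mid (hc w); rewrite -ww.
Qed.

End Words.

(** * Infinite paths and the number of words with a given end *)

Section Paths.
Variables (r : nat) (B : finType) (M : 'I_r -> rel B).
Hypotheses (H0 : RS_H0 M) (H1 : RS_H1 M) (H2 : RS_H2 M).
Implicit Types (k l m n x : degree r) (j : 'I_r) (a b : B).
Local Notation word := (word M).

(* Factor the word of shape e_i + e_j through a - b - c in the other order. *)
Lemma edge_swap i j a b c : M i a b -> M j b c -> exists2 d, M j a d & M i d c.
Proof.
move=> /edge_word [u ou tu] /edge_word [v ov tv].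
have [|w cw] := @cat_ex _ _ _ _ _ _ u v H1 erefl; first by rewrite tu.
have [u' [v' cw']] := cat_split w (degreeDC _ _).
exists (terminus u').
  by rewrite -ou -(is_cat_origin cw) (is_cat_origin cw'); exact: word_edge.
by rewrite -(is_cat_mid cw') -tv -(is_cat_terminus cw) (is_cat_terminus cw'); exact: word_edge.
Qed.

(** Some edge of colour [j] exists by (H0), and [edge_swap] carries it backwards along a path from
    [a] to its source. *)
Lemma no_sinks a j : exists b, M j a b.
Proof.
have [c [d jcd]] := H0 j.
have /connectP [p] := H2 a c; elim: p a => [|e p IHp] a /=; first by move=> _ <-; exists d.
move=> /andP[/existsP[i aie] pp] /(IHp _ pp) [b jeb].
by have [q ? _] := edge_swap aie jeb; exists q.
Qed.

Lemma no_sources b j : exists a, M j a b.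
Proof.
have [c [d jcd]] := H0 j.
have /connectP [p] := H2 d b; elim/last_ind: p b => [|p e IHp] b.
  by move=> _ /= ->; exists c.
rewrite rcons_path last_rcons => /andP[pp /existsP[i lie]] ->.
have [a ja] := IHp _ pp erefl.
by have [q _ ?] := edge_swap ja lie; exists q.
Qed.

Lemma word_from a m : exists w : word m, origin w = a.
Proof.
elim/degree_ind: m a => [|j m IHm] a; first by exists (vertex M a); exact: origin_vertex.
have [b /edge_word [u ou tu]] := no_sinks a j; have [v ov] := IHm b.
have [|w cw] := @cat_ex _ _ _ _ _ _ u v H1 erefl; first by rewrite ov tu.
by exists w; rewrite (is_cat_origin cw).
Qed.

Lemma word_to b m : exists w : word m, terminus w = b.
Proof.
elim/degree_ind: m b => [|j m IHm] b; first by exists (vertex M b); exact: terminus_vertex.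
have [a /edge_word [v ov tv]] := no_sources b j; have [u tu] := IHm a.
have [|w cw] := @cat_ex _ _ _ _ _ _ u v H1 (degreeDC _ _); first by rewrite ov tu.
by exists w; rewrite (is_cat_terminus cw).
Qed.

Lemma word_between a b : exists m (w : word m), origin w = a /\ terminus w = b.
Proof.
have /connectP [p] := H2 a b; elim: p a => [|e p IHp] a /=.
  by move=> _ ->; exists (degree0 r), (vertex M a); split; [exact: origin_vertex|exact: terminus_vertex].
move=> /andP[/existsP[i /edge_word [u ou tu]] pp] /(IHp _ pp) [m [v [ov tv]]].
have [|w cw] := @cat_ex _ _ _ _ _ _ u v H1 erefl; first by rewrite ov tu.
by exists (degreeD (degree_basis i) m), w; split; rewrite ?(is_cat_origin cw) ?(is_cat_terminus cw).
Qed.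

Lemma extend_right m k (u : word m) : degree_le m k ->
  exists w : word k, forall l, degree_le l m -> letter w l = letter u l.
Proof.
move=> mk; have [v ov] := word_from (terminus u) (degree_sub k m).
by have [w [_ h _]] := cat_ex H1 (degree_subKC mk) ov; exists w.
Qed.

Definition infinite_path (xi : degree r -> B) :=
  forall l j, M j (xi l) (xi (degreeD l (degree_basis j))).

Lemma infinite_path_ex m (u : word m) :
  exists2 xi, infinite_path xi & forall l, degree_le l m -> letter u l = xi l.
Proof.
(* A cofinal sequence of shapes. Position [l] is read at stage [|l|], the sum of its coordinates,
   which is at least each of them. *)
pose D s : degree r := [ffun i => (m i + s)%N].
have DS s : degree_le (D s) (D s.+1).
  by apply/degree_leP => i; rewrite !ffunE leq_add2l.
have [|w0 hw0] := @extend_right m (D 0%N) u.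
  by apply/degree_leP => i; rewrite ffunE addn0.
pose ext s (w : word (D s)) := cid (extend_right w (DS s)).
pose W := nat_rect (fun s => word (D s)) w0 (fun s w => sval (ext s w)).
have WS s l : degree_le l (D s) -> letter (W s.+1) l = letter (W s) l.
  by move=> h; exact: (svalP (ext s (W s)) l h).
have Wle s t l : (s <= t)%N -> degree_le l (D s) -> letter (W t) l = letter (W s) l.
  move=> /subnKC <- h; elim: (t - s)%N => [|q IHq]; first by rewrite addn0.
  rewrite addnS WS ?IHq //; apply: degree_le_trans h _.
  by apply/degree_leP => i; rewrite !ffunE leq_add2l leq_addr.
pose N (l : degree r) := (\sum_i l i)%N.
have DN l s : (N l <= s)%N -> degree_le l (D s).
  move=> h; apply/degree_leP => i; rewrite ffunE.
  by apply: leq_trans (leq_addl _ _); apply: leq_trans h; rewrite /N (bigD1 i) //= leq_addr.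
exists (fun l => letter (W (N l)) l).
  move=> l j; set l' := degreeD l _.
  rewrite -(@Wle (N l) (maxn (N l) (N l'))) ?leq_maxl ?DN //.
  rewrite -(@Wle (N l') (maxn (N l) (N l'))) ?leq_maxr ?DN //.
  by apply: letter_edge; apply: DN; rewrite leq_maxr.
move=> l lm; rewrite (@Wle 0%N (N l)) //=; first by rewrite hw0.
by apply: degree_le_trans lm _; apply/degree_leP => i; rewrite ffunE addn0.
Qed.

Definition words_ending m b := #|[set u : word m | terminus u == b]%SET|.

Lemma words_ending_inj m k a b (f : word m -> word k) : injective f ->
  (forall u, terminus u = a -> terminus (f u) = b) ->
  (words_ending m a <= words_ending k b)%N.
Proof.
move=> fi ft; rewrite /words_ending -(card_imset _ fi); apply: subset_leq_card.
by apply/fintype.subsetP => _ /imsetP[u + ->]; rewrite !inE => /eqP /ft ->.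
Qed.

Lemma words_ending_mono m k b : degree_le m k ->
  (words_ending m b <= words_ending k b)%N.
Proof.
move=> mk; have e : k = degreeD (degree_sub k m) m by rewrite degreeDC -degree_subKC.
have P (u : word m) : {w : word k | exists v : word (degree_sub k m), is_cat v u w}.
  apply: cid; have [v tv] := word_to (origin u) (degree_sub k m).
  by have [w cw] := cat_ex H1 e (esym tv); exists w, v.
apply: (@words_ending_inj _ _ _ _ (fun u => sval (P u))) => [u u' E|u tu].
  have [v cv] := svalP (P u); have [v' cv'] := svalP (P u').
  by rewrite E in cv; have [] := is_cat_inj cv cv'.
by have [v cv] := svalP (P u); rewrite (is_cat_terminus cv).
Qed.

Lemma words_ending_transfer a b : exists m, forall c,
  (words_ending c a <= words_ending (degreeD c m) b)%N.
Proof.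
have [m [v [ov tv]]] := word_between a b; exists m => c.
have P (u : word c) : {w : word (degreeD c m) | terminus u = a -> is_cat u v w}.
  apply: cid; have [tu|tu] := pselect (terminus u = a); last first.
    by have [w _] := word_to a (degreeD c m); exists w.
  have [|w cw] := @cat_ex _ _ _ _ _ _ u v H1 erefl; first by rewrite ov tu.
  by exists w.
rewrite /words_ending -(card_in_imset (f := fun u => sval (P u))).
  apply: subset_leq_card; apply/fintype.subsetP => _ /imsetP[u + ->].
  rewrite !inE => /eqP /(svalP (P u)) cw; apply/eqP.
  by rewrite (is_cat_terminus cw).
move=> u u'; rewrite !inE => /eqP /(svalP (P u)) cu /eqP /(svalP (P u')) cu' E.
by rewrite E in cu; have [] := is_cat_inj cu cu'.
Qed.

Lemma card_word m : #|{: word m}| = (\sum_b words_ending m b)%N.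
Proof.
rewrite -sum1_card (partition_big (@terminus _ _ M m) predT) //=.
apply: eq_bigr => b _; rewrite /words_ending -sum1_card.
by apply: eq_bigl => u; rewrite inE.
Qed.

(* If the number of words were bounded, words of a large shape c would extend
   uniquely to the left; moving a window of shape c along e_j then acts as a
   permutation of the words of shape c, and its order is a period of all words. *)
Lemma card_word_unbounded : (0 < r)%N -> RS_H3 M -> forall K, exists m, (K <= #|{: word m}|)%N.
Proof.
move=> r0 H3 K; apply: contrapT => /forallNP bd.
have {}bd m : (#|{: word m}| < K)%N by rewrite ltnNge; apply/negP/bd.
have [c cmax] : exists c, forall m, (#|{: word m}| <= #|{: word c}|)%N.
  have exP : exists s, `[< exists m, #|{: word m}| = s >].
    by exists #|{: word (degree0 r)}|; apply/asboolP; exists (degree0 r).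
  have ub s : `[< exists m, #|{: word m}| = s >] -> (s <= K)%N.
    by move=> /asboolP [m <-]; exact: ltnW.
  case: (ex_maxnP exP ub) => s /asboolP [c cs] h; exists c => m.
  by rewrite cs; apply: h; apply/asboolP; exists m.
pose j := Ordinal r0; pose e := degree_basis j; pose ec := degreeD e c.
have ece : ec = degreeD c e by exact: degreeDC.
have S_ (w : word ec) : {u : word c | exists v : word e, is_cat v u w}.
  by apply: cid; have [v [u cw]] := cat_split w erefl; exists u, v.
have P_ (w : word ec) : {u : word c | exists v : word e, is_cat u v w}.
  by apply: cid; have [u [v cw]] := cat_split w ece; exists u, v.
pose S w := sval (S_ w); pose P w := sval (P_ w).
(* A surjection onto the words of shape [c] is injective, because by the choice of [c] its source is
   no larger. *)
have bij (f : word ec -> word c) : (forall u, exists w, f w = u) -> injective f.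
  move=> fs; have g u : {w | f w = u} by apply: cid; exact: fs.
  apply/injectiveP/card_uniqP; rewrite size_codom; apply/eqP; rewrite eqn_leq.
  rewrite -{1}(size_codom f) card_size /=; apply: leq_trans (cmax ec) _.
  apply: subset_leq_card; apply/fintype.subsetP => u _.
  by have [w <-] := g u; exact: codom_f.
have Si : injective S.
  apply: bij => u; have [v tv] := word_to (origin u) e.
  have [w cw] := @cat_ex _ _ _ _ _ _ v u H1 erefl (esym tv).
  by exists w; have [v' cw'] := svalP (S_ w); have [] := is_cat_inj cw' cw.
have Pi : injective P.
  apply: bij => u; have [v ov] := word_from (terminus u) e.
  have [w cw] := @cat_ex _ _ _ _ _ _ u v H1 ece ov.
  by exists w; have [v' cw'] := svalP (P_ w); have [] := is_cat_inj cw' cw.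
have T_ u : {w | S w = u}.
  apply: cid; have [v tv] := word_to (origin u) e.
  have [w cw] := @cat_ex _ _ _ _ _ _ v u H1 erefl (esym tv).
  by exists w; have [v' cw'] := svalP (S_ w); have [] := is_cat_inj cw' cw.
(* [f] takes the window at [x + e_j] to the window at [x]: it extends to the left in the only
   possible way and drops the last layer. *)
pose f u := P (sval (T_ u)).
have fi : injective f.
  by move=> u u' /Pi E; rewrite -(svalP (T_ u)) -(svalP (T_ u')) E.
pose F := perm fi; pose q := #[F]%g.
have [|m [w]] := H3 (fun i => if i == j then q%:Z else 0).
  exists j; rewrite eqxx eqz_nat -lt0n; exact: order_gt0.
apply => l l' lm l'm ll'.
have El : l = degreeD l' [ffun i => (q * (i == j))%N].
  apply/ffunP => i; rewrite !ffunE; apply/eqP; rewrite -eqz_nat PoszD; have -> := ll' i.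
  by case: (i == j); rewrite /= ?muln1 ?muln0 ?subr0 ?addr0 ?subrK.
move: lm; rewrite El => l'q {ll' El}.
(* Enlarging [w] by [c] makes room for a window of shape [c] at every point of [[0, m]]. *)
have [w' hw'] := extend_right w (degree_leDl m c).
rewrite -!hw' //.
have sub_ x : exists u : word c, degree_le x m ->
    forall n, degree_le n c -> letter u n = letter w' (degreeD x n).
  have [xm|xm] := boolP (degree_le x m); last by have [u _] := word_from (origin w) c; exists u.
  have [|u hu] := @subword_ex _ _ _ _ w' x c; last by exists u => _; exact: hu.
  by rewrite degreeDC [degreeD m c]degreeDC degree_le_add2l.
pose sub x := sval (cid (sub_ x)).
have subP x n : degree_le x m -> degree_le n c -> letter (sub x) n = letter w' (degreeD x n).
  by move=> xm; exact: (svalP (cid (sub_ x)) xm n).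
have substep x : degree_le (degreeD x e) m -> sub x = f (sub (degreeD x e)).
  move=> xm; have xm' := degree_le_trans (degree_leDl _ _) xm.
  have [|W hW] := @subword_ex _ _ _ _ w' x ec.
    by rewrite degreeDA degreeDC [degreeD m c]degreeDC degree_le_add2l.
  have SW : S W = sub (degreeD x e).
    have [v [_ _ h]] := svalP (S_ W); apply: word_ext => n nc.
    by rewrite /S -h // hW ?degree_le_add2l // subP // degreeDA.
  have PW : P W = sub x.
    have [v [_ h _]] := svalP (P_ W); apply: word_ext => n nc.
    by rewrite /P -h // hW ?subP // (degree_le_trans nc) // degree_leDr.
  rewrite -PW /f; congr P; apply: Si; rewrite SW.
  by have /= -> := svalP (T_ (sub (degreeD x e))).
have subiter s : (s <= q)%N ->
    sub l' = iter s f (sub (degreeD l' [ffun i => (s * (i == j))%N])).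
  elim: s => [|s IHs] sq.
    by congr sub; apply/ffunP => i; rewrite !ffunE mul0n addn0.
  rewrite IHs ?(ltnW sq) // iterSr substep.
    congr (iter s f (f (sub _))); apply/ffunP => i; rewrite !ffunE; lia.
  apply: degree_le_trans l'q; apply/degree_leP => i; rewrite !ffunE.
  by case: (i == j) => /=; lia.
have E : iter q f =1 id.
  by move=> u; rewrite -{2}[u](perm1 u) -(expg_order F) permX; apply: eq_iter => ?; rewrite permE.
have := subiter q (leqnn q); rewrite E => E'.
have := subP _ (degree0 r) l'm (degree_le0 _); rewrite E' subP ?degree_le0 // !degreeD0.
by [].
Qed.

(** Among [K |B|] words of one shape some letter ends at least [K]; irreducibility moves this to any
    [b]. The sum of the shapes found for the various [b] serves all of them by monotonicity. *)
Lemma words_ending_unbounded : (0 < r)%N -> RS_H3 M -> forall K, exists m,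
  forall n b, degree_le m n -> (K <= words_ending n b)%N.
Proof.
move=> r0 H3 K.
have one b : exists m, (K <= words_ending m b)%N.
  have P a : {m | forall c, (words_ending c a <= words_ending (degreeD c m) b)%N}.
    by apply: cid; exact: words_ending_transfer.
  have [c hc] := card_word_unbounded r0 H3 (K * #|B|)%N.
  have [K0|K0] := posnP K; first by exists c; rewrite K0.
  have [a ha] : exists a, (K <= words_ending c a)%N.
    apply: contrapT => /forallNP h; move: hc; rewrite leqNgt => /negP; apply.
    rewrite card_word -[in X in (_ < X)%N]sum1_card big_distrr /= muln1.
    have B0 : (0 < #|B|)%N by apply/card_gt0P; exists b.
    rewrite sum_nat_const; apply: (@leq_ltn_trans (\sum_(a : B) K.-1)%N).
      apply: leq_sum => a _; rewrite -ltnS prednK // ltnNge; exact/negP/h.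
    by rewrite sum_nat_const ltn_pmul2l // prednK.
  by exists (degreeD c (sval (P a))); apply: leq_trans ha (svalP (P a) c).
have P b : {m | (K <= words_ending m b)%N} by apply: cid.
exists [ffun i => \sum_b sval (P b) i]%N => n b mn.
apply: leq_trans (svalP (P b)) _; apply: words_ending_mono.
apply: degree_le_trans mn; apply/degree_leP => i; rewrite ffunE.
by rewrite (bigD1 b) //= leq_addr.
Qed.

End Paths.

(** * Consequences of the Cuntz-Krieger relations *)

Section Projections.
Variables (R : realType) (A : cstarAlgType R).
Implicit Types (p q x : A).

Definition is_proj p := star p = p /\ p * p = p.

Lemma cnorm_proj p : is_proj p -> cnorm p <= 1.
Proof.
move=> [ps pp]; have := cnorm_star_mul p; rewrite ps pp.
have := cnorm_ge0 p; nra.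
Qed.

Lemma is_projC p : is_proj p -> is_proj (1 - p).
Proof.
move=> [ps pp]; split; first by rewrite starB star1 ps.
by rewrite mulrBr mulr1 mulrBl mul1r pp subrr subr0.
Qed.

(** [1 - pqp = (1 - p) + p(1 - q)p] is a sum [X] of two contractions whose products vanish. The
    powers of [X^* X] have norm at most 2, so [spectral_radius_bound] gives [|X| <= 1]. *)
Lemma compression_cone p q : is_proj p -> is_proj q ->
  cnorm ((1 : R)%:C *: 1 - p * q * p) <= 1.
Proof.
move=> pj qj; have ej := is_projC pj; have fj := is_projC qj.
set X := (_ - _); pose e := 1 - p; pose f := p * (1 - q) * p.
have Xe : X = e + f.
  by rewrite /X rmorph1 scale1r /e /f mulrBr mulr1 mulrBl pj.2 addrA subrK.
have ef : e * f = 0 by rewrite /e /f !mulrA mulrBl mul1r pj.2 subrr !mul0r.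
have fe : f * e = 0 by rewrite /e /f -!mulrA mulrBr mulr1 pj.2 subrr !mulr0.
have fs : star f = f by rewrite /f !starM pj.1 fj.1 mulrA.
have f1 : cnorm f <= 1.
  rewrite /f; apply: le_trans (cnormM_le _ _) _.
  rewrite mulr_ile1 ?cnorm_ge0 ?(cnorm_proj pj) //.
  by apply: le_trans (cnormM_le _ _) _; rewrite mulr_ile1 ?cnorm_ge0 ?(cnorm_proj pj) ?(cnorm_proj fj).
have : is_proj e by []; clearbody e f X => {}ej.
have Xs : star X = X by rewrite Xe starD fs ej.1.
have XX : star X * X = e + f * f.
  by rewrite Xs Xe mulrDr !mulrDl ef fe ej.2 addr0 add0r.
have pow k : (star X * X) ^+ k.+1 = e + (f * f) ^+ k.+1.
  elim: k => [|k IHk]; first by rewrite !expr1.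
  have e0 : e * (f * f) ^+ k.+1 = 0 by rewrite exprS !mulrA ef !mul0r.
  have e1 : f * f * e = 0 by rewrite -mulrA fe mulr0.
  by rewrite exprS IHk XX mulrDr !mulrDl e0 e1 ej.2 addr0 add0r -exprS.
apply: (@spectral_radius_bound _ _ _ 2 1) => // n.
have [k ->] : exists k, (2 ^ n)%N = k.+1 by exists (2 ^ n).-1; rewrite prednK // expn_gt0.
rewrite pow !expr1n mulr1; apply: le_trans (cnormD_le _ _) _.
rewrite -[2]/(1 + 1); apply: lerD; first exact: cnorm_proj.
apply: le_trans (cnormX_le _ _) _; rewrite exprn_ile1 ?cnorm_ge0 //.
by apply: le_trans (cnormM_le _ _) _; rewrite mulr_ile1 ?cnorm_ge0.
Qed.

(** The positive elements [q_j q_k q_j] with [k <> j] add up to [q_j - q_j = 0], and in a proper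
    cone each of them must vanish. *)
Lemma proj_orthogonal (I : finType) (q : I -> A) : (forall i, is_proj (q i)) ->
  \sum_i q i = 1 -> forall i j, i != j -> q i * q j = 0.
Proof.
move=> qj q1 i j ij.
pose a k := q j * q k * q j.
have as_ k : star (a k) = a k by rewrite /a !starM !(qj _).1 mulrA.
have sa : \sum_(k | k != j) a k = 0.
  apply: (addrI (a j)); rewrite -[LHS](bigD1 j (P := predT)) //= addr0 /a.
  by rewrite -mulr_suml -mulr_sumr q1 mulr1 !(qj j).2.
have ai : a i = 0.
  rewrite (bigD1 i) //= in sa.
  pose t := \sum_(k | (k != j) && (k != i)) (1 : R).
  apply: (@cone_proper _ _ (a i) 1 t) => //.
  - exact: sumr_ge0.
  - exact: compression_cone.
  have -> : t%:C *: 1 + a i = \sum_(k | (k != j) && (k != i)) ((1 : R)%:C *: 1 - a k).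
    rewrite sumrB -scaler_suml -rmorph_sum /=; congr (_ + _).
    by apply/eqP; rewrite -subr_eq0 opprK sa.
  by apply: le_trans (cnorm_sum_le _ _ _) _; apply: ler_sum => k _; exact: compression_cone.
apply: cnorm0_eq0; apply/eqP; rewrite -sqrf_eq0 -cnorm_star_mul starM !(qj _).1.
by rewrite mulrA -[q j * q i * q i]mulrA (qj i).2 -/(a i) ai cnorm0.
Qed.

End Projections.

Section CuntzKrieger.
Variables (R : realType) (r : nat) (B : finType) (M : 'I_r -> rel B).
Hypotheses (H0 : RS_H0 M) (H1 : RS_H1 M) (H2 : RS_H2 M).
Variables (A : cstarAlgType R) (s : forall m : degree r, word M m -> A).
Hypothesis CK : is_CK_algebra s.
Implicit Types (k l m n : degree r) (a b : B) (x y : A).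
Local Notation word := (word M).
Local Notation S w := (s w).
Local Notation V a := (s (vertex M a)).
Local Notation Q w := (s w * star (s w)).

Lemma ck_cat m n k (u : word m) (v : word n) (w : word k) :
  is_cat u v w -> S w = S u * S v.
Proof.
move=> c; have mid := is_cat_mid c; case: c => e; subst k => h1 h2.
by have [[_ h _ _] _ _] := CK; apply: h.
Qed.

Lemma ck_vertex_star a : star (V a) = V a.
Proof. by have [[[h _] _ _ _] _ _] := CK; have [] := h a. Qed.

Lemma ck_vertex_mul a b : V a * V b = if a == b then V a else 0.
Proof.
have [[[h h'] _ _ _] _ _] := CK; case: eqP => [<-|/eqP ab]; last exact: h'.
by have [] := h a.
Qed.

Lemma ck_star_mul m (u : word m) : star (S u) * S u = V (terminus u).
Proof. by have [[_ _ h _] _ _] := CK; exact: h. Qed.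

Lemma ck_sum a n : V a = \sum_(u : word n | origin u == a) Q u.
Proof. by have [[_ _ _ h] _ _] := CK; exact: h. Qed.

Lemma ck_originl m (u : word m) : V (origin u) * S u = S u.
Proof. by rewrite -(ck_cat (is_cat_vertexl u)). Qed.

Lemma ck_terminusr m (u : word m) : S u * V (terminus u) = S u.
Proof. by rewrite -(ck_cat (is_cat_vertexr u)). Qed.

Lemma ck_vertex_mull a m (u : word m) : V a * S u = if a == origin u then S u else 0.
Proof.
rewrite -{1}(ck_originl u) mulrA ck_vertex_mul; case: eqP => [->|_].
  by rewrite ck_originl.
by rewrite mul0r.
Qed.

Lemma ck_vertex_mulr a m (u : word m) : S u * V a = if a == terminus u then S u else 0.
Proof.
rewrite -{1}(ck_terminusr u) -mulrA ck_vertex_mul eq_sym; case: eqP => _.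
  by rewrite ck_terminusr.
by rewrite mulr0.
Qed.

Lemma ck_mul_neq0 m n (u : word m) (v : word n) :
  origin v != terminus u -> S u * S v = 0.
Proof. by move=> h; rewrite -(ck_terminusr u) -mulrA ck_vertex_mull eq_sym (negPf h) mulr0. Qed.

Lemma ck_generated (P : A -> Prop) : (forall m (u : word m), P (S u)) ->
  P 0 -> (forall x y, P x -> P y -> P (x + y)) -> (forall c x, P x -> P (c *: x)) ->
  (forall x y, P x -> P y -> P (x * y)) -> (forall x, P x -> P (star x)) ->
  (forall x, (forall eps, 0 < eps -> exists2 y, P y & cnorm (x - y) < eps) -> P x) ->
  forall x, P x.
Proof.
move=> PS P0 PD PZ PM Pstar Pc x; have [_ h _] := CK.
have -> : P = [set: A]; last by [].
apply: h => //.
move=> u l Pu ul; apply: Pc; have {}ul := iffLR (ctendsE u l) ul; move=> e e0; have [N hN] := ul e e0.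
by exists (u N) => //; rewrite cnorm_distC hN.
Qed.

Lemma limit_eq0 (f : A -> A) (K : R) : (forall x y, f (x - y) = f x - f y) ->
  (forall x, cnorm (f x) <= K * cnorm x) -> forall x,
  (forall eps, 0 < eps -> exists2 y, f y = 0 & cnorm (x - y) < eps) -> f x = 0.
Proof.
move=> fB fK x h; apply: cnorm_eq0P => e e0.
have K0 : 0 < `|K| + 1 by have := normr_ge0 K; lra.
have [|y fy yx] := h (e / (`|K| + 1)); first by rewrite divr_gt0.
have -> : f x = f (x - y) by rewrite fB fy subr0.
apply: le_trans (fK _) _; move: yx; rewrite ltr_pdivlMr // => yx.
apply: le_trans (ltW yx); rewrite mulrC ler_wpM2l ?cnorm_ge0 //.
by have := ler_norm K; lra.
Qed.

(** The relations do not mention the unit of [A]. The sum is a two-sided unit for the generators,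
    hence by density for all of [A], in particular for 1. *)
Lemma ck_one : \sum_a V a = 1.
Proof.
set e := \sum_a _.
have es : star e = e by rewrite star_sum; apply: eq_bigr => a _; rewrite ck_vertex_star.
have eS m (u : word m) : e * S u = S u.
  rewrite mulr_suml (bigD1 (origin u)) //= ck_originl big1 ?addr0 // => a /negPf h.
  by rewrite ck_vertex_mull h.
have Se m (u : word m) : S u * e = S u.
  rewrite mulr_sumr (bigD1 (terminus u)) //= ck_terminusr big1 ?addr0 // => a /negPf h.
  by rewrite ck_vertex_mulr h.
have H x : e * x - x = 0 /\ x * e - x = 0.
  move: x; apply: ck_generated.
  - by move=> m u; rewrite eS Se subrr.
  - by rewrite mulr0 mul0r subrr.
  - by move=> x y [a b] [c d]; rewrite mulrDr mulrDl opprD; split; rewrite addrACA ?a ?b ?c ?d addr0.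
  - by move=> c x [a b]; rewrite -scalerAr -scalerAl -!scalerBr a b scaler0.
  - move=> x y [/subr0_eq a _] [_ /subr0_eq b].
    by rewrite mulrA a -mulrA b subrr.
  - move=> x [/subr0_eq a /subr0_eq b].
    by rewrite -{1 2}es -!starM a b subrr.
  - move=> x h; split.
      apply: (@limit_eq0 (fun x => e * x - x) (cnorm e + 1)).
      + by move=> y z; rewrite mulrBr subrBACA.
      + by move=> y; apply: le_trans (cnormB_le _ _) _; rewrite mulrDl mul1r lerD2r cnormM_le.
      by move=> eps /h [y [] ? _ ?]; exists y.
    apply: (@limit_eq0 (fun x => x * e - x) (cnorm e + 1)).
    + by move=> y z; rewrite mulrBl subrBACA.
    + by move=> y; apply: le_trans (cnormB_le _ _) _; rewrite mulrDl mul1r lerD2r mulrC cnormM_le.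
    by move=> eps /h [y [] _ ? ?]; exists y.
by have [/subr0_eq] := H 1; rewrite mulr1.
Qed.

Lemma ck_sum_Q n : \sum_(w : word n) Q w = 1.
Proof.
rewrite -ck_one (partition_big (@origin _ _ M n) predT) //=.
by apply: eq_bigr => a _; rewrite (ck_sum a n).
Qed.

Lemma ck_proj m (u : word m) : is_proj (Q u).
Proof.
split; first by rewrite starM starK.
by rewrite mulrA -[_ * _ * S u]mulrA ck_star_mul ck_terminusr.
Qed.

(** The relations give the case [u = v]. Distinct words of one shape have orthogonal ranges because
    the range projections sum to 1. *)
Lemma ck_starS m (u v : word m) : star (S u) * S v = if u == v then V (terminus u) else 0.
Proof.
case: eqP => [<-|/eqP uv]; first exact: ck_star_mul.
have qS w : Q w * S w = S w by rewrite -mulrA ck_star_mul ck_terminusr.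
have e : star (S u) * Q u = star (S u) by rewrite -[in RHS](qS _ u) starM (ck_proj u).1.
rewrite -e -(qS _ v) mulrA -[star (S u) * Q u * Q v]mulrA.
by rewrite (proj_orthogonal (@ck_proj m) (ck_sum_Q m) uv) mulr0 mul0r.
Qed.

Lemma ck_starS_cat m n k (u u' : word m) (v : word n) (w : word k) : is_cat u v w ->
  star (S w) * S u' = if u == u' then star (S v) else 0.
Proof.
move=> c; rewrite (ck_cat c) starM -mulrA ck_starS; case: eqP => _; last by rewrite mulr0.
by rewrite -(is_cat_mid c) -(ck_vertex_star) -starM ck_originl.
Qed.

Lemma ck_starS_cat' m n k (u u' : word m) (v : word n) (w : word k) : is_cat u v w ->
  star (S u') * S w = if u == u' then S v else 0.
Proof.
move=> c; rewrite -[LHS]starK starM starK (ck_starS_cat _ c).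
by case: eqP; rewrite ?starK ?star0.
Qed.

(** A word [v] from [a] to [b] gives [V b = s_v^* (V a) s_v], so one zero vertex projection would
    make all of them, and their sum 1, vanish. *)
Lemma ck_vertex_neq0 a : V a != 0.
Proof.
apply/eqP => a0.
have [m [u _]] : exists m (u : word m), S u != 0.
  apply: contrapT => h.
  have S0 m (u : word m) : S u = 0.
    by apply/eqP/negPn/negP => n; apply: h; exists m, u.
  have := ck_one; rewrite big1 => [e|b _]; last exact: S0.
  by move: (oner_neq0 A); rewrite -e eqxx.
have V0 b : V b = 0.
  have [n [v [ov tv]]] := word_between H1 H2 a b.
  by rewrite -tv -ck_star_mul -(ck_originl v) ov a0 mul0r mulr0.
have := ck_one; rewrite big1 => [e|b _]; last exact: V0.
by move: (oner_neq0 A); rewrite -e eqxx.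
Qed.

Lemma cnorm_Q m (u : word m) : cnorm (Q u) = 1.
Proof.
have n : cnorm (Q u) != 0.
  apply/eqP => /cnorm0_eq0 q0; have := ck_vertex_neq0 (terminus u).
  have -> : V (terminus u) = star (S u) * Q u * S u.
    by rewrite mulrA -mulrA !ck_star_mul ck_vertex_mul eqxx.
  by rewrite q0 mulr0 mul0r eqxx.
have := cnorm_star_mul (Q u); rewrite (ck_proj u).1 (ck_proj u).2 expr2 => h.
by apply: (mulfI n); rewrite mulr1 -h.
Qed.

Inductive monomial_span : A -> Prop :=
| MonomialSpan m n (u : word m) (v : word n) : monomial_span (S u * star (S v))
| MonomialSpanD x y : monomial_span x -> monomial_span y -> monomial_span (x + y)
| MonomialSpanZ c x : monomial_span x -> monomial_span (c *: x).

Lemma monomial_span0 : monomial_span 0.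
Proof.
have [m [u _]] : exists m (u : word m), True.
  apply: contrapT => h.
  have := ck_one; rewrite big1 => [e|b _]; last by case: h; exists (degree0 r), (vertex M b).
  by move: (oner_neq0 A); rewrite -e eqxx.
by rewrite -(scale0r (S u * star (S u))); apply/MonomialSpanZ/MonomialSpan.
Qed.

Lemma monomial_span_sum (I : Type) (t : seq I) (P : pred I) (F : I -> A) :
  (forall i, P i -> monomial_span (F i)) -> monomial_span (\sum_(i <- t | P i) F i).
Proof. by move=> h; apply: big_ind => //; [exact: monomial_span0|exact: MonomialSpanD]. Qed.

Lemma monomial_span_star x : monomial_span x -> monomial_span (star x).
Proof.
elim=> [m n u v|y z _ hy _ hz|c y _ hy].
- by rewrite starM starK; exact: MonomialSpan.
- by rewrite starD; exact: MonomialSpanD.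
by rewrite starZ; exact: MonomialSpanZ.
Qed.

Lemma ck_mulS m n (u : word m) (v : word n) :
  S u * S v = 0 \/ exists w : word (degreeD m n), is_cat u v w /\ S u * S v = S w.
Proof.
have [e|ne] := eqVneq (origin v) (terminus u); last by left; exact: ck_mul_neq0.
by right; have [w c] := cat_ex H1 erefl e; exists w; rewrite (ck_cat c).
Qed.

Lemma monomial_span_mul x y : monomial_span x -> monomial_span y -> monomial_span (x * y).
Proof.
move=> hx; elim: hx y => [m n u v y|x1 x2 _ h1 _ h2 y hy|c x1 _ h1 y hy]; last 2 first.
- by rewrite mulrDl; apply: MonomialSpanD; [exact: h1|exact: h2].
- by rewrite -scalerAl; apply: MonomialSpanZ; exact: h1.
elim=> [m' n' u' v'|y1 y2 _ h1 _ h2|c y1 _ h1]; last 2 first.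
- by rewrite mulrDr; exact: MonomialSpanD.
- by rewrite -scalerAr; exact: MonomialSpanZ.
(* Inserting [1 = sum Q w] over the shape [n + m'] avoids minimal common extensions: each [w] is
   long enough to begin with [v] and [u'] or to be orthogonal to one of them. *)
have -> : S u * star (S v) * (S u' * star (S v')) =
    \sum_(w : word (degreeD n m')) S u * (star (S v) * S w) * ((star (S w) * S u') * star (S v')).
  rewrite -[X in X * (S u' * _)]mulr1 -(ck_sum_Q (degreeD n m')) mulr_sumr mulr_suml.
  by apply: eq_bigr => w _; rewrite !mulrA.
apply: monomial_span_sum => w _.
have [v1 [w1 c1]] := cat_split w erefl.
have [u1 [w2 c2]] := cat_split w (degreeDC _ _).
rewrite (ck_starS_cat' _ c1) (ck_starS_cat _ c2).
case: eqP => _; last by rewrite mulr0 mul0r; exact: monomial_span0.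
case: eqP => _; last by rewrite mul0r mulr0; exact: monomial_span0.
rewrite -starM.
have [->|[a [_ ->]]] := ck_mulS u w1; first by rewrite mul0r; exact: monomial_span0.
have [->|[b [_ ->]]] := ck_mulS v' w2; first by rewrite star0 mulr0; exact: monomial_span0.
exact: MonomialSpan.
Qed.

Lemma monomial_span_dense x eps : 0 < eps ->
  exists2 y, monomial_span y & cnorm (x - y) < eps.
Proof.
move: x eps; pose P x := forall eps : R, 0 < eps ->
  exists2 y, monomial_span y & cnorm (x - y) < eps.
rewrite -/(forall x, P x).
have PM x : monomial_span x -> P x by move=> h e e0; exists x; rewrite ?subrr ?cnorm0.
apply: ck_generated.
- move=> m u; apply: PM; rewrite -ck_terminusr -ck_vertex_star; exact: MonomialSpan.
- exact/PM/monomial_span0.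
- move=> x y hx hy e e0; have e20 : 0 < e / 2 by lra.
  have [x' mx xx] := hx _ e20; have [y' my yy] := hy _ e20.
  exists (x' + y'); first exact: MonomialSpanD.
  rewrite opprD addrACA; apply: le_lt_trans (cnormD_le _ _) _; lra.
- move=> c x hx e e0; have n0 := nrmc_ge0 c.
  have [|x' mx xx] := hx (e / (nrmc c + 1)); first by rewrite divr_gt0 //; lra.
  exists (c *: x'); first exact: MonomialSpanZ.
  rewrite -scalerBr cnormZE; move: xx; rewrite ltr_pdivlMr; last lra.
  have := cnorm_ge0 (x - x'); nra.
- move=> x y hx hy e e0.
  have x0 := cnorm_ge0 x; have y0 := cnorm_ge0 y.
  have e1 : 0 < e / 2 / (cnorm y + 1) by rewrite !divr_gt0 //; lra.
  have [x' mx xx] := hx _ e1.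
  have x'0 := cnorm_ge0 x'.
  have e2 : 0 < e / 2 / (cnorm x' + 1) by rewrite !divr_gt0 //; lra.
  have [y' my yy] := hy _ e2.
  exists (x' * y'); first exact: monomial_span_mul.
  have -> : x * y - x' * y' = (x - x') * y + x' * (y - y').
    by rewrite mulrBl mulrBr addrA subrK.
  apply: le_lt_trans (cnormD_le _ _) _.
  have := cnormM_le (x - x') y; have := cnormM_le x' (y - y').
  move: xx yy; rewrite !ltr_pdivlMr; try lra.
  have := cnorm_ge0 (x - x'); have := cnorm_ge0 (y - y'); nra.
- move=> x hx e /hx [y my yx]; exists (star y); first exact: monomial_span_star.
  by rewrite -starB cnorm_star.
move=> x hx e e0; have e20 : 0 < e / 2 by lra.
have [y hy yx] := hx _ e20; have [z mz zy] := hy _ e20.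
exists z => //; have -> : x - z = (x - y) + (y - z) by rewrite addrA subrK.
by apply: le_lt_trans (cnormD_le _ _) _; lra.
Qed.

Lemma ck_ind (P : A -> Prop) :
  (forall m n (u : word m) (v : word n), P (S u * star (S v))) ->
  (forall x y, P x -> P y -> P (x + y)) -> (forall c x, P x -> P (c *: x)) ->
  (forall x, (forall eps, 0 < eps -> exists2 y, P y & cnorm (x - y) < eps) -> P x) ->
  forall x, P x.
Proof.
move=> PS PD PZ Pc x; apply: Pc => e e0.
have [y my yx] := monomial_span_dense x e0; exists y => //.
by elim: {yx} my => [m n u v|y1 y2 _ h1 _ h2|c y1 _ h1]; [exact: PS|exact: PD|exact: PZ].
Qed.

End CuntzKrieger.

(** * Gauge-invariant states along infinite paths *)

Section ComplexLimits.
Variable R : realType.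
Implicit Types (c d : R[i]) (e : R).

Lemma nrmc_eq0 c : (forall e, 0 < e -> nrmc c <= e) -> c = 0.
Proof.
move=> h; apply/eqP; rewrite -normr_eq0 -nrmcE -(rmorph0 (real_complex R)).
rewrite (inj_eq (@complexI R)) eq_le nrmc_ge0 andbT.
by apply/ler_addgt0Pr => e e0; rewrite add0r h.
Qed.

Lemma nrmcN c : nrmc (- c) = nrmc c.
Proof. by rewrite /nrmc normrN. Qed.

Lemma Re_le_nrmc c : `|complex.Re c| <= nrmc c.
Proof. by have := normc_ge_Re c; rewrite -nrmcE lecR. Qed.

Lemma nrmci : nrmc ('i%C : R[i]) = 1.
Proof. by apply: (@complexI R); rewrite nrmcE normc_def /= expr0n expr1n add0r sqrtr1. Qed.

Lemma Im_le_nrmc c : `|complex.Im c| <= nrmc c.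
Proof.
have := Re_le_nrmc (- ('i%C * c)); rewrite nrmcN nrmcM.
by rewrite nrmci mul1r; case: c => a b /=; rewrite mul0r mul1r sub0r opprK.
Qed.

Lemma nrmc_le_ReIm c : nrmc c <= `|complex.Re c| + `|complex.Im c|.
Proof.
rewrite {1}[c]complexE; apply: le_trans (nrmcD _ _) _.
by rewrite nrmcR lerD2l nrmcM nrmcR nrmci mul1r.
Qed.

Lemma real_complete (u : nat -> R) :
  (forall e, 0 < e -> exists N, forall m n, (N <= m)%N -> (N <= n)%N -> `|u m - u n| < e) ->
  exists l, forall e, 0 < e -> exists N, forall n, (N <= n)%N -> `|u n - l| < e.
Proof.
move=> h; have cu : cvgn u.
  apply/cauchy_cvgP/cauchy_exP => e e0; have [N hN] := h e e0.
  by exists (u N), N => // n /= Nn; apply: hN.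
exists (limn u) => e e0.
have /cvgrPdist_lt /(_ e e0) [N _ hN] := cu.
by exists N => n Nn; rewrite distrC; exact: hN.
Qed.

Lemma complex_complete (u : nat -> R[i]) :
  (forall e, 0 < e -> exists N, forall m n, (N <= m)%N -> (N <= n)%N -> nrmc (u m - u n) < e) ->
  exists l, forall e, 0 < e -> exists N, forall n, (N <= n)%N -> nrmc (u n - l) < e.
Proof.
move=> h; have ReB x y : complex.Re (x - y : R[i]) = complex.Re x - complex.Re y by rewrite raddfB.
have ImB x y : complex.Im (x - y : R[i]) = complex.Im x - complex.Im y by rewrite raddfB.
have [a ha] : exists l, forall e, 0 < e -> exists N, forall n, (N <= n)%N -> `|complex.Re (u n) - l| < e.
  apply: real_complete => e /h [N hN]; exists N => m n Nm Nn.
  by rewrite -ReB; apply: le_lt_trans (Re_le_nrmc _) (hN _ _ Nm Nn).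
have [b hb] : exists l, forall e, 0 < e -> exists N, forall n, (N <= n)%N -> `|complex.Im (u n) - l| < e.
  apply: real_complete => e /h [N hN]; exists N => m n Nm Nn.
  by rewrite -ImB; apply: le_lt_trans (Im_le_nrmc _) (hN _ _ Nm Nn).
exists (a +i* b) => e e0; have e20 : 0 < e / 2 by lra.
have [N hN] := ha _ e20; have [N' hN'] := hb _ e20; exists (maxn N N') => n.
rewrite geq_max => /andP[/hN h1 /hN' h2].
apply: le_lt_trans (nrmc_le_ReIm _) _; rewrite ReB ImB /=; lra.
Qed.

Lemma nonneg_limit c : (forall e, 0 < e -> exists2 d, 0 <= d & nrmc (c - d) <= e) -> 0 <= c.
Proof.
move=> h; rewrite lecE /=; apply/andP; split.
  rewrite -normr_eq0 eq_le normr_ge0 andbT; apply/ler_addgt0Pr => e e0; rewrite add0r.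
  have [d + cd] := h e e0; rewrite lecE /= => /andP[/eqP d0 _].
  by apply: le_trans cd; apply: le_trans (Im_le_nrmc _); rewrite raddfB /= d0 subr0.
apply/ler_addgt0Pr => e e0.
have [d + cd] := h e e0; rewrite lecE /= => /andP[_ d0].
have := le_trans (Re_le_nrmc (c - d)) cd; rewrite raddfB /= ler_distl; lra.
Qed.

(** Grouped by label [t], the form is the sum over [t] of the squared moduli of the total
    coefficients at [t]. *)
Lemma gram_indicator_ge0 (T : eqType) (L : seq (R[i] * T)) :
  0 <= \sum_(x <- L) \sum_(y <- L) (x.1)^* * y.1 * (x.2 == y.2)%:R.
Proof.
have -> : \sum_(x <- L) \sum_(y <- L) (x.1)^* * y.1 * (x.2 == y.2)%:R =
   \sum_(t <- undup (map snd L)) (\sum_(x <- L | x.2 == t) x.1)^* * (\sum_(x <- L | x.2 == t) x.1).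
  under [RHS]eq_bigr => t _ do rewrite rmorph_sum /= mulr_suml big_mkcond.
  rewrite [RHS]exchange_big /=; apply: eq_big_seq => x xL.
  rewrite (bigD1_seq x.2) ?undup_uniq ?mem_undup ?map_f //= eqxx.
  rewrite [X in _ + X]big1 ?addr0 => [|t /negPf]; last by rewrite eq_sym => ->.
  rewrite mulr_sumr [RHS]big_mkcond; apply: eq_bigr => y _.
  by rewrite eq_sym; case: eqP; rewrite ?mulr1 ?mulr0.
by apply: sumr_ge0 => t _; rewrite mulrC mul_conjC_ge0.
Qed.

End ComplexLimits.

Section Torus.
Variables (R : realType) (r : nat).
Implicit Types (k l m n : degree r).

Definition torus := {z : 'I_r -> R[i] | forall i, `|z i| = 1}.

Definition zpow (z : torus) m : R[i] := \prod_i sval z i ^+ m i.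

Lemma zpow0 z : zpow z (degree0 r) = 1.
Proof. by rewrite /zpow big1 // => i _; rewrite ffunE expr0. Qed.

Lemma zpowD z m n : zpow z (degreeD m n) = zpow z m * zpow z n.
Proof. by rewrite /zpow -big_split /=; apply: eq_bigr => i _; rewrite ffunE exprD. Qed.

Lemma norm_zpow z m : `|zpow z m| = 1.
Proof.
by rewrite /zpow normr_prod big1 // => i _; rewrite normrX (svalP z) expr1n.
Qed.

Lemma zpow_conjV z m : (zpow z m)^* * zpow z m = 1.
Proof. by rewrite mulrC -normCK norm_zpow expr1n. Qed.

(** The value [-1] is what makes the mean of the identity and the gauge automorphism at [z]
    annihilate monomials of degree [k - l]. *)
Lemma torus_separates k l : k != l -> exists z : torus, zpow z k * (zpow z l)^* = -1.
Proof.
move=> kl; have [i ki] : exists i, k i != l i.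
  by apply/existsP; apply: contraNT kl => /existsPn h; apply/eqP/ffunP => i; apply/eqP/negPn/h.
have [d [d0 hd]] : exists d, (0 < d)%N /\ (k i = l i + d \/ l i = k i + d)%N.
  by exists (maxn (k i - l i) (l i - k i)); split; lia.
(* At a coordinate where [k] and [l] differ by [d], the torus point is a [d]-th root of [-1];
   elsewhere it is 1. *)
pose zeta : R[i] := d.-root (-1).
have zd : zeta ^+ d = -1 by exact: rootCK.
have nz : `|zeta| = 1.
  by apply/eqP; rewrite -(pexpr_eq1 d0) // -normrX zd normrN normr1.
have hz j : `|if j == i then zeta else 1| = 1 by case: eqP => // _; rewrite normr1.
have zp m : zpow (exist _ _ hz) m = zeta ^+ m i.
  rewrite /zpow (bigD1 i) //= eqxx big1 ?mulr1 // => j /negPf ->.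
  by rewrite expr1n.
have zz q : zeta ^+ q * (zeta ^+ q)^* = 1 by rewrite -normCK normrX nz !expr1n.
exists (exist _ _ hz); rewrite !zp; case: hd => ->.
  by rewrite addnC exprD -mulrA zz mulr1.
by rewrite exprD rmorphM /= mulrA zz mul1r zd rmorphN rmorph1.
Qed.

End Torus.

Section Gauge.
Variables (R : realType) (r : nat) (B : finType) (M : 'I_r -> rel B).
Hypotheses (H0 : RS_H0 M) (H1 : RS_H1 M) (H2 : RS_H2 M).
Variables (A : cstarAlgType R) (s : forall m : degree r, word M m -> A).
Hypothesis CK : is_CK_algebra s.
Implicit Types (k l m n : degree r) (a b : B) (x y : A) (z : torus R r) (zs : seq (torus R r)).
Local Notation word := (word M).
Local Notation S w := (s w).
Local Notation V a := (s (vertex M a)).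
Local Notation Q w := (s w * star (s w)).

Lemma gauge_ex z : exists f : {linear A -> A},
  star_hom f /\ forall m (u : word m), f (S u) = zpow z m *: S u.
Proof.
have [[[h1 h1'] h2 h3 h4] _ univ] := CK.
have zz m (u v : word m) : star (zpow z m *: S u) * (zpow z m *: S v) = star (S u) * S v.
  by rewrite starZ -scalerAl -scalerAr scalerA zpow_conjV scale1r.
have zz' m (u : word m) : (zpow z m *: S u) * star (zpow z m *: S u) = Q u.
  by rewrite starZ -scalerAl -scalerAr scalerA mulrC zpow_conjV scale1r.
apply: (univ A (fun m u => zpow z m *: S u)); split.
- by split=> [a|a b ab]; rewrite zpow0 !scale1r; [exact: h1|exact: h1'].
- move=> m n u v w uv c; rewrite (h2 _ _ u v w) // zpowD.
  by rewrite -scalerAl -scalerAr scalerA.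
- by move=> m u; rewrite zz zpow0 scale1r; exact: h3.
- move=> a n; rewrite zpow0 scale1r (h4 a n).
  by apply: eq_bigr => u _; rewrite zz'.
Qed.

Definition gauge z : {linear A -> A} := sval (cid (gauge_ex z)).

Lemma gauge_star_hom z : star_hom (gauge z).
Proof. by have [] := svalP (cid (gauge_ex z)). Qed.

Lemma gaugeM z x y : gauge z (x * y) = gauge z x * gauge z y.
Proof. by have [h _] := gauge_star_hom z; exact: h. Qed.

Lemma gauge_star z x : gauge z (star x) = star (gauge z x).
Proof. by have [_ h] := gauge_star_hom z; exact: h. Qed.

Lemma gaugeS z m (u : word m) : gauge z (S u) = zpow z m *: S u.
Proof. by have [_ h] := svalP (cid (gauge_ex z)); exact: h. Qed.

Lemma gauge_le z x : cnorm (gauge z x) <= cnorm x.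
Proof. exact: star_hom_contractive (gauge_star_hom z). Qed.

Lemma gauge_mono z m n (u : word m) (v : word n) :
  gauge z (S u * star (S v)) = (zpow z m * (zpow z n)^*) *: (S u * star (S v)).
Proof. by rewrite gaugeM gauge_star !gaugeS starZ -scalerAl -scalerAr scalerA. Qed.

Lemma gaugeB z x y : gauge z (x - y) = gauge z x - gauge z y.
Proof. exact: linearB. Qed.

Lemma gaugeD z x y : gauge z (x + y) = gauge z x + gauge z y.
Proof. exact: linearD. Qed.

Lemma gaugeZ z c x : gauge z (c *: x) = c *: gauge z x.
Proof. exact: linearZ. Qed.

Lemma gaugeC z z' x : gauge z (gauge z' x) = gauge z' (gauge z x).
Proof.
move: x; apply: (ck_ind H1 CK).
- by move=> m n u v; rewrite !gauge_mono !gaugeZ !gauge_mono !scalerA mulrC.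
- by move=> x y hx hy; rewrite !gaugeD hx hy.
- by move=> c x hx; rewrite !gaugeZ hx.
move=> x h; apply: subr0_eq.
apply: (@limit_eq0 _ _ (fun x => gauge z (gauge z' x) - gauge z' (gauge z x)) 2).
- by move=> y y'; rewrite !gaugeB subrBACA.
- move=> y; apply: le_trans (cnormB_le _ _) _.
  have := le_trans (gauge_le z _) (gauge_le z' y).
  have := le_trans (gauge_le z' _) (gauge_le z y); lra.
by move=> e /h [y hy yx]; exists y; rewrite ?hy ?subrr.
Qed.

(** A composition of the averages [(id + gauge z) / 2], a finite substitute for the integral over
    the torus. The averages commute, so further ones do not spoil what earlier ones achieved. *)
Definition gauge_mean zs x : A :=
  foldr (fun z y => (2^-1 : R)%:C *: (y + gauge z y)) x zs.

Lemma gauge_mean_cat zs zs' x :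
  gauge_mean (zs ++ zs') x = gauge_mean zs (gauge_mean zs' x).
Proof. by rewrite /gauge_mean foldr_cat. Qed.

Lemma gauge_meanD zs x y : gauge_mean zs (x + y) = gauge_mean zs x + gauge_mean zs y.
Proof. by elim: zs => //= z zs ->; rewrite gaugeD addrACA scalerDr. Qed.

Lemma gauge_meanZ zs c x : gauge_mean zs (c *: x) = c *: gauge_mean zs x.
Proof. by elim: zs => //= z zs ->; rewrite gaugeZ -scalerDr !scalerA mulrC. Qed.

Lemma gauge_mean0 zs : gauge_mean zs 0 = 0.
Proof. by rewrite -(scale0r 0) gauge_meanZ !scale0r. Qed.

Lemma gauge_meanB zs x y : gauge_mean zs (x - y) = gauge_mean zs x - gauge_mean zs y.
Proof. by rewrite gauge_meanD -scaleN1r gauge_meanZ scaleN1r. Qed.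

Lemma gauge_mean_le zs x : cnorm (gauge_mean zs x) <= cnorm x.
Proof.
elim: zs => //= z zs IH; rewrite cnormZr ger0_norm ?invr_ge0 //.
set y := gauge_mean zs x in IH *; rewrite -/y in IH *.
have := cnormD_le y (gauge z y); have := gauge_le z y; lra.
Qed.

Lemma gauge_gauge_mean z zs x : gauge z (gauge_mean zs x) = gauge_mean zs (gauge z x).
Proof.
elim: zs => //= z' zs IH; rewrite gaugeZ gaugeD -IH; congr (_ *: (_ + _)).
exact: gaugeC.
Qed.

Lemma gauge_meanC zs zs' x :
  gauge_mean zs (gauge_mean zs' x) = gauge_mean zs' (gauge_mean zs x).
Proof.
by elim: zs => //= z zs ->; rewrite gauge_gauge_mean -gauge_meanD -gauge_meanZ.
Qed.

Lemma gauge_Q z m (u : word m) : gauge z (Q u) = Q u.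
Proof. by rewrite gauge_mono mulrC zpow_conjV scale1r. Qed.

Lemma gauge_mean_Q zs m (u : word m) x :
  gauge_mean zs (Q u * x * Q u) = Q u * gauge_mean zs x * Q u.
Proof.
elim: zs => //= z zs ->; rewrite !gaugeM -!gaugeM.
rewrite [gauge z _]gaugeM gauge_Q gaugeM gauge_Q -mulrDl -mulrDr.
by rewrite -scalerAr -scalerAl.
Qed.

Section State.
Variable xi : degree r -> B.
Hypothesis xiP : infinite_path M xi.

Lemma path_prefix_ex m : exists u : word m, forall l, degree_le l m -> letter u l = xi l.
Proof. by apply: word_of_fun => l j _; exact: xiP. Qed.

Definition path_prefix m : word m := sval (cid (path_prefix_ex m)).
Local Notation P m := (Q (path_prefix m)).

Lemma path_prefixE m l : degree_le l m -> letter (path_prefix m) l = xi l.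
Proof. exact: (svalP (cid (path_prefix_ex m))). Qed.

Lemma path_prefix_cat m n : degree_le m n ->
  exists v : word (degree_sub n m), is_cat (path_prefix m) v (path_prefix n).
Proof.
move=> mn; have [u [v c]] := cat_split (path_prefix n) (degree_subKC mn).
exists v; suff -> : path_prefix m = u by [].
apply: word_ext => l lm; case: c => _ <- // _.
by rewrite !path_prefixE // (degree_le_trans lm).
Qed.

Lemma path_prefix_mul m n : degree_le m n -> P n * P m = P n /\ P m * P n = P n.
Proof.
move=> /path_prefix_cat [v c].
have e : P n * P m = P n.
  rewrite mulrA -[_ * _ * S (path_prefix m)]mulrA (ck_starS_cat CK _ c) eqxx.
  by rewrite -mulrA -starM -(ck_cat CK c).
split=> //; have [ps _] := ck_proj CK (path_prefix n).
have [pm _] := ck_proj CK (path_prefix m).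
by rewrite -{2}ps -{2}e starM pm ps.
Qed.

(** Averaged and compressed to a long prefix of the path, [x] is nearly the scalar [c]. Uniformity
    in [m] and in the further averages [zs] allows two such limits to be compared at a common prefix
    and a common list. *)
Definition state_limit x (c : R[i]) := forall eps : R, 0 < eps ->
  exists m0 zs0, forall m zs, degree_le m0 m ->
    cnorm (P m * gauge_mean zs (gauge_mean zs0 x) * P m - c *: P m) <= eps.

Lemma P_compress_le m x : cnorm (P m * x * P m) <= cnorm x.
Proof.
apply: le_trans (cnormM_le _ _) _; rewrite (cnorm_Q H1 H2 CK) mulr1.
by apply: le_trans (cnormM_le _ _) _; rewrite (cnorm_Q H1 H2 CK) mul1r.
Qed.

Lemma zmod_telescope (U : zmodType) (a b c d : U) : c - d = (b - d) - (a - c) + (a - b).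
Proof. by rewrite subrBACA addrAC -[b - a]opprB addNr sub0r opprB. Qed.

(** Compressions and means are contractive and [|P m| = 1], so [c - d] can be read off at a common
    prefix. For [x = y] this is uniqueness of the value; in general it is continuity of the
    state. *)
Lemma state_limit_diff x y c d : state_limit x c -> state_limit y d ->
  nrmc (c - d) <= cnorm (x - y).
Proof.
move=> hx hy; apply/ler_addgt0Pr => e e0; have e20 : 0 < e / 2 by lra.
have [m1 [zs1 h1]] := hx _ e20; have [m2 [zs2 h2]] := hy _ e20.
pose m := degreeD m1 m2.
have {}h1 := h1 m zs2 (degree_leDl _ _); have {}h2 := h2 m zs1 (degree_leDr _ _).
rewrite gauge_meanC in h1.
set E := (fun x => gauge_mean zs1 (gauge_mean zs2 x)) in h1 h2.
have -> : nrmc (c - d) = cnorm ((c - d) *: P m) by rewrite cnormZE (cnorm_Q H1 H2 CK) mulr1.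
have -> : (c - d) *: P m = (P m * E y * P m - d *: P m) - (P m * E x * P m - c *: P m)
    + P m * E (x - y) * P m.
  rewrite /E !gauge_meanB mulrBr mulrBl scalerBl; exact: zmod_telescope.
have e1 : cnorm (P m * E (x - y) * P m) <= cnorm (x - y).
  apply: le_trans (P_compress_le _ _) _; rewrite /E.
  exact: le_trans (gauge_mean_le _ _) (gauge_mean_le _ _).
apply: le_trans (cnormD_le _ _) _.
apply: le_trans (lerD (cnormB_le _ _) e1) _; rewrite addrC lerD2l.
have := h1; have := h2; rewrite /E; lra.
Qed.

Lemma state_limitD x y c d : state_limit x c -> state_limit y d -> state_limit (x + y) (c + d).
Proof.
move=> hx hy e e0; have e20 : 0 < e / 2 by lra.
have [m1 [zs1 h1]] := hx _ e20; have [m2 [zs2 h2]] := hy _ e20.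
exists (degreeD m1 m2), (zs1 ++ zs2) => m zs mm.
have {}h1 := h1 m (zs ++ zs2) (degree_le_trans (degree_leDl _ _) mm).
have {}h2 := h2 m (zs ++ zs1) (degree_le_trans (degree_leDr _ _) mm).
rewrite gauge_mean_cat (gauge_meanC zs2) in h1; rewrite gauge_mean_cat in h2.
rewrite gauge_mean_cat !gauge_meanD mulrDr mulrDl scalerDl opprD addrACA.
by apply: le_trans (cnormD_le _ _) _; lra.
Qed.

Lemma state_limitZ (q : R[i]) x c : state_limit x c -> state_limit (q *: x) (q * c).
Proof.
move=> hx e e0; have n0 := nrmc_ge0 q.
have [|m1 [zs1 h1]] := hx (e / (nrmc q + 1)); first by rewrite divr_gt0 //; lra.
exists m1, zs1 => m zs /(h1 m zs) {}h1.
rewrite !gauge_meanZ -scalerAr -scalerAl -scalerA -scalerBr cnormZE.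
move: h1; rewrite ler_pdivlMr; last lra.
set t := cnorm _; have : 0 <= t by exact: cnorm_ge0.
nra.
Qed.

Lemma gauge_mean_fixed zs x : (forall z, gauge z x = x) -> gauge_mean zs x = x.
Proof. by move=> h; elim: zs => //= z zs ->; rewrite h scale_half_double. Qed.

Lemma state_limit_diag m (u v : word m) :
  state_limit (S u * star (S v)) ((u == path_prefix m) && (v == path_prefix m))%:R.
Proof.
move=> e e0; exists m, [::] => n zs mn.
rewrite /= gauge_mean_fixed; last first.
  by move=> z; rewrite gauge_mono mulrC zpow_conjV scale1r.
have [w c] := path_prefix_cat mn.
set p := path_prefix n in c *.
have -> : Q p * (S u * star (S v)) * Q p =
    S p * (star (S p) * S u) * (star (S v) * S p) * star (S p) by rewrite !mulrA.
rewrite (ck_starS_cat CK _ c) (ck_starS_cat' CK _ c) ![path_prefix m == _]eq_sym.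
case: (u == _); last by rewrite !(mulr0, mul0r) scale0r subr0 cnorm0 ltW.
case: (v == _); last by rewrite !(mulr0, mul0r) scale0r subr0 cnorm0 ltW.
rewrite scale1r -[S p * _ * _]mulrA (ck_star_mul CK).
by rewrite -(is_cat_terminus c) (ck_terminusr CK) subrr cnorm0 ltW.
Qed.

Lemma state_limit_offdiag m n (u : word m) (v : word n) : m != n ->
  state_limit (S u * star (S v)) 0.
Proof.
move=> mn e e0; have [z hz] := torus_separates R mn.
exists m, [:: z] => k zs _.
rewrite /= gauge_mono hz scaleN1r subrr scaler0 gauge_mean0.
by rewrite mulr0 mul0r scale0r subr0 cnorm0 ltW.
Qed.

Lemma state_limit_closed x : (forall eps : R, 0 < eps ->
  exists2 y, (exists c, state_limit y c) & cnorm (x - y) < eps) -> exists c, state_limit x c.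
Proof.
move=> h.
have pn (n : nat) : 0 < (n.+1%:R^-1 : R) by rewrite invr_gt0.
have Y (n : nat) : {yc : A * R[i] | state_limit yc.1 yc.2 /\ cnorm (x - yc.1) < n.+1%:R^-1}.
  by apply: cid; have [y [c yc] xy] := h _ (pn n); exists (y, c).
pose y (n : nat) := (sval (Y n)).1; pose c (n : nat) := (sval (Y n)).2.
have yc (n : nat) : state_limit (y n) (c n) by have [] := svalP (Y n).
have yx (n : nat) : cnorm (x - y n) < n.+1%:R^-1 by have [] := svalP (Y n).
have small (e : R) : 0 < e -> exists N, forall n : nat, (N <= n)%N -> n.+1%:R^-1 < e.
  move=> e0; exists (Num.truncn e^-1) => n' Nn.
  rewrite invf_plt ?posrE //; apply: lt_le_trans (truncnS_gt _) _.
  by rewrite ler_nat ltnS.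
have [l hl] : exists l : R[i], forall e : R, 0 < e -> exists N, forall n : nat, (N <= n)%N -> nrmc (c n - l) < e.
  apply: complex_complete => e e0; have e20 : 0 < e / 2 by lra.
  have [N hN] := small _ e20; exists N => m' n' Nm Nn.
  apply: le_lt_trans (state_limit_diff (yc m') (yc n')) _.
  have -> : y m' - y n' = (x - y n') - (x - y m') by rewrite opprB [RHS]addrC addrA subrK.
  apply: le_lt_trans (cnormB_le _ _) _.
  have := lt_trans (yx m') (hN _ Nm); have := lt_trans (yx n') (hN _ Nn); lra.
exists l => e e0; have e30 : 0 < e / 3 by lra.
have [N hN] := hl _ e30; have [N' hN'] := small _ e30.
pose n := maxn N N'; have {}hN := hN n (leq_maxl _ _); have {}hN' := hN' n (leq_maxr _ _).
have [m0 [zs0 h0]] := yc n _ e30; exists m0, zs0 => m zs /(h0 m zs) {}h0.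
set E := (fun x => gauge_mean zs (gauge_mean zs0 x)) in h0 *.
have -> : P m * gauge_mean zs (gauge_mean zs0 x) * P m - l *: P m =
   P m * E (x - y n) * P m + (P m * E (y n) * P m - c n *: P m) + (c n - l) *: P m.
  by rewrite /E !gauge_meanB mulrBr mulrBl scalerBl !addrA !subrK.
apply: le_trans (cnormD_le _ _) _; apply: le_trans (lerD (cnormD_le _ _) (lexx _)) _.
rewrite cnormZE (cnorm_Q H1 H2 CK) mulr1.
have e1 : cnorm (P m * E (x - y n) * P m) <= cnorm (x - y n).
  apply: le_trans (P_compress_le _ _) _; rewrite /E.
  exact: le_trans (gauge_mean_le _ _) (gauge_mean_le _ _).
have := lt_trans (yx n) hN'; move: h0; rewrite /E; lra.
Qed.

Lemma state_limit_ex x : exists c, state_limit x c.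
Proof.
move: x; apply: (ck_ind H1 CK).
- move=> m n u v; have [e|ne] := eqVneq m n; last by exists 0; exact: state_limit_offdiag.
  by subst n; eexists; exact: state_limit_diag.
- by move=> x y [c hc] [d hd]; exists (c + d); exact: state_limitD.
- by move=> q x [c hc]; exists (q * c); exact: state_limitZ.
exact: state_limit_closed.
Qed.

Definition path_state x : R[i] := sval (cid (state_limit_ex x)).
Local Notation tau := path_state.

Lemma path_stateE x c : state_limit x c -> tau x = c.
Proof.
move=> h; apply: subr0_eq; apply: nrmc_eq0 => e e0.
have := state_limit_diff (svalP (cid (state_limit_ex x))) h.
by rewrite subrr cnorm0 => h'; apply: le_trans h' (ltW e0).
Qed.

Lemma path_stateP x : state_limit x (tau x).
Proof. exact: (svalP (cid (state_limit_ex x))). Qed.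

Lemma path_stateD x y : tau (x + y) = tau x + tau y.
Proof. by apply/path_stateE/state_limitD; exact: path_stateP. Qed.

Lemma path_stateZ c x : tau (c *: x) = c * tau x.
Proof. by apply/path_stateE/state_limitZ/path_stateP. Qed.

Lemma path_state0 : tau 0 = 0.
Proof. by rewrite -(scale0r 0) path_stateZ mul0r. Qed.

Lemma path_state_sum (I : Type) (t : seq I) (D : pred I) (F : I -> A) :
  tau (\sum_(i <- t | D i) F i) = \sum_(i <- t | D i) tau (F i).
Proof. by apply: (big_morph _ path_stateD path_state0). Qed.

Lemma path_state_le x : nrmc (tau x) <= cnorm x.
Proof.
by have := state_limit_diff (path_stateP x) (path_stateP 0); rewrite path_state0 !subr0.
Qed.

Lemma path_state_diag m (u v : word m) :
  tau (S u * star (S v)) = ((u == path_prefix m) && (v == path_prefix m))%:R.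
Proof. exact/path_stateE/state_limit_diag. Qed.

Lemma path_state_gauge z x : tau (gauge z x) = tau x.
Proof.
apply: path_stateE => e e0; have [m0 [zs0 h]] := path_stateP x e0.
exists m0, zs0 => m zs mm; apply: le_trans (h m zs mm).
rewrite -!gauge_gauge_mean -{1 2 3}(gauge_Q z (path_prefix m)) -!gaugeM -gaugeZ -gaugeB.
exact: gauge_le.
Qed.

Lemma path_state_compress m x : tau (P m * x * P m) = tau x.
Proof.
apply: path_stateE => e e0; have [m0 [zs0 h]] := path_stateP x e0.
exists (degreeD m0 m), zs0 => n zs nn.
have := h n zs (degree_le_trans (degree_leDl _ _) nn).
have [e1 e2] := path_prefix_mul (degree_le_trans (degree_leDr _ _) nn).
rewrite !gauge_mean_Q; set y := gauge_mean zs _.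
have -> // : P n * (P m * y * P m) * P n = P n * y * P n.
by transitivity ((P n * P m) * y * (P m * P n)); [rewrite !mulrA | rewrite e1 e2].
Qed.

Lemma path_state_prefix m : tau (P m) = 1.
Proof. by rewrite path_state_diag eqxx. Qed.

Lemma path_state1 : tau 1 = 1.
Proof.
rewrite -(path_state_compress (degree0 r)) mulr1.
by rewrite (ck_proj CK (path_prefix (degree0 r))).2 path_state_prefix.
Qed.

Lemma path_state_vertex a : tau (V a) = (a == xi (degree0 r))%:R.
Proof.
rewrite -{1}(ck_vertex_star CK).
have -> : star (V a) = V a * star (V a).
  by rewrite (ck_vertex_star CK) (ck_vertex_mul CK) eqxx.
rewrite path_state_diag andbb; congr (nat_of_bool _)%:R.
have e : path_prefix (degree0 r) = vertex M (xi (degree0 r)).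
  by rewrite [LHS]word0E /origin path_prefixE // degree_le0.
apply/eqP/eqP => [|->]; last by rewrite e.
by rewrite e => /(congr1 (@origin _ _ M _)); rewrite !origin_vertex.
Qed.

Lemma path_state_eigen0 z x : gauge z x = - x -> tau x = 0.
Proof.
move=> e; have := path_state_gauge z x; rewrite e -scaleN1r path_stateZ mulN1r.
by move/esym/eqP; rewrite -addr_eq0 -mulr2n mulrn_eq0 => /eqP.
Qed.

(** Conjugated by the prefix, the state makes the words with its terminus orthonormal, across all
    shapes: equal shapes by [ck_starS], different ones by gauge invariance. *)
Lemma path_state_pair m n n' (v : word n) (v' : word n') :
  terminus v = terminus (path_prefix m) ->
  tau (S (path_prefix m) * (star (S v) * S v') * star (S (path_prefix m))) =
  (Tagged word v == Tagged word v')%:R.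
Proof.
move=> tv; have [e|ne] := eqVneq n n'.
  subst n'; rewrite eq_Tagged /= (ck_starS CK); case: eqP => _.
    by rewrite tv (ck_terminusr CK) path_state_prefix.
  by rewrite mulr0 mul0r path_state0.
have -> : (Tagged word v == Tagged word v') = false.
  by apply/negbTE; apply: contra ne => /eqP/(congr1 (@tag _ _))/= ->.
have [z hz] := torus_separates R ne.
apply: (@path_state_eigen0 z).
have hz' : zpow z n' * (zpow z n)^* = -1.
  by rewrite -[LHS]conjCK rmorphM /= conjCK mulrC hz rmorphN rmorph1.
rewrite !gaugeM !gauge_star !gaugeS !starZ.
rewrite -!(scalerAl, scalerAr) !scalerA -scaleN1r; congr (_ *: _).
rewrite -hz'; set a := zpow z m; set b := zpow z n; set c := zpow z n'.
have : a^* * a = 1 by exact: zpow_conjV.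
move=> aa; rewrite -[RHS]mul1r -aa; ring.
Qed.

(** Once [w] is at least as long as every [v] occurring in a monomial [s_u s_v^*] of [x], the
    product with [s_w] contains no adjoints. *)
Lemma monomial_span_expand x : monomial_span s x ->
  exists m0, forall m (w : word m), degree_le m0 m ->
    exists2 L : seq (R[i] * {n & word n}),
      x * S w = \sum_(q <- L) q.1 *: S (tagged q.2) &
      {in L, forall q, terminus (tagged q.2) = terminus w}.
Proof.
elim=> [m n u v|x1 x2 _ [m1 h1] _ [m2 h2]|c x1 _ [m1 h1]].
- exists n => k w nk.
  have [v' [w' cw]] := cat_split w (degree_subKC nk).
  rewrite -mulrA (ck_starS_cat' CK v cw); case: eqP => _; last first.
    by exists [::] => //; rewrite mulr0 big_nil.
  have [->|[p [cp ->]]] := ck_mulS H1 CK u w'; first by exists [::] => //; rewrite big_nil.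
  exists [:: (1, Tagged word p)]; first by rewrite big_seq1 /= scale1r.
  by move=> q; rewrite inE => /eqP -> /=; rewrite (is_cat_terminus cp) (is_cat_terminus cw).
- exists (degreeD m1 m2) => m w mm.
  have [L1 e1 t1] := h1 m w (degree_le_trans (degree_leDl _ _) mm).
  have [L2 e2 t2] := h2 m w (degree_le_trans (degree_leDr _ _) mm).
  exists (L1 ++ L2); first by rewrite mulrDl e1 e2 big_cat.
  by move=> q; rewrite mem_cat => /orP[/t1|/t2].
exists m1 => m w /(h1 m w) [L e t].
exists [seq (c * q.1, q.2) | q <- L].
  by rewrite -scalerAl e big_map scaler_sumr; apply: eq_bigr => q _; rewrite scalerA.
by move=> _ /mapP[q /t tq ->].
Qed.

(** For sums of monomials, compression to a long prefix [w] turns [x^* x] into the square of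
    [x s_w], a combination of words, and the value is the form of [gram_indicator_ge0]. Density
    gives the rest. *)
Lemma path_state_ge0 x : 0 <= tau (star x * x).
Proof.
have mono y : monomial_span s y -> 0 <= tau (star y * y).
  move=> /monomial_span_expand [m h].
  have [L e t] := h m (path_prefix m) (degree_le_refl m).
  rewrite -(path_state_compress m).
  set w := path_prefix m in e t *.
  have -> : Q w * (star y * y) * Q w = S w * (star (y * S w) * (y * S w)) * star (S w).
    by rewrite starM !mulrA.
  rewrite e star_sum mulr_suml mulr_sumr mulr_suml path_state_sum.
  rewrite [X in 0 <= X](_ : _ =
      \sum_(p <- L) \sum_(q <- L) (p.1)^* * q.1 * (p.2 == q.2)%:R).
    exact: gram_indicator_ge0.
  apply: eq_big_seq => p pL; rewrite mulr_sumr mulr_sumr mulr_suml path_state_sum.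
  apply: eq_bigr => q _; rewrite starZ -!(scalerAl, scalerAr) !path_stateZ.
  by rewrite path_state_pair ?t // !Tagged_eta; ring.
apply: nonneg_limit => e e0.
have x0 := cnorm_ge0 x.
(* [K] bounds [|x| + |y|] for every [y] with [|x - y| < 1]. *)
pose K := 2 * cnorm x + 1.
have d0 : 0 < Num.min 1 (e / K) by rewrite lt_min ltr01 divr_gt0 // /K; lra.
have [y my yx] := monomial_span_dense H1 CK x d0.
exists (tau (star y * y)); first exact: mono.
move: yx; rewrite lt_min => /andP[y1]; rewrite ltr_pdivlMr; last by rewrite /K; lra.
rewrite /K => yK.
have -> : tau (star x * x) - tau (star y * y) = tau (star x * (x - y) + star (x - y) * y).
  rewrite -mulN1r -path_stateZ -path_stateD scaleN1r; congr tau.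
  by rewrite starB mulrBr mulrBl addrA subrK.
apply: le_trans (path_state_le _) _; apply: le_trans (cnormD_le _ _) _.
have := cnormM_le (star x) (x - y); have := cnormM_le (star (x - y)) y.
rewrite !cnorm_star.
have : cnorm y <= cnorm x + cnorm (x - y).
  by have := cnormB_le x (x - y); rewrite opprB addrC subrK.
have := cnorm_ge0 (x - y); nra.
Qed.

End State.
End Gauge.

(** * Minimal projections and states *)

Section MaximalAbelian.
Variables (R : realType) (C : cstarAlgType R).
Implicit Types (x y e p q h c : C) (S : set C).

(* The double commutant of S together with x is an abelian star-subalgebra. *)
Lemma maximal_abelian_mem S x : maximal_abelian S -> star x = x ->
  (forall y, S y -> x * y = y * x) -> S x.
Proof.
move=> [[[S0 SD SZ SM Ss] Sc] Smax] xs xS.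
pose G : set C := [set y | S y \/ y = x].
pose comm (E : set C) : set C := [set y | forall z, E z -> y * z = z * y].
pose T := comm (comm G).
have Gs y : G y -> G (star y).
  by case=> [/Ss|->]; [left|right].
have GG y z : G y -> G z -> y * z = z * y.
  move=> [Sy|->] [Sz|->] //; first exact: Sc.
    by rewrite xS.
  exact: xS.
have GT : G `<=` T by move=> y Gy z cz; rewrite cz.
have Tc y z : T y -> T z -> y * z = z * y.
  move=> Ty Tz; apply: Ty => w Gw; apply/Tz => v cv; exact: GG.
have commS (E : set C) : (forall y, E y -> E (star y)) ->
    star_subalgebra (comm E).
  move=> Es; split.
  - by move=> z _; rewrite mul0r mulr0.
  - by move=> y y' a b z Ez; rewrite mulrDl mulrDr a // b.
  - by move=> c y a z Ez; rewrite -scalerAl -scalerAr a.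
  - by move=> y y' a b z Ez; rewrite -mulrA b // mulrA a // mulrA.
  - move=> y a z Ez; rewrite -[z]starK -!starM; congr star.
    by rewrite a //; exact: Es.
have [c0 cD cZ cM cs] := commS G Gs.
have TS : T = S.
  apply: Smax; last by move=> y Sy; apply: GT; left.
  by split=> //; exact: commS.
by rewrite -TS; apply: GT; right.
Qed.

Lemma has_dim_dependent S k l (x : 'I_l -> C) : has_dim S k -> (forall i, S (x i)) ->
  (k < l)%N -> exists2 v : 'I_l -> R[i], (exists i, v i != 0) & \sum_i v i *: x i = 0.
Proof.
move=> [b bS _] xS kl.
have co i : {c : 'I_k -> R[i] | x i = \sum_j c j *: b j}.
  by apply: cid; apply/bS.
pose X := \matrix_(i < l, j < k) sval (co i) j.
have nz : kermx X != 0.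
  rewrite -mxrank_eq0 mxrank_ker subn_eq0 -ltnNge.
  exact: leq_ltn_trans (rank_leq_col X) kl.
have [i [j ij]] : exists i j, kermx X i j != 0.
  apply: contrapT => h; move/eqP: nz; apply; apply/matrixP => i j; rewrite [RHS]mxE.
  by apply/eqP/negPn/negP => hij; apply: h; exists i, j.
exists (fun j => kermx X i j); first by exists j.
under eq_bigr => a _ do rewrite (svalP (co a)) scaler_sumr.
rewrite exchange_big big1 //= => a _.
under eq_bigr => d _ do rewrite scalerA.
rewrite -scaler_suml.
suff -> : \sum_d kermx X i d * sval (co d) a = 0 by rewrite scale0r.
have /matrixP /(_ i a) := mulmx_ker X; rewrite mxE [RHS]mxE => h; rewrite -[RHS]h.
by apply: eq_bigr => d _; rewrite [X d a]mxE.
Qed.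

Definition proj_family S l (e : 'I_l -> C) :=
  [/\ forall i, S (e i), forall i, is_proj (e i), forall i, e i != 0
    & forall i j, i != j -> e i * e j = 0].

Lemma proj_family_le S k l (e : 'I_l -> C) : has_dim S k -> proj_family S e -> (l <= k)%N.
Proof.
move=> dS [eS ep e0 eo]; rewrite leqNgt; apply/negP => kl.
have [v [i vi] vx] := has_dim_dependent dS eS kl.
have := congr1 (fun y => e i * y) vx; rewrite mulr0 mulr_sumr (bigD1 i) //=.
rewrite -scalerAr (ep i).2 big1 ?addr0 => [|j ji]; last first.
  by rewrite -scalerAr eo ?scaler0 // eq_sym.
by move/eqP; rewrite scaler_eq0 (negPf vi) (negPf (e0 i)).
Qed.

Lemma proj_family_extend S l (e : 'I_l -> C) f : proj_family S e -> S f -> is_proj f ->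
  f != 0 -> (forall i, e i * f = 0) -> exists e' : 'I_l.+1 -> C, proj_family S e'.
Proof.
move=> [eS ep e0 eo] fS fp f0 ef.
have fe i : f * e i = 0 by rewrite -fp.1 -(ep i).1 -starM ef star0.
exists (fun i => oapp e f (unlift ord_max i)); split.
- by move=> i; case: unliftP => [j _|_] /=; [exact: eS|].
- by move=> i; case: unliftP => [j _|_] /=; [exact: ep|].
- by move=> i; case: unliftP => [j _|_] /=; [exact: e0|].
move=> i j; case: unliftP => [i' ->|->]; case: unliftP => [j' ->|->] //=.
- by rewrite (inj_eq lift_inj) => /eo.
- by rewrite eqxx.
Qed.

Lemma sum_proj (l : nat) (e : 'I_l -> C) : (forall i, is_proj (e i)) ->
  (forall i j, i != j -> e i * e j = 0) ->
  forall i, e i * (\sum_j e j) = e i /\ (\sum_j e j) * e i = e i.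
Proof.
move=> ep eo i; rewrite mulr_sumr mulr_suml !(bigD1 i (P := predT)) //= (ep i).2.
rewrite !big1 ?addr0 // => j ji; first exact: eo.
by apply: eo; rewrite eq_sym.
Qed.

Lemma selfadj_sq_eq0 x : star x * x = 0 -> x = 0.
Proof.
move=> h; apply: cnorm0_eq0; apply/eqP; rewrite -sqrf_eq0 -cnorm_star_mul h cnorm0 //.
Qed.

Section Minimal.
Variables (S : set C) (k : nat).
Hypotheses (Smax : maximal_abelian S) (Sdim : has_dim S k).

Lemma maximal_abelian1 : S 1.
Proof. by apply: (maximal_abelian_mem Smax) => [|y _]; rewrite ?star1 // mul1r mulr1. Qed.

Lemma maximal_abelian_poly h (f : {poly R[i]}) : S h -> S (horner_alg h f).
Proof.
have [[[S0 SD SZ SM _] _] _] := Smax; move=> Sh.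
elim/poly_ind: f => [|f c IH]; first by rewrite rmorph0.
rewrite rmorphD rmorphM /= horner_algX horner_algC; apply: SD; first exact: SM.
by apply: SZ; exact: maximal_abelian1.
Qed.

Lemma horner_alg_eigen h p (la : R[i]) (f : {poly R[i]}) : h * p = la *: p ->
  horner_alg h f * p = f.[la] *: p.
Proof.
move=> hp; elim/poly_ind: f => [|f c IH]; first by rewrite rmorph0 mul0r horner0 scale0r.
rewrite rmorphD rmorphM /= horner_algX horner_algC mulrDl -mulrA hp -scalerAr IH.
by rewrite -scalerAl mul1r hornerMXaddC scalerDl scalerA mulrC.
Qed.

(** For a polynomial [f] of least degree with [f(h) e = 0] and a root [la] of it, put
    [g = f / (X - la)]. Then [g(h) e] is nonzero by minimality, is an eigenvector of [h], and has a
    multiple that is a projection. *)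
Lemma corner_spectrum e h : S e -> is_proj e -> e != 0 -> S h ->
  exists q (la : R[i]), [/\ S q, is_proj q, q != 0, q * e = q & h * q = la *: q].
Proof.
have [[[S0 SD SZ SM Ss] Sc] _] := Smax; move=> Se [es ee] e0 Sh.
have Sp := maximal_abelian_poly _ Sh.
have [f0 [f0n f0e]] : exists f : {poly R[i]}, f != 0 /\ horner_alg h f * e = 0.
  have [|v [i vi] vx] := @has_dim_dependent S k k.+1 (fun i => h ^+ i * e) Sdim _ (leqnn _).
    move=> i; apply: SM => //; have := Sp 'X^i.
    by rewrite rmorphXn /= horner_algX.
  exists (\poly_(i < k.+1) (if insub i is Some j then v j else 0)); split.
    apply/eqP => /polyP /(_ i); rewrite coef_poly coef0 ltn_ord.
    by rewrite insubT //= => iP; apply/eqP; rewrite [Sub _ _](_ : _ = i) //; apply: val_inj.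
  rewrite poly_def raddf_sum mulr_suml /= -[RHS]vx; apply: eq_bigr => j _.
  rewrite -mul_polyC rmorphM /= horner_algC rmorphXn /= horner_algX -scalerAl mul1r -scalerAl.
  by congr (_ *: _); rewrite insubT //= => iP; congr v; apply: val_inj.
have [f [fn fe fmin]] : exists f : {poly R[i]}, [/\ f != 0, horner_alg h f * e = 0
    & forall g : {poly R[i]}, g != 0 -> horner_alg h g * e = 0 -> (size f <= size g)%N].
  pose D d := `[< exists f : {poly R[i]}, [/\ f != 0, horner_alg h f * e = 0 & size f = d] >].
  have exD : exists d, D d by exists (size f0); apply/asboolP; exists f0.
  case: (ex_minnP exD) => d /asboolP [f [fn fe fd]] dmin.
  exists f; split=> // g gn ge; rewrite fd; apply: dmin; apply/asboolP.
  by exists g.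
have f1 : size f != 1%N.
  apply/negP => /size_poly1P [c cn fc]; move: fe; rewrite fc horner_algC.
  by rewrite -scalerAl mul1r => /eqP; rewrite scaler_eq0 (negPf cn) (negPf e0).
have [la fla] := closed_rootP f f1.
have [g fg] := factor_theorem _ _ fla.
have gn : g != 0 by apply: contraNneq fn => g0; rewrite fg g0 mul0r.
pose p := horner_alg h g * e.
have pn : p != 0.
  apply/eqP => p0; have := fmin g gn p0; rewrite fg size_Mmonic ?monicXsubC //.
  by rewrite size_XsubC addn2 /= ltnn.
have hp : h * p = la *: p.
  move: fe; rewrite fg mulrC rmorphM rmorphB /= horner_algX horner_algC -mulrA -/p.
  by rewrite mulrBl -scalerAl mul1r => /subr0_eq.
have SP : S p by apply: SM => //; exact: Sp.
have pe : p * e = p by rewrite /p -mulrA ee.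
have pp : p * p = g.[la] *: p.
  rewrite {1}/p -mulrA (Sc e p) // pe; exact: horner_alg_eigen.
clearbody p.
(* Otherwise [p * p = 0], but an abelian star-subalgebra has no nonzero nilpotent elements. *)
have gla : g.[la] != 0.
  apply/eqP => g0; rewrite g0 scale0r in pp.
  move/eqP: pn; apply; apply: selfadj_sq_eq0; apply: selfadj_sq_eq0.
  rewrite starM starK -!mulrA [p * (star p * p)]mulrA (Sc p (star p)) //; last exact: Ss.
  by rewrite -mulrA pp !mulr0.
pose q := g.[la]^-1 *: p.
have Sq : S q by exact: SZ.
have qq : q * q = q by rewrite -scalerAl -scalerAr pp !scalerA -mulrA mulVf // mulr1.
(* A normal idempotent is self-adjoint: [q - q^* q] has square norm zero. *)
have qsq : q = star q * q.
  apply: subr0_eq; apply: selfadj_sq_eq0.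
  have cs : star q * q = q * star q by apply: Sc => //; exact: Ss.
  have e1 : star q * (star q * q) = star q * q by rewrite mulrA -starM qq.
  have e2 : star q * q * q = star q * q by rewrite -mulrA qq.
  rewrite starB starM starK mulrBl !mulrBr e1 e2.
  by rewrite [star q * q * (star q * q)]mulrA -[star q * q * star q]mulrA -cs e1 e2 !subrr.
exists q, la; split=> //.
- by split=> //; rewrite qsq starM starK.
- by rewrite scaler_eq0 invr_eq0 (negPf gla) (negPf pn).
- by rewrite -scalerAl pe.
by rewrite -scalerAr hp !scalerA mulrC.
Qed.

(** Take an orthogonal family of projections in [S] of maximal length. It sums to 1, since otherwise
    the complement could be added, and [S] acts on each [e i] by scalars, since otherwise [e i]
    could be split. *)
Lemma minimal_projections : exists l (e : 'I_l -> C),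
  [/\ (l <= k)%N, forall i, is_proj (e i), forall i, e i != 0,
      \sum_i e i = 1 & forall i c, exists la : R[i], e i * c * e i = la *: e i].
Proof.
have [[[S0 SD SZ SM Ss] Sc] _] := Smax.
have [l [e [pf lmax]]] : exists l (e : 'I_l -> C), proj_family S e /\
    forall e' : 'I_l.+1 -> C, ~ proj_family S e'.
  pose D l := `[< exists e : 'I_l -> C, proj_family S e >].
  have exD : exists l, D l.
    by exists 0%N; apply/asboolP; exists (fun _ => 0); split; case.
  have ubD l : D l -> (l <= k)%N by move=> /asboolP [e]; exact: proj_family_le.
  case: (ex_maxnP exD ubD) => l /asboolP [e pf] lm; exists l, e; split=> // e' pf'.
  by have : (l.+1 <= l)%N; [apply: lm; apply/asboolP; exists e'|rewrite ltnn].
have [eS ep e0 eo] := pf.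
have S1 := maximal_abelian1.
have SN y : S y -> S (- y) by rewrite -scaleN1r; exact: SZ.
have Ssum : S (\sum_i e i) by apply: big_ind => // i _.
have sume := sum_proj ep eo.
have sum1 : \sum_i e i = 1.
  apply: contrapT => ne.
  have [|||i|e'] := @proj_family_extend S l e (1 - \sum_i e i) pf; last exact: lmax.
  - by apply: SD => //; exact: SN.
  - apply: is_projC; split; first by rewrite star_sum; apply: eq_bigr => i _; exact: (ep i).1.
    by rewrite [LHS]mulr_suml; apply: eq_bigr => i _; exact: (sume i).1.
  - by rewrite subr_eq0 eq_sym; apply/eqP.
  by rewrite mulrBr mulr1 (sume i).1 subrr.
have scal h i : S h -> exists la : R[i], h * e i = la *: e i.
  move=> Sh; have [q [la [Sq qp q0 qe hq]]] := corner_spectrum (eS i) (ep i) (e0 i) Sh.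
  have [qei|ne] := eqVneq q (e i); first by exists la; rewrite -qei.
  have eq_ : e i * q = q by rewrite Sc.
  (* If [q] is a proper part of [e i], replacing [e i] by [q] and [e i - q] lengthens the family. *)
  pose e' j := if j == i then q else e j.
  have ejq j : j != i -> e j * q = 0 by move=> ji; rewrite -eq_ mulrA eo // mul0r.
  have qej j : j != i -> q * e j = 0 by move=> ji; rewrite -qe -mulrA eo ?mulr0 // eq_sym.
  have pf' : proj_family S e'.
    split.
    - by move=> j; rewrite /e'; case: eqP => _; [exact: Sq|exact: eS].
    - by move=> j; rewrite /e'; case: eqP => _; [exact: qp|exact: ep].
    - by move=> j; rewrite /e'; case: (j == i); [exact: q0|exact: e0].
    move=> j j'; rewrite /e'; case: (eqVneq j i) => [->|ji]; case: (eqVneq j' i) => [_|ji'].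
    - by [].
    - by move=> _; exact: qej.
    - by move=> _; exact: ejq.
    exact: eo.
  have [|||j|e''] := @proj_family_extend S l e' (e i - q) pf'; last by move=> /lmax.
  - by apply: SD => //; exact: SN.
  - split; first by rewrite starB (ep i).1 qp.1.
    by rewrite mulrBl !mulrBr (ep i).2 eq_ qe qp.2 subrr subr0.
  - by rewrite subr_eq0 eq_sym.
  rewrite /e'; case: (eqVneq j i) => [_|ji]; first by rewrite mulrBr qe qp.2 subrr.
  by rewrite mulrBr ejq // eo // subrr.
(* Since [S] acts on [e i] by scalars, a self-adjoint [x] in the corner commutes with [S] and so
   belongs to it. General elements of the corner follow through real and imaginary parts. *)
have scal' i x : star x = x -> e i * x * e i = x -> exists la : R[i], x = la *: e i.
  move=> xs ex.
  have exi : e i * x = x by rewrite -ex !mulrA (ep i).2.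
  have xei : x * e i = x by rewrite -ex -!mulrA (ep i).2.
  have xe j : x * e j = if j == i then x else 0.
    case: (eqVneq j i) => [->//|ji]; by rewrite -xei -mulrA eo ?mulr0 // eq_sym.
  have ex' j : e j * x = if j == i then x else 0.
    case: (eqVneq j i) => [->//|ji]; by rewrite -exi mulrA eo ?mul0r.
  have Sx : S x.
    apply: (maximal_abelian_mem Smax) => // y Sy.
    rewrite -[y]mulr1 -sum1 !mulr_sumr !mulr_suml; apply: eq_bigr => j _.
    have [la ->] := scal y j Sy.
    by rewrite -scalerAr -scalerAl xe ex'.
  by have [la] := scal x i Sx; exists la; rewrite -xei.
exists l, e; split=> //; first exact: proj_family_le Sdim pf.
move=> i c; pose x := e i * c * e i.
have ex : e i * x * e i = x by rewrite /x !mulrA (ep i).2 -!mulrA (ep i).2.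
have sx : star x = e i * star c * e i by rewrite /x !starM !(ep i).1 mulrA.
have esx : e i * star x * e i = star x by rewrite sx !mulrA (ep i).2 -!mulrA (ep i).2.
have [a ha] : exists la : R[i], x + star x = la *: e i.
  apply: scal'; first by rewrite starD starK addrC.
  by rewrite mulrDr mulrDl ex esx.
have [b hb] : exists la : R[i], 'i *: (x - star x) = la *: e i.
  apply: scal'.
    by rewrite starZ conjCi starB starK -[in RHS]opprB scalerN scaleNr.
  by rewrite -scalerAr -scalerAl mulrBr mulrBl ex esx.
exists ((2^-1 : R)%:C * (a - 'i * b)).
rewrite -/x -scalerA scalerBl -ha -scalerA -hb scalerA.
have -> : ('i * 'i : R[i]) = -1 by exact: sqrCi.
rewrite scaleN1r opprK addrACA subrr addr0; exact/esym/scale_half_double.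
Qed.

End Minimal.
End MaximalAbelian.

(** * Positive forms, states and joint measurements *)

Section PositiveForms.
Variables (R : realType) (V : lmodType R[i]) (q : V -> V -> R[i]).
Hypotheses (qD : forall a b c, q a (b + c) = q a b + q a c)
  (qZ : forall (z : R[i]) a b, q a (z *: b) = z * q a b)
  (qC : forall a b, q b a = (q a b)^*) (q_ge0 : forall a, 0 <= q a a).

Lemma form_cauchy_schwarz a b : `|q a b| ^+ 2 <= q a a * q b b.
Proof.
set w := q a b; set x := q a a; set y := q b b.
have x0 : 0 <= x by exact: q_ge0.
have y0 : 0 <= y by exact: q_ge0.
have xr : x^* = x by apply/CrealP/ger0_real.
have yr : y^* = y by apply/CrealP/ger0_real.
have pos c : 0 <= x - c * w - c^* * w^* + c^* * c * y.
  have e : q (a + (- c) *: b) (a + (- c) *: b) = x - c * w - c^* * w^* + c^* * c * y.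
    set a' := a + _.
    rewrite {2}/a' qD qZ (qC a a') (qC b a') /a' !qD !qZ (qC a b) -/w -/x -/y.
    by rewrite !rmorphD /= !rmorphM /= rmorphN /= conjCK xr yr; ring.
  by rewrite -e.
rewrite normCK.
have [yz|yn] := eqVneq y 0.
  have [->|wn] := eqVneq w 0; first by rewrite mul0r mulr_ge0.
  have ww : 0 < w * w^* by rewrite -normCK exprn_gt0 // normr_gt0.
  (* With [y = 0] and [w] nonzero, [c] equal to this number times the conjugate of [w] would give
     the form the value [- (x + 2) < 0]. *)
  have tr : ((x + 1) / (w * w^*))^* = (x + 1) / (w * w^*).
    by apply/CrealP/ger0_real; rewrite divr_ge0 ?addr_ge0 // ltW.
  have := pos ((x + 1) / (w * w^*) * w^*).
  rewrite rmorphM /= tr conjCK yz mulr0 addr0.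
  have -> : x - (x + 1) / (w * w^*) * w^* * w - (x + 1) / (w * w^*) * w * w^* =
    x - (x + 1) - (x + 1) by field; rewrite wn conjC_eq0 wn.
  have -> : x - (x + 1) - (x + 1) = - (x + 2) by ring.
  rewrite oppr_ge0 => h; have := lt_le_trans (ltr_pwDr (ltr0Sn _ 1) x0) h.
  by rewrite ltxx.
have yp : 0 < y by rewrite lt_def yn y0.
have := pos (w^* / y).
rewrite rmorphM /= fmorphV /= conjCK yr.
have -> : x - w^* / y * w - w / y * w^* + w / y * (w^* / y) * y = x - w * w^* / y by field.
by rewrite subr_ge0 ler_pdivrMr.
Qed.

End PositiveForms.

Section States.
Variables (R : realType) (C : cstarAlgType R).
Implicit Types (a b x y : C) (f : C -> R[i]).

Definition is_state f :=
  [/\ forall x y, f (x + y) = f x + f y, forall c x, f (c *: x) = c * f x,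
      forall x, 0 <= f (star x * x) & f 1 = 1].

Section OneState.
Variable f : C -> R[i].
Hypothesis fS : is_state f.

Lemma state0 : f 0 = 0.
Proof. by have [_ fZ _ _] := fS; rewrite -(scale0r 0) fZ mul0r. Qed.

Lemma stateB x y : f (x - y) = f x - f y.
Proof. by have [fD fZ _ _] := fS; rewrite fD -scaleN1r fZ mulN1r. Qed.

Lemma state_sum (I : Type) (t : seq I) (D : pred I) (F : I -> C) :
  f (\sum_(i <- t | D i) F i) = \sum_(i <- t | D i) f (F i).
Proof. by have [fD _ _ _] := fS; apply: (big_morph _ fD state0). Qed.

Lemma state_conj a b : f (star b * a) = (f (star a * b))^*.
Proof.
have [fD fZ f0 _] := fS.
set u := f (star b * a); set v := f (star a * b).
have real x : (f (star x * x))^* = f (star x * x) by apply/CrealP/ger0_real.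
have e1 : (u + v)^* = u + v.
  have -> : u + v = f (star (a + b) * (a + b)) - f (star a * a) - f (star b * b).
    rewrite starD mulrDl !mulrDr !fD -/u -/v; ring.
  by rewrite !rmorphB /= !real.
have e2 : ('i * (u - v))^* = 'i * (u - v).
  have -> : 'i * (u - v) = f (star (a + (- 'i) *: b) * (a + (- 'i) *: b))
      - f (star a * a) - f (star b * b).
    rewrite starD starZ rmorphN /= conjCi opprK mulrDl !mulrDr -!(scalerAl, scalerAr).
    rewrite scalerA !fD !fZ -/u -/v.
    have -> : 'i * (- 'i) = 1 :> R[i] by rewrite mulrN -expr2 sqrCi opprK.
    ring.
  by rewrite !rmorphB /= !real.
move: e2; rewrite rmorphM /= conjCi rmorphB /= => e2.
have {}e2 : u - v = v^* - u^*.
  apply: (mulfI (neq0Ci R[i])); rewrite -e2; ring.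
move: e1; rewrite rmorphD /= => e1.
have : u + u = v^* + v^*.
  have -> : u + u = (u + v) + (u - v) by ring.
  rewrite e2 -e1; ring.
by rewrite -!mulr2n => /eqP; rewrite eqr_pMn2r // => /eqP.
Qed.

Lemma state_cauchy_schwarz a b :
  `|f (star a * b)| ^+ 2 <= f (star a * a) * f (star b * b).
Proof.
have [fD fZ f0 _] := fS.
apply: (@form_cauchy_schwarz _ C (fun a b => f (star a * b))) => //.
- by move=> x y z; rewrite mulrDr fD.
- by move=> c x y; rewrite -scalerAr fZ.
- exact: state_conj.
Qed.

End OneState.
End States.

Section JointMeasurement.
Variables (R : realType) (C : cstarAlgType R) (S : set C) (k : nat).
Hypotheses (Smax : maximal_abelian S) (Sdim : has_dim S k).
Variables (X : finType) (f : X -> C -> R[i]) (z h : X -> C) (w : X -> X -> R) (W : R).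
Hypotheses (f_state : forall x, is_state (f x))
  (z_sum : \sum_y star (z y) * z y = 1)
  (hE : forall x, star (h x) * h x = \sum_y (w x y)%:C *: (star (z y) * z y))
  (W_ge0 : 0 <= W) (w_sum : forall y, \sum_x w x y <= W).

(* With minimal projections e_i and e_i c e_i = g_i(c) e_i, Cauchy-Schwarz and
   the inequality of the means bound |f(e_i c e_j)| by
   (g_i(c) f(e_j) + g_j(c) f(e_i)) / 2, so f(c) <= sum_i g_i(c) for c = h^* h. *)
Lemma joint_measurement_bound : \sum_x f x (star (h x) * h x) <= (k%:R * W)%:C.
Proof.
have [l [e [lk ep en e1 ec]]] := minimal_projections Smax Sdim.
pose g i c := sval (cid (ec i c)).
have gE i c : e i * c * e i = g i c *: e i by exact: (svalP (cid (ec i c))).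
have gI i (a b : R[i]) : a *: e i = b *: e i -> a = b.
  move=> ab; apply/eqP; rewrite -subr_eq0; have : (a - b) *: e i = 0 by rewrite scalerBl ab subrr.
  by move/eqP; rewrite scaler_eq0 (negPf (en i)) orbF.
have gD i c d : g i (c + d) = g i c + g i d.
  by apply: (gI i); rewrite -gE mulrDr mulrDl !gE scalerDl.
have gZ i a c : g i (a *: c) = a * g i c.
  by apply: (gI i); rewrite -gE -scalerAr -scalerAl gE scalerA.
have g0 i : g i 0 = 0 by rewrite -(scale0r 0) gZ mul0r.
have gsum i (F : X -> C) : g i (\sum_y F y) = \sum_y g i (F y).
  exact: (big_morph _ (gD i) (g0 i)).
have g1 i : g i 1 = 1 by apply: (gI i); rewrite -gE mulr1 (ep i).2 scale1r.
pose P y := star (z y) * z y; pose H x := star (h x) * h x.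
have fe x i : 0 <= f x (e i).
  by have [_ _ h0 _] := f_state x; rewrite -(ep i).2 -{1}(ep i).1.
(* For an index charged by some state, [g i] inherits positivity from it, through [f x (e i * c^* *
   c * e i) = g i (c^* c) * f x (e i)]. *)
pose J i := [exists x, f x (e i) != 0].
have gP i c : J i -> 0 <= g i (star c * c).
  case/existsP => x xi; have [_ fZ f0 _] := f_state x.
  have := f0 (c * e i); rewrite starM (ep i).1 mulrA -[_ * star c * c]mulrA gE fZ.
  by rewrite pmulr_lge0 // lt_def xi fe.
have key x : f x (H x) <= \sum_(i | J i) g i (H x).
  have [fD fZ f0 f1] := f_state x.
  pose I i := f x (e i) != 0.
  have IJ i : I i -> J i by move=> Ii; apply/existsP; exists x.
  have cs i j : `|f x (e i * H x * e j)| ^+ 2 <= (g i (H x) * f x (e j)) * (g j (H x) * f x (e i)).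
    have -> : e i * H x * e j = star (h x * e i) * (h x * e j).
      by rewrite starM (ep i).1 /H !mulrA.
    apply: le_trans (state_cauchy_schwarz (f_state x) _ _) _.
    rewrite !starM !(ep _).1 !mulrA -![_ * star (h x) * h x]mulrA !gE !fZ.
    by rewrite le_eqVlt; apply/orP; left; apply/eqP; rewrite -/(H x); ring.
  (* If [f x] does not charge both [e i] and [e j], the right side of [cs] is zero; this restricts
     the sums to [I], where the weights [f x (e j)] add up to 1. *)
  have bd i j : `|f x (e i * H x * e j)| <=
      if I i && I j then (g i (H x) * f x (e j) + g j (H x) * f x (e i)) / 2 else 0.
    case: ifP => [/andP[Ii Ij]|/negbT].
      have a0 : 0 <= g i (H x) * f x (e j) by rewrite mulr_ge0 ?gP ?IJ.
      have b0 : 0 <= g j (H x) * f x (e i) by rewrite mulr_ge0 ?gP ?IJ.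
      rewrite -ler_sqr ?nnegrE ?divr_ge0 ?addr_ge0 //; apply: le_trans (cs i j) _.
      set a := _ * f x (e j) in a0 *; set b := _ * f x (e i) in b0 *.
      rewrite -subr_ge0.
      have -> : ((a + b) / 2) ^+ 2 - a * b = ((a - b) / 2) ^+ 2 by field.
      by apply: real_exprn_even_ge0 => //; rewrite realM ?realB ?ger0_real ?invr_ge0.
    rewrite negb_and /I !negbK => ij; have := cs i j.
    have -> : g i (H x) * f x (e j) * (g j (H x) * f x (e i)) = 0.
      by case/orP: ij => /eqP ->; rewrite !(mulr0, mul0r).
    by rewrite real_exprn_even_le0 ?normr_real //= => /eqP ->.
  have -> : f x (H x) = \sum_i \sum_j f x (e i * H x * e j).
    under eq_bigr do rewrite -(state_sum (f_state x)) -mulr_sumr e1 mulr1.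
    by rewrite -(state_sum (f_state x)) -mulr_suml e1 mul1r.
  rewrite -[X in X <= _]ger0_norm; last first.
    under eq_bigr do rewrite -(state_sum (f_state x)) -mulr_sumr e1 mulr1.
    by rewrite -(state_sum (f_state x)) -mulr_suml e1 mul1r f0.
  apply: le_trans (ler_norm_sum _ _ _) _.
  apply: le_trans (ler_sum _ (fun i _ => ler_norm_sum _ _ _)) _.
  apply: le_trans (ler_sum _ (fun i _ => ler_sum _ (fun j _ => bd i j))) _.
  have sf : \sum_(j | I j) f x (e j) = 1.
    rewrite -f1 -e1 (state_sum (f_state x)) [RHS](bigID I) /= [X in _ = _ + X]big1 ?addr0 //.
    by move=> j; rewrite negbK => /eqP.
  have -> : \sum_i \sum_j (if I i && I j then (g i (H x) * f x (e j) + g j (H x) * f x (e i)) / 2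
      else 0) = \sum_(i | I i) g i (H x).
    transitivity (\sum_(i | I i) \sum_(j | I j) (g i (H x) * f x (e j) + g j (H x) * f x (e i)) / 2).
      rewrite [RHS]big_mkcond; apply: eq_bigr => i _; case: (I i) => /=; last by rewrite big1.
      by rewrite -big_mkcond.
    under eq_bigr do rewrite -mulr_suml big_split /= -mulr_sumr sf mulr1 -mulr_suml.
    by rewrite -mulr_suml big_split /= -mulr_sumr sf mulr1; field.
  rewrite [leLHS]big_mkcond [leRHS]big_mkcond; apply: ler_sum => i _.
  case Ii: (I i); first by rewrite IJ.
  by case Ji: (J i) => //; rewrite gP.
apply: le_trans (ler_sum _ (fun x _ => key x)) _.
rewrite exchange_big /=.
(* The numbers [g i (P y)] are nonnegative with sum 1, so the column bound [W] applies for each of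
   the at most [k] indices. *)
have bi i : J i -> \sum_x g i (H x) <= W%:C.
  move=> Ji; under eq_bigr => x _ do rewrite /H hE gsum.
  rewrite exchange_big /=.
  have -> : W%:C = \sum_y W%:C * g i (P y) by rewrite -mulr_sumr -gsum z_sum g1 mulr1.
  apply: ler_sum => y _; under eq_bigr do rewrite gZ.
  rewrite -mulr_suml ler_wpM2r ?gP //.
  by rewrite -rmorph_sum /= lecR.
apply: le_trans (ler_sum _ bi) _.
rewrite sumr_const -rmorphMn /= lecR -mulr_natl ler_wpM2r // ler_nat.
by apply: leq_trans lk; rewrite -[X in (_ <= X)%N]card_ord; exact: max_card.
Qed.

End JointMeasurement.

(** * The canonical shift maps *)

Section Shift.
Variables (R : realType) (r : nat) (B : finType) (M : 'I_r -> rel B).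
Hypotheses (H0 : RS_H0 M) (H1 : RS_H1 M) (H2 : RS_H2 M).
Variables (A : cstarAlgType R) (s : forall m : degree r, word M m -> A).
Hypothesis CK : is_CK_algebra s.
Implicit Types (k l m n p : degree r) (a b : B) (x y : A).
Local Notation word := (word M).
Local Notation S w := (s w).
Local Notation Q w := (s w * star (s w)).
Local Notation Phi := (shift_map s).

Definition degree_scale (n : nat) p : degree r := [ffun i => (n * p i)%N].

Lemma degree_scale0 p : degree_scale 0 p = degree0 r.
Proof. by apply/ffunP => i; rewrite !ffunE. Qed.

Lemma degree_scaleS (n : nat) p : degree_scale n.+1 p = degreeD p (degree_scale n p).
Proof. by apply/ffunP => i; rewrite !ffunE mulSn. Qed.

Lemma degree_scaleSr (n : nat) p : degree_scale n.+1 p = degreeD (degree_scale n p) p.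
Proof. by rewrite degreeDC degree_scaleS. Qed.

Lemma shiftD p x y : Phi p (x + y) = Phi p x + Phi p y.
Proof.
by rewrite /shift_map -big_split /=; apply: eq_bigr => w _; rewrite mulrDr mulrDl.
Qed.

Lemma shiftZ p c x : Phi p (c *: x) = c *: Phi p x.
Proof.
by rewrite /shift_map scaler_sumr; apply: eq_bigr => w _; rewrite -scalerAr -scalerAl.
Qed.

Lemma shift_add m n x : Phi m (Phi n x) = Phi (degreeD m n) x.
Proof.
rewrite /shift_map [RHS](cat_reindex (G := fun u v => S u * (S v * x * star (S v)) * star (S u)) H1 erefl).
  apply: eq_bigr => u _; rewrite mulr_sumr mulr_suml [RHS]big_mkcond.
  apply: eq_bigr => v _; case: eqP => // /eqP ne.
  by rewrite !mulrA (ck_mul_neq0 CK ne) !mul0r.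
by move=> u v w c; rewrite (ck_cat CK c) starM !mulrA.
Qed.

(** [Phi^0] sends [x] to the sum of the compressions [V_a x V_a], and is not the identity in
    general. For this reason [iter_shift] assumes [0 < j]. *)
Lemma shift_map0 x : (forall a, s (vertex M a) * x = x * s (vertex M a)) -> Phi (degree0 r) x = x.
Proof.
move=> h; rewrite /shift_map; transitivity (\sum_(w : word (degree0 r)) Q w * x).
  apply: eq_bigr => w _; rewrite (word0E w); set a := origin w.
  by rewrite (ck_vertex_star CK) -mulrA -h mulrA.
by rewrite -mulr_suml (ck_sum_Q CK) mul1r.
Qed.

Lemma iter_shift (j : nat) p x : (0 < j)%N -> iter j (Phi p) x = Phi (degree_scale j p) x.
Proof.
case: j => // j _; elim: j => [|j IH].
  by rewrite /= degree_scaleS degree_scale0 degreeD0.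
by rewrite iterS IH shift_add -degree_scaleS.
Qed.

Lemma shift_compress m n k (u u' : word m) (v : word n) (v' : word k) l l' (w : word l)
    (w' : word l') x : is_cat u v w -> is_cat u' v' w' ->
  star (S w) * Phi m x * S w' = if u == u' then star (S v) * x * S v' else 0.
Proof.
move=> c c'; rewrite /shift_map mulr_sumr mulr_suml.
transitivity (\sum_(u1 : word m) (star (S w) * S u1) * x * (star (S u1) * S w')).
  by apply: eq_bigr => u1 _; rewrite !mulrA.
rewrite (bigD1 u) //= big1 ?addr0.
  rewrite (ck_starS_cat CK _ c) eqxx (ck_starS_cat' CK _ c') eq_sym.
  by case: eqP => _; rewrite ?mulr0.
by move=> u1 /negPf ne; rewrite (ck_starS_cat CK _ c) eq_sym ne !mul0r.
Qed.

Lemma cnormS_le m (w : word m) : cnorm (S w) <= 1.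
Proof.
have := cnorm_mul_star (S w); rewrite (cnorm_Q H1 H2 CK) => h.
by have := cnorm_ge0 (S w); nra.
Qed.

(* The powers of Phi(x)^* Phi(x) are sums over words of elements of norm at
   most |x|^(2k), so only the number of words could spoil the estimate. *)
Lemma shift_le m x : cnorm (Phi m x) <= cnorm x.
Proof.
pose V w := s (vertex M (@terminus _ _ M m w)).
pose G w := V w * star x * V w * x * V w.
have VV w : V w * V w = V w by rewrite /V (ck_vertex_mul CK) eqxx.
have Vs w : star (V w) = V w by exact: ck_vertex_star CK _.
have V1 w : cnorm (V w) <= 1 by apply: cnorm_proj.
have SV w : S w * V w = S w by rewrite /V (ck_terminusr CK).
have VS w : V w * star (S w) = star (S w) by rewrite -Vs -starM SV.
have sPhi : star (Phi m x) = Phi m (star x).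
  rewrite /shift_map star_sum; apply: eq_bigr => w _.
  by rewrite !starM starK mulrA.
have mulE (F F' : word m -> A) : (\sum_w S w * F w * star (S w)) * (\sum_w S w * F' w * star (S w)) =
    \sum_w S w * (F w * V w * F' w) * star (S w).
  rewrite mulr_suml; apply: eq_bigr => w _; rewrite mulr_sumr.
  transitivity (\sum_w' S w * F w * (star (S w) * S w') * F' w' * star (S w')).
    by apply: eq_bigr => w' _; rewrite !mulrA.
  rewrite (bigD1 w) //= big1 ?addr0 => [|w' /negPf ne].
    by rewrite (ck_star_mul CK) !mulrA.
  by rewrite (ck_starS CK) eq_sym ne mulr0 !mul0r.
have sq : star (Phi m x) * Phi m x = \sum_w S w * G w * star (S w).
  rewrite sPhi mulE; apply: eq_bigr => w _; rewrite /G.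
  by rewrite -[LHS]mulrA -[RHS]mulrA -{1}(SV w) -{1}(VS w) !mulrA.
have pow (k : nat) : (star (Phi m x) * Phi m x) ^+ k.+1 = \sum_w S w * (G w ^+ k.+1) * star (S w).
  elim: k => [|k IH]; first by rewrite expr1 sq; apply: eq_bigr => w _; rewrite expr1.
  rewrite exprS IH sq mulE; apply: eq_bigr => w _; congr (_ * _ * _).
  by rewrite [in RHS]exprS; congr (_ * _); rewrite /G -mulrA VV.
have Gle w : cnorm (G w) <= cnorm x ^+ 2.
  have -> : G w = star (V w * x * V w) * (V w * x * V w).
    by rewrite !starM !Vs /G !mulrA -[_ * V w * V w * x]mulrA mulrA -[_ * V w * V w]mulrA VV.
  rewrite cnorm_star_mul lerXn2r ?nnegrE ?cnorm_ge0 //.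
  apply: le_trans (cnormM_le _ _) _; apply: le_trans (_ : cnorm (V w * x) * 1 <= _).
    by rewrite ler_wpM2l ?cnorm_ge0.
  rewrite mulr1; apply: le_trans (cnormM_le _ _) _.
  by rewrite -[leRHS]mul1r ler_wpM2r ?cnorm_ge0.
apply: (@spectral_radius_bound _ _ _ (#|{: word m}|%:R) (cnorm x)); first exact: cnorm_ge0.
move=> n; have [k ->] : exists k : nat, (2 ^ n)%N = k.+1 by exists (2 ^ n).-1; rewrite prednK // expn_gt0.
rewrite pow; apply: le_trans (cnorm_sum_le _ _ _) _.
rewrite -sum1_card natr_sum mulr_suml; apply: ler_sum => w _; rewrite mul1r.
apply: le_trans (cnormM_le _ _) _; rewrite cnorm_star.
apply: le_trans (_ : cnorm (G w ^+ k.+1) <= _); last first.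
  apply: le_trans (cnormX_le _ _) _; rewrite lerXn2r ?nnegrE ?exprn_ge0 ?cnorm_ge0 //.
have := cnormM_le (S w) (G w ^+ k.+1); have := cnormS_le w.
have := cnorm_ge0 (S w); have := cnorm_ge0 (G w ^+ k.+1).
have := cnorm_ge0 (S w * G w ^+ k.+1); nra.
Qed.

Lemma iter_shift_le (j : nat) p x : cnorm (iter j (Phi p) x) <= cnorm x.
Proof. by elim: j => //= j IH; exact: le_trans (shift_le _ _) IH. Qed.

Lemma iter_shiftD (j : nat) p x y :
  iter j (Phi p) (x + y) = iter j (Phi p) x + iter j (Phi p) y.
Proof. by elim: j => //= j ->; rewrite shiftD. Qed.

Lemma iter_shiftZ (j : nat) p c x : iter j (Phi p) (c *: x) = c *: iter j (Phi p) x.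
Proof. by elim: j => //= j ->; rewrite shiftZ. Qed.

End Shift.

Lemma completely_positive_square (R : realType) (A D : cstarAlgType R) (f : {linear A -> D}) a :
  completely_positive f -> exists z, f (star a * a) = star z * z.
Proof.
move=> /(_ 1%N (const_mx (star a * a))) [|X /matrixP /(_ 0 0)].
  by exists (const_mx a); apply/matrixP => i j; rewrite !mxE big_ord1 !mxE.
by rewrite !mxE big_ord1 !mxE => e; exists (X 0 0).
Qed.

(** * Lower bound for the rank *)

Section LowerBound.
Variables (R : realType) (r : nat) (B : finType) (M : 'I_r -> rel B).
Hypotheses (H0 : RS_H0 M) (H1 : RS_H1 M) (H2 : RS_H2 M).
Variables (A : cstarAlgType R) (s : forall m : degree r, word M m -> A).
Hypothesis CK : is_CK_algebra s.
Implicit Types (k l m : degree r) (a b : B) (x y : A).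
Local Notation word := (word M).
Local Notation S w := (s w).
Local Notation Q w := (s w * star (s w)).
Local Notation Phi := (shift_map s).
Variables (p : degree r) (n : nat).
Hypothesis n_gt0 : (0 < n)%N.
Local Notation X := (word (degree_scale n p)).
Implicit Types (u v : X) (j : 'I_n).

Lemma block_ex u j : exists b : word p, forall l, degree_le l p ->
  letter b l = letter u (degreeD (degree_scale j p) l).
Proof.
apply: subword_ex; apply/degree_leP => i; rewrite !ffunE -mulSnr.
by rewrite leq_mul2r ltn_ord orbT.
Qed.

Definition block u j : word p := sval (cid (block_ex u j)).

Lemma blockE u j l : degree_le l p ->
  letter (block u j) l = letter u (degreeD (degree_scale j p) l).
Proof. exact: (svalP (cid (block_ex u j))). Qed.

(** The blocks cover only a chain of boxes along a diagonal of [[0, (q + 1) p]]; the remaining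
    letters are forced by uniqueness in (H1). *)
Lemma blocks_ext (q : nat) k (u v : word k) : k = degree_scale q.+1 p ->
  (forall (j : nat) l, (j <= q)%N -> degree_le l p ->
    letter u (degreeD (degree_scale j p) l) = letter v (degreeD (degree_scale j p) l)) -> u = v.
Proof.
elim: q k u v => [|q IH] k u v ek h.
  apply: word_ext => l lk; have := h 0%N l (leqnn _).
  rewrite degree_scale0 !degree0D; apply.
  by move: lk; rewrite ek degree_scaleS degree_scale0 degreeD0.
rewrite degree_scaleSr in ek.
have [u1 [u2 cu]] := cat_split u ek; have [v1 [v2 cv]] := cat_split v ek.
have e1 : u1 = v1.
  apply: IH => // j l jq lp; have := h j l (leqW jq) lp.
  have le : degree_le (degreeD (degree_scale j p) l) (degree_scale q.+1 p).
    apply/degree_leP => i; rewrite !ffunE; move/degree_leP/(_ i): lp => lp.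
    by rewrite mulSnr leq_add // leq_mul2r jq orbT.
  by case: cu => _ -> // _; case: cv => _ -> // _.
have e2 : u2 = v2.
  apply: word_ext => l lp; have := h q.+1 l (leqnn _) lp.
  by case: cu => _ _ -> //; case: cv => _ _ -> //.
by rewrite e1 e2 in cu; exact: is_cat_uniq H1 cu cv.
Qed.

Lemma block_inj u v : (forall j, block u j = block v j) -> u = v.
Proof.
move=> h; apply: (@blocks_ext n.-1); first by rewrite prednK.
move=> j l jn lp; have jn' : (j < n)%N by rewrite -(prednK n_gt0) ltnS.
by rewrite -!(@blockE _ (Ordinal jn')) // h.
Qed.

(** [Phi^(j p)(Q b)] is the test that block [j] is [b], so the projections of shape [n p] refine the
    first [n] shifts of the [Q b] simultaneously. *)
Lemma iter_shift_Q (b : word p) j v :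
  iter j (Phi p) (Q b) * Q v = if block v j == b then Q v else 0.
Proof.
have e : degree_scale n p = degreeD (degree_scale j p) (degreeD p (degree_scale (n - j.+1) p)).
  apply/ffunP => i; rewrite !ffunE -mulSn -mulnDl; congr (_ * _)%N.
  by rewrite addnS -addSn subnKC.
have [v1 [v2 c1]] := cat_split v e; have [v3 [v4 c2]] := cat_split v2 erefl.
have -> : block v j = v3.
  apply: word_ext => l lp; rewrite blockE //; case: c1 c2 => _ _ h1 [_ h2 _].
  by rewrite h1 ?h2 // (degree_le_trans lp) // degree_leDl.
have -> : iter j (Phi p) (Q b) = Phi (degree_scale j p) (Q b).
  (* For [j = 0] the identity has to be matched with [Phi^0], which fixes [Q b] because [Q b]
     commutes with the vertex projections. *)
  have [j0|j0] := posnP j; last exact: iter_shift.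
  rewrite j0 degree_scale0 shift_map0 // => a.
  have -> : Q b * s (vertex M a) = S b * (if a == origin b then star (S b) else 0).
    rewrite -mulrA -(ck_vertex_star CK a) -starM (ck_vertex_mull CK).
    by case: eqP; rewrite ?star0.
  by rewrite mulrA (ck_vertex_mull CK); case: eqP => _; rewrite ?mulr0 ?mul0r.
rewrite /shift_map mulr_suml.
transitivity (\sum_(w : word (degree_scale j p))
    S w * Q b * (star (S w) * S v) * star (S v)).
  by apply: eq_bigr => w _; rewrite !mulrA.
rewrite (bigD1 v1) //= big1 ?addr0 => [|w /negPf ne]; last first.
  by rewrite (ck_starS_cat' CK _ c1) eq_sym ne mulr0 mul0r.
rewrite (ck_starS_cat' CK _ c1) eqxx.
have -> : S v1 * Q b * S v2 = S v1 * (S b * (star (S b) * S v2)) by rewrite !mulrA.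
rewrite (ck_starS_cat' CK _ c2); case: eqP => [<-|_]; last by rewrite !mulr0 mul0r.
by rewrite -(ck_cat CK c2) -(ck_cat CK c1).
Qed.

Lemma iter_shift_QE (b : word p) j :
  iter j (Phi p) (Q b) = \sum_(v : X | block v j == b) Q v.
Proof.
rewrite -[LHS]mulr1 -(ck_sum_Q CK (degree_scale n p)) mulr_sumr [RHS]big_mkcond.
by apply: eq_bigr => v _; rewrite iter_shift_Q.
Qed.

Definition hamming u v : nat := (\sum_j (block u j != block v j))%N.

(** Words embed into sequences of [n] blocks, over which the weight is a product. Each factor sums
    to at most 1 for the agreeing block plus [e^(-t)] for each of the others. *)
Lemma hamming_weight (t : R) v :
  \sum_u expR (- t * (hamming u v)%:R) <= (1 + #|{: word p}|%:R * expR (- t)) ^+ n.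
Proof.
pose g u : {ffun 'I_n -> word p} := [ffun j => block u j].
have gi : injective g.
  by move=> u u' /ffunP e; apply: block_inj => j; have := e j; rewrite !ffunE.
pose F (c : {ffun 'I_n -> word p}) := \prod_j expR (- t * (c j != block v j)%:R).
have -> : \sum_u expR (- t * (hamming u v)%:R) = \sum_u F (g u).
  apply: eq_bigr => u _; rewrite /hamming natr_sum mulr_sumr expR_sum.
  by apply: eq_bigr => j _; rewrite ffunE.
have -> : \sum_u F (g u) = \sum_(c in codom g) F c.
  rewrite -big_uniq /=; last by apply/injectiveP.
  by rewrite /codom big_image.
have F0 c : 0 <= F c by apply: prodr_ge0 => j _; exact: expR_ge0.
apply: le_trans (_ : \sum_c F c <= _).
  by rewrite [leRHS](bigID (mem (codom g))) /= lerDl sumr_ge0.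
rewrite /F -(bigA_distr_bigA (fun j (c : word p) => expR (- t * (c != block v j)%:R))) /=.
rewrite -[n in leRHS]card_ord -prodr_const; apply: ler_prod => j _.
rewrite sumr_ge0 => [/=|c _]; last exact: expR_ge0.
rewrite (bigD1 (block v j)) //= eqxx mulr0 expR0 lerD2l.
apply: le_trans (_ : \sum_(b : word p) expR (- t) <= _).
  rewrite [leLHS]big_mkcond; apply: ler_sum => c _; case: eqP => _ /=; first exact: expR_ge0.
  by rewrite mulr1.
by rewrite sumr_const mulr_natl.
Qed.

Section Approximation.
Variables (eps t : R) (C : cstarAlgType R) (phi : {linear C -> A}) (psi : {linear A -> C}) (k : nat).
Hypotheses (t_ge0 : 0 <= t) (C_rank : has_rank C k).
Hypothesis approx : CPA (orbit_upto (Phi p) [set Q w | w in [set: word p]] n) eps phi psi.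

Lemma path_through_ex u : exists xi, infinite_path M xi /\
  forall l, degree_le l (degree_scale n p) -> letter u l = xi l.
Proof. by have [xi ? ?] := infinite_path_ex H0 H1 H2 u; exists xi. Qed.

Let xi u := sval (cid (path_through_ex u)).
Let xiP u : infinite_path M (xi u) := (svalP (cid (path_through_ex u))).1.
Let f u (c : C) := path_state H1 H2 CK (xiP u) (phi c).

Lemma path_state_word u v : path_state H1 H2 CK (xiP u) (Q v) = (u == v)%:R.
Proof.
rewrite path_state_diag andbb; congr (nat_of_bool _)%:R; rewrite eq_sym; congr (_ == _).
apply: word_ext => l lm; rewrite path_prefixE //.
by rewrite (svalP (cid (path_through_ex u))).2.
Qed.

Lemma approx_is_state u : is_state (f u).
Proof.
have [_ [phi1 phiP] _ _] := approx; split.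
- by move=> x y; rewrite /f linearD path_stateD.
- by move=> c x; rewrite /f linearZ path_stateZ.
- move=> x; have [z] := completely_positive_square x phiP; rewrite /f => ->.
  exact: path_state_ge0.
by rewrite /f phi1 path_state1.
Qed.

(** For each [u] the numbers [T v] form a probability distribution under which every block agrees
    with that of [u] up to probability [eps]. The expected Hamming distance is at most [n eps], so
    the expected weight is at least [e^(-t n eps)] by convexity; summing over [u] meets
    [joint_measurement_bound]. *)
Lemma rank_lower_bound :
  #|{: X}|%:R * expR (- t * (n%:R * eps)) <=
  k%:R * (1 + #|{: word p}|%:R * expR (- t)) ^+ n.
Proof.
have [Cfd [phi1 phiP] [psi1 psiP] ap] := approx.
have [Sm Smax Sdim] := C_rank.
have QQ u : Q u = star (Q u) * Q u by rewrite (ck_proj CK u).1 (ck_proj CK u).2.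
have zP u : exists z, psi (Q u) = star z * z.
  by rewrite QQ; exact: completely_positive_square.
pose z u := sval (cid (zP u)).
have zE u : psi (Q u) = star (z u) * z u by exact: (svalP (cid (zP u))).
have zsum : \sum_u star (z u) * z u = 1.
  by under eq_bigr do rewrite -zE; rewrite -raddf_sum (ck_sum_Q CK).
pose w u v := expR (- t * (hamming u v)%:R).
have w0 u v : 0 <= w u v by exact: expR_ge0.
have hP u : exists h, star h * h = \sum_v (w u v)%:C *: (star (z v) * z v).
  (* The weighted sum of the orthogonal projections [Q v] is the square of [a], so positivity of
     [psi] makes its image a square [star h * h]. *)
  pose a := \sum_v (Num.sqrt (w u v))%:C *: Q v.
  have aa : star a * a = \sum_v (w u v)%:C *: Q v.
    rewrite /a star_sum mulr_suml; apply: eq_bigr => v _.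
    rewrite mulr_sumr (bigD1 v) //= big1 ?addr0.
      rewrite starZr -scalerAl -scalerAr scalerA -QQ -rmorphM /= -expr2 sqr_sqrtr //.
    move=> v' ne; rewrite starZr -scalerAl -scalerAr (ck_proj CK v).1.
    rewrite (proj_orthogonal (ck_proj CK (m := _)) (ck_sum_Q CK _)) ?scaler0 //.
    by rewrite eq_sym.
  have [h hE] := completely_positive_square a psiP; exists h.
  rewrite -hE aa raddf_sum; apply: eq_bigr => v _.
  by rewrite /= linearZ /= zE.
pose h u := sval (cid (hP u)).
have hE u : star (h u) * h u = \sum_v (w u v)%:C *: (star (z v) * z v) by exact: (svalP (cid (hP u))).
have W0 : 0 <= (1 + #|{: word p}|%:R * expR (- t)) ^+ n.
  by rewrite exprn_ge0 // addr_ge0 // mulr_ge0 // expR_ge0.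
have := joint_measurement_bound Smax Sdim approx_is_state zsum hE W0 (hamming_weight t).
move=> ub; rewrite -lecR; apply: le_trans ub.
rewrite -sum1_card natr_sum mulr_suml rmorph_sum /=; apply: ler_sum => u _; rewrite mul1r.
have [fD fZ f0 f1] := approx_is_state u.
pose T v := complex.Re (f u (psi (Q v))).
have TE v : f u (psi (Q v)) = (T v)%:C.
  by rewrite /T RRe_real // ger0_real // zE.
have T0 v : 0 <= T v by rewrite -lecR -TE zE.
have T1 : \sum_v T v = 1.
  apply: (@complexI R); rewrite rmorph_sum rmorph1 /= -f1 -psi1 -(ck_sum_Q CK (degree_scale n p)).
  rewrite raddf_sum (state_sum (approx_is_state u)).
  by apply: eq_bigr => v _; rewrite TE.
rewrite hE (state_sum (approx_is_state u)).
under eq_bigr => v _ do rewrite fZ -zE TE -rmorphM /=.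
rewrite -rmorph_sum lecR /=.
have agree j : \sum_(v | block v j == block u j) T v >= 1 - eps.
  set b := block u j; pose E := iter j (Phi p) (Q b).
  have Eo : orbit_upto (Phi p) [set Q w | w in [set: word p]] n E.
    by exists (nat_of_ord j) => /=; [rewrite ltnW | exists (Q b) => //; exists b].
  have tE : path_state H1 H2 CK (xiP u) E = 1.
    rewrite /E iter_shift_QE path_state_sum (bigD1 u) //= path_state_word eqxx.
    by rewrite big1 ?addr0 // => v /andP[_ ne]; rewrite path_state_word eq_sym (negPf ne).
  have fE : f u (psi E) = (\sum_(v | block v j == b) T v)%:C.
    rewrite /E iter_shift_QE raddf_sum (state_sum (approx_is_state u)) rmorph_sum /=.
    by apply: eq_bigr => v _; rewrite TE.
  have : nrmc (f u (psi E) - 1) < eps.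
    rewrite -tE /f -(stateB (f := path_state H1 H2 CK (xiP u))); last first.
      split; [exact: path_stateD|exact: path_stateZ|exact: path_state_ge0|exact: path_state1].
    apply: le_lt_trans (path_state_le _ _ _ _ _) _; exact: ap.
  by rewrite fE -(rmorph1 (real_complex R)) -rmorphB /= nrmcR ltr_norml; lra.
have dist : \sum_v T v * (hamming u v)%:R <= n%:R * eps.
  under eq_bigr do rewrite /hamming natr_sum mulr_sumr.
  rewrite exchange_big /= -[n in leRHS]card_ord mulr_natl -sumr_const; apply: ler_sum => j _.
  have := agree j; move: T1; rewrite (bigID (fun v => block v j == block u j)) /=.
  set a := \sum_(v | _) _; set a' := \sum_(v | _) _ => e1 e2.
  have -> : \sum_v T v * (block u j != block v j)%:R = a'.
    rewrite /a' [RHS]big_mkcond; apply: eq_bigr => v _; rewrite eq_sym.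
    by case: eqP => _; rewrite ?mulr0 ?mulr1.
  lra.
set D := n%:R * eps in dist *.
(* Jensen's inequality in the form of the tangent line of the exponential at [- t * D]. *)
apply: le_trans (_ : \sum_v expR (- t * D) * (T v * (1 + t * D) - t * (T v * (hamming u v)%:R)) <= _).
  rewrite -mulr_sumr sumrB -mulr_suml T1 mul1r -mulr_sumr.
  rewrite -[leLHS]mulr1 ler_wpM2l ?expR_ge0 //.
  have := ler_wpM2l t_ge0 dist; lra.
apply: ler_sum => v _.
rewrite /w.
have -> : - t * (hamming u v)%:R = - t * D + (t * D - t * (hamming u v)%:R) by ring.
rewrite expRD -mulrA ler_wpM2l ?expR_ge0 //.
have -> : T v * (1 + t * D) - t * (T v * (hamming u v)%:R) =
  (1 + (t * D - t * (hamming u v)%:R)) * T v by ring.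
by rewrite ler_wpM2r // expR_ge1Dx.
Qed.

End Approximation.
End LowerBound.

(** * Matrix algebras *)

Section VectorNorm.
Variables (R : realType) (n : nat).
Implicit Types (u v : 'cV[R[i]]_n) (X Y : 'M[R[i]]_n) (c : R).

Definition mxadj X : 'M[R[i]]_n := (map_mx Num.conj X)^T.

Definition vdot u v : R[i] := \sum_i (u i 0)^* * v i 0.

Definition vnorm u : R := Num.sqrt (complex.Re (vdot u u)).

Lemma vdot_ge0 u : 0 <= vdot u u.
Proof. by apply: sumr_ge0 => i _; rewrite mulrC mul_conjC_ge0. Qed.

Lemma vdot_sqr u : vdot u u = (vnorm u ^+ 2)%:C.
Proof.
rewrite /vnorm sqr_sqrtr; first by rewrite RRe_real // ger0_real // vdot_ge0.
by have := vdot_ge0 u; rewrite lecE => /andP[].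
Qed.

Lemma vdotD u v v' : vdot u (v + v') = vdot u v + vdot u v'.
Proof. by rewrite -big_split; apply: eq_bigr => i _; rewrite mxE mulrDr. Qed.

Lemma vdotZ (z : R[i]) u v : vdot u (z *: v) = z * vdot u v.
Proof. by rewrite /vdot mulr_sumr; apply: eq_bigr => i _; rewrite mxE mulrCA. Qed.

Lemma vdotC u v : vdot v u = (vdot u v)^*.
Proof.
rewrite /vdot rmorph_sum; apply: eq_bigr => i _.
by rewrite rmorphM /= conjCK mulrC.
Qed.

Lemma vdot_adj X u v : vdot (X *m u) v = vdot u (mxadj X *m v).
Proof.
rewrite /vdot; under eq_bigr do rewrite mxE rmorph_sum mulr_suml.
rewrite exchange_big; apply: eq_bigr => i _; rewrite mxE mulr_sumr.
by apply: eq_bigr => j _; rewrite !mxE rmorphM /= mulrCA mulrA.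
Qed.

Lemma vnorm_ge0 u : 0 <= vnorm u.
Proof. exact: sqrtr_ge0. Qed.

Lemma vdot_le u v : nrmc (vdot u v) <= vnorm u * vnorm v.
Proof.
have := form_cauchy_schwarz vdotD vdotZ vdotC vdot_ge0 u v.
rewrite !vdot_sqr -nrmcE -rmorphXn -rmorphM /= lecR -exprMn.
by rewrite ler_pXn2r ?nnegrE ?mulr_ge0 ?nrmc_ge0 ?vnorm_ge0.
Qed.

Lemma vnormD_le u v : vnorm (u + v) <= vnorm u + vnorm v.
Proof.
rewrite -(@ler_pXn2r _ 2) ?nnegrE ?addr_ge0 ?vnorm_ge0 //.
rewrite -lecR -vdot_sqr vdotD (vdotC u) (vdotC v (u + v)) !vdotD.
have -> : (vdot u u + vdot u v)^* + (vdot v u + vdot v v)^* =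
    (vnorm u ^+ 2)%:C + (vnorm v ^+ 2)%:C + (vdot u v + (vdot u v)^*).
  rewrite !rmorphD /= -!vdotC !vdot_sqr (vdotC u v); ring.
have -> : vdot u v + (vdot u v)^* = (2 * complex.Re (vdot u v))%:C.
  by rewrite -[X in X + _]mulr1 -[X in _ + X]mulr1 -mulrDl mulr1; case: (vdot u v) => a b;
   apply/eqP; rewrite eq_complex /= ; apply/andP; split; apply/eqP; ring.
rewrite -!rmorphD /= lecR sqrrD.
have := Re_le_nrmc (vdot u v); have := vdot_le u v.
by have := ler_norm (complex.Re (vdot u v)); lra.
Qed.

End VectorNorm.

Section OperatorNorm.
Variables (R : realType) (n : nat).
Local Notation Mn := ('M[R[i]]_n.+1).
Implicit Types (u v : 'cV[R[i]]_n.+1) (X Y : Mn) (c : R).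

Lemma vnormZ (z : R[i]) u : vnorm (z *: u) = nrmc z * vnorm u.
Proof.
apply/eqP; rewrite -(@eqrXn2 _ 2) ?mulr_ge0 ?vnorm_ge0 ?nrmc_ge0 // exprMn.
apply/eqP/(@complexI R); rewrite -vdot_sqr rmorphM /= -vdot_sqr rmorphXn /= nrmcE.
by rewrite vdotZ vdotC vdotZ rmorphM /= -vdotC mulrA normCK.
Qed.

Lemma vnorm0 : vnorm (0 : 'cV[R[i]]_n.+1) = 0.
Proof.
rewrite -(scale0r 0) vnormZ /nrmc normr0 /= mul0r //.
Qed.

Lemma entry_le_vnorm u i : nrmc (u i 0) <= vnorm u.
Proof.
rewrite -(@ler_pXn2r _ 2) ?nnegrE ?vnorm_ge0 ?nrmc_ge0 // -lecR -vdot_sqr rmorphXn /= nrmcE.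
rewrite normCK mulrC /vdot (bigD1 i) //= lerDl sumr_ge0 // => j _.
by rewrite mulrC mul_conjC_ge0.
Qed.

Lemma vnorm_eq0 u : vnorm u = 0 -> u = 0.
Proof.
move=> h; apply/matrixP => i j; rewrite (ord1 j) [RHS]mxE; apply: nrmc_eq0 => e e0.
by apply: le_trans (entry_le_vnorm u i) _; rewrite h ltW.
Qed.

Lemma vnorm_le_sum u : vnorm u <= \sum_i nrmc (u i 0).
Proof.
have s0 : 0 <= \sum_i nrmc (u i 0) by apply: sumr_ge0 => i _; exact: nrmc_ge0.
rewrite -(@ler_pXn2r _ 2) ?nnegrE ?vnorm_ge0 // -lecR -vdot_sqr.
have -> : vdot u u = (\sum_i nrmc (u i 0) * nrmc (u i 0))%:C.
  by rewrite rmorph_sum; apply: eq_bigr => i _; rewrite rmorphM /= !nrmcE mulrC -normCK.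
rewrite lecR expr2 mulr_suml; apply: ler_sum => i _.
by rewrite ler_wpM2l ?nrmc_ge0 // (bigD1 i) //= lerDl sumr_ge0 // => j _; exact: nrmc_ge0.
Qed.

Definition opnorm X : R := sup [set vnorm (X *m u) | u in [set u | vnorm u <= 1]].

Definition mxsum_norm X : R := \sum_i \sum_j nrmc (X i j).

Lemma vnorm_mul_le X u : vnorm (X *m u) <= mxsum_norm X * vnorm u.
Proof.
apply: le_trans (vnorm_le_sum _) _; rewrite mulr_suml; apply: ler_sum => i _.
rewrite mxE mulr_suml; elim/big_rec2: _ => [|j y z _ h]; first by rewrite /nrmc normr0.
apply: le_trans (nrmcD _ _) _; apply: lerD => //.
by rewrite nrmcM ler_wpM2l ?nrmc_ge0 // entry_le_vnorm.
Qed.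

Lemma opnorm_has_sup X : has_sup [set vnorm (X *m u) | u in [set u | vnorm u <= 1]].
Proof.
split; first by exists (vnorm (X *m 0)), 0 => //=; rewrite vnorm0 ler01.
exists (mxsum_norm X) => _ [u /= u1 <-]; apply: le_trans (vnorm_mul_le _ _) _.
rewrite -[leRHS]mulr1 ler_wpM2l // sumr_ge0 // => i _.
by apply: sumr_ge0 => j _; exact: nrmc_ge0.
Qed.

Lemma opnormP X u : vnorm (X *m u) <= opnorm X * vnorm u.
Proof.
have [u0|u0] := eqVneq (vnorm u) 0.
  by rewrite (vnorm_eq0 u0) mulmx0 vnorm0 mulr0.
have up : 0 < vnorm u by rewrite lt_def u0 vnorm_ge0.
have : vnorm (X *m ((vnorm u)^-1%:C *: u)) <= opnorm X.
  apply: ub_le_sup; first by have [] := opnorm_has_sup X.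
  exists ((vnorm u)^-1%:C *: u) => //=.
  by rewrite vnormZ nrmcR ger0_norm ?invr_ge0 ?vnorm_ge0 // mulVf.
rewrite -scalemxAr vnormZ nrmcR ger0_norm ?invr_ge0 ?vnorm_ge0 //.
by rewrite mulrC ler_pdivrMr.
Qed.

Lemma opnorm_le X c : 0 <= c -> (forall u, vnorm (X *m u) <= c * vnorm u) -> opnorm X <= c.
Proof.
move=> c0 h; apply: ge_sup; first by have [] := opnorm_has_sup X.
move=> _ [u /= u1 <-]; apply: le_trans (h u) _.
by rewrite -[leRHS]mulr1 ler_wpM2l.
Qed.

Lemma opnorm_ge0 X : 0 <= opnorm X.
Proof.
apply: le_trans (_ : vnorm (X *m 0) <= _); first exact: vnorm_ge0.
apply: ub_le_sup; first by have [] := opnorm_has_sup X.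
by exists 0 => //=; rewrite vnorm0 ler01.
Qed.

Lemma opnorm_le_sum X : opnorm X <= mxsum_norm X.
Proof.
apply: opnorm_le; last exact: vnorm_mul_le.
by apply: sumr_ge0 => i _; apply: sumr_ge0 => j _; exact: nrmc_ge0.
Qed.

Lemma entry_le_opnorm X i j : nrmc (X i j) <= opnorm X.
Proof.
have d1 : vnorm (delta_mx j 0 : 'cV[R[i]]_n.+1) = 1.
  apply/eqP; rewrite -(@eqrXn2 _ 2) ?vnorm_ge0 //; apply/eqP/(@complexI R).
  rewrite -vdot_sqr /vdot (bigD1 j) //= big1 => [|k /negPf kj].
    by rewrite !mxE !eqxx rmorph1 mulr1 addr0 expr1n.
  by rewrite !mxE kj rmorph0 mul0r.
have := opnormP X (delta_mx j 0); rewrite d1 mulr1; apply: le_trans.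
have -> : X i j = (X *m delta_mx j (0 : 'I_1)) i 0 by rewrite -colE mxE.
exact: entry_le_vnorm.
Qed.

Lemma mxadjK : involutive (@mxadj R n.+1).
Proof. by move=> X; apply/matrixP => i j; rewrite !mxE conjCK. Qed.

Lemma mxadjD : {morph @mxadj R n.+1 : X Y / X + Y}.
Proof. by move=> X Y; rewrite /mxadj map_mxD linearD. Qed.

Lemma mxadjZ (z : R[i]) X : mxadj (z *: X) = z^* *: mxadj X.
Proof. by apply/matrixP => i j; rewrite !mxE rmorphM. Qed.

Lemma mxadjM X Y : mxadj (X * Y) = mxadj Y * mxadj X.
Proof. by rewrite /mxadj map_mxM trmx_mul. Qed.

Lemma opnorm_eq0 X : opnorm X = 0 -> X = 0.
Proof.
move=> h; apply/matrixP => i j; rewrite [RHS]mxE; apply: nrmc_eq0 => e e0.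
by apply: le_trans (entry_le_opnorm X i j) _; rewrite h ltW.
Qed.

Lemma opnormD_le X Y : opnorm (X + Y) <= opnorm X + opnorm Y.
Proof.
apply: opnorm_le; first by rewrite addr_ge0 ?opnorm_ge0.
move=> u; rewrite mulmxDl mulrDl; apply: le_trans (vnormD_le _ _) _.
by apply: lerD; exact: opnormP.
Qed.

Lemma opnormZ (z : R[i]) X : opnorm (z *: X) = complex.Re `|z| * opnorm X.
Proof.
have le (a : R[i]) Y : opnorm (a *: Y) <= nrmc a * opnorm Y.
  apply: opnorm_le => [|u]; first by rewrite mulr_ge0 ?nrmc_ge0 ?opnorm_ge0.
  by rewrite -scalemxAl vnormZ -mulrA ler_wpM2l ?nrmc_ge0 // opnormP.
rewrite -/(nrmc z); apply/eqP; rewrite eq_le le /=.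
have [->|z0] := eqVneq z 0; first by rewrite /nrmc normr0 /= mul0r opnorm_ge0.
have zz : nrmc z^-1 * nrmc z = 1.
  by rewrite -nrmcM mulVf // -[RHS]normr1 -nrmcR.
have np : 0 < nrmc z.
  rewrite lt_def nrmc_ge0 andbT; apply/eqP => h; move: zz; rewrite h mulr0 => /esym/eqP.
  by rewrite oner_eq0.
rewrite -ler_pdivlMl // -[X in X^-1 * _]mul1r.
have -> : (1 * nrmc z)^-1 = nrmc z^-1.
  by rewrite mul1r; apply: (mulIf (lt0r_neq0 np)); rewrite zz mulVf // lt0r_neq0.
by rewrite -{1}[X](scalerK z0); exact: le.
Qed.

Lemma opnormM_le X Y : opnorm (X * Y) <= opnorm X * opnorm Y.
Proof.
apply: opnorm_le => [|u]; first by rewrite mulr_ge0 ?opnorm_ge0.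
rewrite -mulmxA; apply: le_trans (opnormP _ _) _.
by rewrite -mulrA ler_wpM2l ?opnorm_ge0 // opnormP.
Qed.

Lemma opnorm_sq_le X : opnorm X ^+ 2 <= opnorm (mxadj X * X).
Proof.
rewrite -[leRHS]sqr_sqrtr ?opnorm_ge0 // lerXn2r ?nnegrE ?sqrtr_ge0 ?opnorm_ge0 //.
apply: opnorm_le => [|u]; first exact: sqrtr_ge0.
rewrite -(@ler_pXn2r _ 2) ?nnegrE ?mulr_ge0 ?sqrtr_ge0 ?vnorm_ge0 //.
rewrite exprMn [Num.sqrt (opnorm _) ^+ 2]sqr_sqrtr ?opnorm_ge0 //.
have -> : vnorm (X *m u) ^+ 2 = nrmc (vdot u (mxadj X * X *m u)).
  apply: (@complexI R); rewrite nrmcE -mulmxA -vdot_adj ger0_norm ?vdot_ge0 //.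
  by rewrite vdot_sqr.
apply: le_trans (vdot_le _ _) _; rewrite expr2 mulrCA ler_wpM2l ?vnorm_ge0 //.
exact: opnormP.
Qed.

Lemma opnorm_adj X : opnorm (mxadj X) = opnorm X.
Proof.
have le Y : opnorm Y <= opnorm (mxadj Y).
  have [->|nz] := eqVneq (opnorm Y) 0; first exact: opnorm_ge0.
  have pos : 0 < opnorm Y by rewrite lt_def nz opnorm_ge0.
  rewrite -(ler_pM2r pos) -expr2; exact: le_trans (opnorm_sq_le _) (opnormM_le _ _).
by apply/eqP; rewrite eq_le le andbT -{2}[X]mxadjK le.
Qed.

Lemma opnorm_star_mul X : opnorm (mxadj X * X) = opnorm X ^+ 2.
Proof.
apply/eqP; rewrite eq_le opnorm_sq_le andbT; apply: le_trans (opnormM_le _ _) _.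
by rewrite opnorm_adj expr2.
Qed.

Lemma opnorm_complete (u : nat -> Mn) :
  (forall eps : R, 0 < eps -> exists N : nat, forall m k : nat,
     (N <= m)%N -> (N <= k)%N -> opnorm (u m - u k) < eps) ->
  exists l : Mn, (fun k => opnorm (u k - l)) @ \oo --> (0 : R).
Proof.
move=> h.
have ent i j : {l : R[i] | forall e : R, 0 < e ->
    exists N, forall k, (N <= k)%N -> nrmc (u k i j - l) < e}.
  apply: cid; apply: complex_complete => e /h [N hN]; exists N => m k Nm Nk.
  apply: le_lt_trans (hN _ _ Nm Nk).
  by have := entry_le_opnorm (u m - u k) i j; rewrite !mxE.
pose l : Mn := \matrix_(i, j) sval (ent i j).
exists l; apply/cvgrPdist_lt => e e0.
pose K : R := (n.+1 * n.+1)%:R + 1.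
have K0 : 0 < K by rewrite /K; have : 0 <= (n.+1 * n.+1)%:R :> R by []; lra.
have eK : 0 < e / K by rewrite divr_gt0.
pose N i j := sval (cid (svalP (ent i j) _ eK)).
exists (\max_i \max_j N i j)%N => // k /= Nk.
rewrite sub0r normrN ger0_norm ?opnorm_ge0 //.
apply: le_lt_trans (opnorm_le_sum _) _.
apply: (@le_lt_trans _ _ (\sum_(i < n.+1) \sum_(j < n.+1) e / K)).
  apply: ler_sum => i _; apply: ler_sum => j _; rewrite !mxE; apply: ltW.
  apply: (svalP (cid (svalP (ent i j) _ eK))).
  apply: leq_trans Nk; apply: leq_trans (leq_bigmax i).
  exact: (@leq_bigmax _ (N i) j).
rewrite !sumr_const !card_ord -mulrnA -mulr_natl mulrA ltr_pdivrMr // mulrC ltr_pM2l //.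
by rewrite /K; lra.
Qed.

End OperatorNorm.

HB.instance Definition _ (R : realType) (n : nat) :=
  isCStarAlgebra.Build R 'M[R[i]]_n.+1
    (@mxadjK R n) (@mxadjD R n) (@mxadjZ R n) (@mxadjM R n)
    (@opnorm_eq0 R n) (@opnormD_le R n) (@opnormZ R n) (@opnormM_le R n)
    (@opnorm_star_mul R n) (@opnorm_complete R n).

Section MatrixRank.
Variables (R : realType) (n : nat).
Local Notation Mn := ('M[R[i]]_n.+1 : cstarAlgType R).

Lemma mx_finite_dimensional : finite_dimensional Mn.
Proof.
exists #|{: 'I_n.+1 * 'I_n.+1}|.
pose e (i : 'I_#|{: 'I_n.+1 * 'I_n.+1}|) : Mn :=
  delta_mx (enum_val i).1 (enum_val i).2.
have reix (F : 'I_n.+1 * 'I_n.+1 -> Mn) : 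
    \sum_(i < #|{: 'I_n.+1 * 'I_n.+1}|) F (enum_val i) = \sum_ij F ij.
  rewrite [RHS](reindex (fun i : 'I_#|{: 'I_n.+1 * 'I_n.+1}| => enum_val i)) //=.
  by exists enum_rank => x _; rewrite ?enum_valK ?enum_rankK.
have sumE (c : 'I_n.+1 * 'I_n.+1 -> R[i]) i j : (\sum_k c (enum_val k) *: e k : Mn) i j = c (i, j).
  rewrite (reix (fun ij => c ij *: delta_mx ij.1 ij.2)) summxE (bigD1 (i, j)) //= big1.
    by rewrite !mxE !eqxx mulr1 addr0.
  move=> [a b]; rewrite !mxE /= xpair_eqE => ne.
  by rewrite [i == a]eq_sym [j == b]eq_sym (negPf ne) mulr0.
exists e.
  move=> x; split=> // _; exists (fun k => x (enum_val k).1 (enum_val k).2).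
  by apply/matrixP => i j; rewrite (sumE (fun ij => x ij.1 ij.2)).
move=> c c0 k.
have := sumE (fun ij => c (enum_rank ij)) (enum_val k).1 (enum_val k).2.
rewrite -surjective_pairing enum_valK => <-.
by under eq_bigr do rewrite enum_valK; rewrite c0 mxE.
Qed.

Lemma mx_has_rank : has_rank Mn n.+1.
Proof.
pose S : set Mn := [set x | exists d, x = diag_mx d].
have SE (x : Mn) : S x <-> forall i j, i != j -> x i j = 0.
  split=> [[d ->] i j /negPf ij|h]; first by rewrite mxE ij.
  exists (\row_i x i i); apply/matrixP => i j; rewrite !mxE.
  by case: eqVneq => [->|/h ->]; rewrite ?mulr1n ?mulr0n.
exists S.
  split.
    split.
      split.
      - by exists 0; rewrite linear0.
      - by move=> _ _ [d ->] [d' ->]; exists (d + d'); rewrite linearD.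
      - by move=> c _ [d ->]; exists (c *: d); rewrite linearZ.
      - by move=> _ _ [d ->] [d' ->]; eexists; exact: mulmx_diag.
      - move=> x /SE h; apply/SE => i j ij.
        by rewrite !mxE h ?rmorph0 // eq_sym.
    by move=> _ _ [d ->] [d' ->]; exact: diag_mxC.
  move=> T [_ Tc] ST; apply/seteqP; split=> // x Tx; apply/SE => i j ij.
  have Sd : S (delta_mx i i).
    by apply/SE => a b ab; rewrite mxE; case: (eqVneq a i) => [<-|//]; rewrite eq_sym (negPf ab).
  have /matrixP /(_ i j) := Tc _ _ (ST _ Sd) Tx.
  rewrite !mxE (bigD1 i) //= big1 ?addr0 => [|k /negPf ki]; last by rewrite mxE ki andbF mul0r.
  rewrite mxE !eqxx mul1r big1 // => k _; rewrite mxE [j == i]eq_sym (negPf ij) andbF mulr0 //.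
pose e (i : 'I_n.+1) : Mn := delta_mx i i.
have sumE (c : 'I_n.+1 -> R[i]) i j : (\sum_k c k *: e k : Mn) i j = if i == j then c i else 0.
  rewrite summxE (bigD1 i) //= big1 ?addr0 => [|k /negPf ki].
    by rewrite !mxE eqxx /= eq_sym; case: eqP; rewrite ?mulr1 ?mulr0.
  by rewrite !mxE eq_sym ki mulr0.
exists e.
  move=> x; split=> [/SE h|[c ->]].
    exists (fun i => x i i); apply/matrixP => i j; rewrite sumE.
    by case: eqVneq => [->|/h].
  by apply/SE => i j /negPf ij; rewrite sumE ij.
by move=> c c0 i; have := sumE c i i; rewrite c0 eqxx mxE.
Qed.

End MatrixRank.

Lemma linear_ex (K : pzRingType) (U V : lmodType K) (g : U -> V) :
  (forall x y, g (x + y) = g x + g y) -> (forall c x, g (c *: x) = c *: g x) ->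
  exists f : {linear U -> V}, forall x, f x = g x.
Proof.
move=> gD gZ.
have lin : linear g by move=> c x y; rewrite gD gZ.
pose m := GRing.isLinear.Build K U V *:%R g lin.
pose f : {linear U -> V} := HB.pack g m.
by exists f.
Qed.

(** * Compressions and expansions *)

Section PositiveKernels.
Variable R : realType.
Local Notation C := R[i].
Local Open Scope sesquilinear_scope.

(** By the spectral theorem [K = P^* D P] with [D] nonnegative, and [Y] is the square root of [D]
    times [P]. *)
Lemma psd_matrix_square n (K : 'M[C]_n) : (forall i j, K j i = (K i j)^*) ->
  (forall v : 'I_n -> C, 0 <= \sum_i \sum_j (v i)^* * v j * K i j) ->
  exists Y : 'M[C]_n, forall i j, K i j = \sum_k (Y k i)^* * Y k j.
Proof.
move=> Kh Kpos.
have Kadj : K^t* = K by apply/matrixP => i j; rewrite !mxE -Kh.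
have /orthomx_spectralP : K \is normalmx by apply/normalmxP; rewrite Kadj.
set P := spectralmx K; set D := spectral_diag K.
have Pu : P \is unitarymx by exact: spectral_unitarymx.
rewrite invmx_unitary // => KE.
have PP : P *m P^t* = 1%:M by exact/unitarymxP.
have D0 k : 0 <= D 0 k.
  have <- : (P *m K *m P^t*) k k = D 0 k.
    by rewrite KE !mulmxA PP mul1mx -mulmxA PP mulmx1 mxE eqxx mulr1n.
  have := Kpos (fun i => (P k i)^*).
  have -> // : \sum_i \sum_j (P k i)^*^* * (P k j)^* * K i j = (P *m K *m P^t*) k k.
  rewrite exchange_big mxE; apply: eq_bigr => j _ /=; rewrite !mxE mulr_suml.
  by apply: eq_bigr => i _; rewrite conjCK mulrAC.
pose d : 'rV[C]_n := \row_k sqrtC (D 0 k).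
exists (diag_mx d *m P) => i j; rewrite {1}KE mxE; apply: eq_bigr => k _.
rewrite mul_mx_diag !mul_diag_mx !mxE rmorphM /=.
have -> : (sqrtC (D 0 k))^* = sqrtC (D 0 k) by apply/CrealP/ger0_real; rewrite sqrtC_ge0.
by rewrite mulrACA -expr2 sqrtCK mulrCA mulrA.
Qed.

End PositiveKernels.

Section Compression.
Variables (R : realType) (A : cstarAlgType R) (tau : A -> R[i]).
Hypotheses (tauD : forall x y, tau (x + y) = tau x + tau y)
  (tauZ : forall c x, tau (c *: x) = c * tau x)
  (tauC : forall a b, tau (star b * a) = (tau (star a * b))^*)
  (tau_ge0 : forall x, 0 <= tau (star x * x)).
Variables (n : nat) (E : 'I_n.+1 -> A).
Hypothesis E_orth : forall i j, tau (star (E i) * E j) = (i == j)%:R.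
Implicit Types (x y : A).

Let tau0 : tau 0 = 0. Proof. by rewrite -(scale0r 0) tauZ mul0r. Qed.

Let tauZZ (c d : R[i]) x y : tau (star (c *: x) * (d *: y)) = c^* * d * tau (star x * y).
Proof. by rewrite starZ -scalerAl -scalerAr !tauZ mulrA. Qed.

Let tauB x y : tau (x - y) = tau x - tau y.
Proof. by rewrite tauD -scaleN1r tauZ mulN1r. Qed.

Let tau_sum (I : Type) (t : seq I) (D : pred I) (F : I -> A) :
  tau (\sum_(i <- t | D i) F i) = \sum_(i <- t | D i) tau (F i).
Proof. by apply: (big_morph _ tauD tau0). Qed.

(** For [t > |x|] the element [1 - x^* x / t^2] is a square [c^2] by [sqrt_one_sub], and positivity
    at [c y] is the estimate with [t]. Then [t] decreases to [|x|]. *)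
Lemma positive_functional_le x y :
  tau (star (x * y) * (x * y)) <= (cnorm x ^+ 2)%:C * tau (star y * y).
Proof.
set q := tau (star y * y).
have [u u0 qu] : exists2 u : R, 0 <= u & q = u%:C.
  exists (complex.Re q); last by rewrite RRe_real // ger0_real // tau_ge0.
  by have := tau_ge0 y; rewrite lecE => /andP[].
have [v vE] : exists v : R, tau (star (x * y) * (x * y)) = v%:C.
  by exists (complex.Re (tau (star (x * y) * (x * y)))); rewrite RRe_real // ger0_real // tau_ge0.
rewrite vE qu -rmorphM /= lecR.
have x0 := cnorm_ge0 x.
have bd t : cnorm x < t -> v <= t ^+ 2 * u.
  move=> xt; have t0 : 0 < t by lra.
  pose h := (t ^+ 2)^-1%:C *: (star x * x).
  have hs : star h = h by rewrite starZr starM starK.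
  have h1 : cnorm h < 1.
    rewrite cnormZr cnorm_star_mul ger0_norm ?invr_ge0 ?sqr_ge0 // mulrC.
    rewrite ltr_pdivrMr ?exprn_gt0 // mul1r ltrXn2r // ?nnegrE // ltW //.
  have [c [cs cc _]] := sqrt_one_sub hs h1.
  have := tau_ge0 (c * y).
  have -> : star (c * y) * (c * y) = star y * y - (t ^+ 2)^-1%:C *: (star (x * y) * (x * y)).
    rewrite !starM cs !mulrA -[star y * c * c]mulrA cc mulrBr mulr1 mulrBl; congr (_ - _).
    by rewrite /h -scalerAr -scalerAl !mulrA.
  rewrite tauB tauZ vE -/q qu -rmorphM -rmorphB /= -(rmorph0 (real_complex R)) lecR.
  by rewrite subr_ge0 mulrC ler_pdivrMr ?exprn_gt0 // mulrC.
apply/ler_addgt0Pr => e e0.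
pose d := Num.min 1 (e / ((2 * cnorm x + 1) * (u + 1))).
have K0 : 0 < (2 * cnorm x + 1) * (u + 1) by rewrite mulr_gt0 //; lra.
have d0 : 0 < d by rewrite lt_min ltr01 divr_gt0.
have d1 : d <= 1 by rewrite ge_min lexx.
have d2 : d * ((2 * cnorm x + 1) * (u + 1)) <= e.
  by rewrite -ler_pdivlMr // ge_min lexx orbT.
have := bd (cnorm x + d); rewrite ltrDl => /(_ d0); nra.
Qed.

(** [psi] is the GNS representation of [tau] compressed to the orthonormal vectors given by the
    [E i], written without the Hilbert space. *)
Lemma compression_ex : exists psi : {linear A -> 'M[R[i]]_n.+1},
  [/\ forall x i j, psi x i j = tau (star (E i) * x * E j), ucp psi
    & forall x, cnorm (psi x) <= cnorm x].
Proof.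
have [psi psiE] : exists psi : {linear A -> 'M[R[i]]_n.+1}, forall x,
    psi x = \matrix_(i, j) tau (star (E i) * x * E j).
  apply: linear_ex.
    by move=> x y; apply/matrixP => i j; rewrite !mxE mulrDr mulrDl tauD.
  by move=> c x; apply/matrixP => i j; rewrite !mxE -scalerAr -scalerAl tauZ.
have pE x i j : psi x i j = tau (star (E i) * x * E j) by rewrite psiE mxE.
exists psi; split=> //.
  split; first by apply/matrixP => i j; rewrite pE mulr1 E_orth mxE.
  move=> q P [X PE].
  (* A matrix of matrices is flattened to a scalar matrix indexed by pairs. The square factor found
     there folds back to the size that [positive_mx] demands. *)
  pose T := ('I_q * 'I_n.+1)%type.
  pose K (a b : T) : R[i] := psi (P a.1 b.1) a.2 b.2.
  have KE a b : K a b = \sum_c tau (star (X c a.1 * E a.2) * (X c b.1 * E b.2)).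
    rewrite /K pE PE mxE mulr_sumr mulr_suml tau_sum; apply: eq_bigr => c _.
    by rewrite mxE starM !mulrA.
  have reix (F : T -> R[i]) : \sum_(i < #|{: T}|) F (enum_val i) = \sum_ij F ij.
    rewrite [RHS](reindex (fun i : 'I_#|{: T}| => enum_val i)) //=.
    by exists enum_rank => z _; rewrite ?enum_valK ?enum_rankK.
  have [||Y YE] := @psd_matrix_square R #|{: T}| (\matrix_(i, j) K (enum_val i) (enum_val j)).
  - move=> i j; rewrite !mxE !KE rmorph_sum; apply: eq_bigr => c _.
    exact: tauC.
  - move=> v.
    have -> : \sum_i \sum_j (v i)^* * v j *
        (\matrix_(i, j) K (enum_val i) (enum_val j)) i j =
      \sum_c tau (star (\sum_i v i *: (X c (enum_val i).1 * E (enum_val i).2)) *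
                  (\sum_i v i *: (X c (enum_val i).1 * E (enum_val i).2))).
      under [RHS]eq_bigr => c _.
        rewrite star_sum mulr_suml tau_sum.
        under eq_bigr => i _ do rewrite mulr_sumr tau_sum.
        over.
      rewrite [RHS]exchange_big; apply: eq_bigr => i _.
      rewrite [RHS]exchange_big; apply: eq_bigr => j _.
      rewrite mxE KE mulr_sumr; apply: eq_bigr => c _.
      by rewrite tauZZ.
    by apply: sumr_ge0 => c _; exact: tau_ge0.
  exists (\matrix_(c, a) \matrix_(k, i) Y (enum_rank (c, k)) (enum_rank (a, i))).
  apply/matrixP => a b; apply/matrixP => i j; rewrite !mxE.
  have := YE (enum_rank (a, i)) (enum_rank (b, j)); rewrite mxE !enum_rankK /K /= => ->.
  rewrite summxE.
  transitivity (\sum_(ck : T) (Y (enum_rank (ck.1, ck.2)) (enum_rank (a, i)))^* *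
      Y (enum_rank (ck.1, ck.2)) (enum_rank (b, j))).
    by rewrite -reix; apply: eq_bigr => k _; rewrite -surjective_pairing enum_valK.
  rewrite -(pair_bigA _ (fun c k => (Y (enum_rank (c, k)) (enum_rank (a, i)))^* * Y (enum_rank (c, k)) (enum_rank (b, j)))) /=.
  apply: eq_bigr => c _; rewrite !mxE; apply: eq_bigr => k _.
  by rewrite !mxE.
move=> x; apply: opnorm_le => [|v]; first exact: cnorm_ge0.
have [->|wn] := eqVneq (vnorm (psi x *m v)) 0; first by rewrite mulr_ge0 ?cnorm_ge0 ?vnorm_ge0.
set w := psi x *m v in wn *.
have wp : 0 < vnorm w by rewrite lt_def wn vnorm_ge0.
(* An element of [A] representing the vector [u]. Cauchy-Schwarz for [tau] between [hat w] and
   [x * hat v] bounds [psi x] by the norm of [x]. *)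
pose hat (u : 'cV[R[i]]_n.+1) := \sum_i u i 0 *: E i.
have tau_hat u u' y : tau (star (hat u) * y * hat u') =
    \sum_i \sum_j (u i 0)^* * u' j 0 * tau (star (E i) * y * E j).
  rewrite /hat star_sum !mulr_suml tau_sum; apply: eq_bigr => i _.
  rewrite mulr_sumr tau_sum; apply: eq_bigr => j _.
  by rewrite -mulrA -[y * (_ *: _)]scalerAr tauZZ mulrA.
have tau_hat1 u : tau (star (hat u) * hat u) = (vnorm u ^+ 2)%:C.
  rewrite -vdot_sqr -[star (hat u)]mulr1 tau_hat /vdot; apply: eq_bigr => i _.
  rewrite (bigD1 i) //= mulr1 E_orth eqxx mulr1 big1 ?addr0 // => j /negPf ji.
  by rewrite E_orth eq_sym ji mulr0.
have dE : vdot w w = tau (star (hat w) * (x * hat v)).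
  rewrite mulrA tau_hat {2}/w /vdot; apply: eq_bigr => i _.
  by rewrite mxE mulr_sumr; apply: eq_bigr => j _; rewrite pE; ring.
have cs := form_cauchy_schwarz (q := fun a b => tau (star a * b)) (V := A).
have {}cs : `|tau (star (hat w) * (x * hat v))| ^+ 2 <=
    tau (star (hat w) * hat w) * tau (star (x * hat v) * (x * hat v)).
  apply: cs => //; first by move=> a b c; rewrite mulrDr tauD.
  by move=> z a b; rewrite -scalerAr tauZ.
have := le_trans cs (ler_wpM2l (tau_ge0 _) (positive_functional_le x (hat v))).
rewrite -dE !tau_hat1 vdot_sqr -nrmcE nrmcR -rmorphXn -!rmorphM /= lecR.
rewrite ger0_norm ?sqr_ge0 // -!exprMn ler_pXn2r ?nnegrE ?mulr_ge0 ?sqr_ge0 ?vnorm_ge0 ?cnorm_ge0 //.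
by rewrite expr2 ler_pM2l.
Qed.

End Compression.

Section Expansion.
Variables (R : realType) (A : cstarAlgType R) (B : finType) (V : B -> A).
Variables (n : nat) (E : 'I_n.+1 -> A) (t : 'I_n.+1 -> B) (U : 'I_n.+1 -> B -> A) (q : R).
Hypotheses (EV : forall i, E i * V (t i) = E i) (q_gt0 : 0 < q)
  (E_sum : \sum_i E i * star (E i) = q%:C *: 1)
  (U_orth : forall i j b c, star (U i b) * U j c = if (i == j) && (b == c) then V b else 0)
  (UV : forall i b, U i b * V b = U i b).
Local Notation Mn := ('M[R[i]]_n.+1).
Implicit Types X Y : Mn.

(* X |-> W theta(X) W^* for the homomorphism theta sending the matrix unit
   (i, j) to sum_b U_ib U_jb^* and W = q^(-1/2) sum_i E_i U_(i, t i)^*. *)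
Lemma expansion_ex : exists phi : {linear Mn -> A},
  [/\ forall X, phi X = q^-1%:C *:
        \sum_i \sum_j X i j *: (if t i == t j then E i * star (E j) else 0), ucp phi
    & forall X, cnorm (phi X) <= cnorm X].
Proof.
pose theta0 X := \sum_i \sum_j X i j *: (\sum_b U i b * star (U j b)).
have [theta thetaE] : exists theta : {linear Mn -> A}, forall X, theta X = theta0 X.
  apply: linear_ex => [X Y|c X]; rewrite /theta0.
    rewrite -big_split; apply: eq_bigr => i _; rewrite -big_split; apply: eq_bigr => j _.
    by rewrite mxE scalerDl.
  rewrite scaler_sumr; apply: eq_bigr => i _; rewrite scaler_sumr; apply: eq_bigr => j _.
  by rewrite mxE scalerA.
have VU i b : V b * star (U i b) = star (U i b).
  have -> : V b = star (U i b) * U i b by rewrite U_orth !eqxx.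
  rewrite -{1}[star (U i b) * U i b]starK starM starK -starM mulrA.
  by rewrite -mulrA U_orth !eqxx UV.
have UU i j k l : (\sum_b U i b * star (U j b)) * (\sum_b U k b * star (U l b)) =
    if j == k then \sum_b U i b * star (U l b) else 0.
  rewrite mulr_suml.
  transitivity (\sum_b if j == k then U i b * star (U l b) else 0); last first.
    by case: eqP => // _; rewrite big1.
  apply: eq_bigr => b _; rewrite mulr_sumr (bigD1 b) //= big1 ?addr0.
    by rewrite mulrA -[_ * _ * U k b]mulrA U_orth eqxx andbT; case: eqP => _;
      rewrite ?UV // mulr0 mul0r.
  move=> c /negPf cb; rewrite mulrA -[_ * _ * U k c]mulrA U_orth eq_sym [b == c]eq_sym cb andbF.
  by rewrite mulr0 mul0r.
have theta_hom : star_hom theta.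
  split=> [X Y|X]; rewrite !thetaE /theta0.
    rewrite mulr_suml; apply: eq_bigr => i _; rewrite mulr_suml.
    under eq_bigr => j _ do rewrite mxE scaler_suml.
    rewrite exchange_big /=; apply: eq_bigr => k _.
    rewrite mulr_sumr [RHS](bigD1 k) //= [X in _ + X]big1 ?addr0; last first.
      move=> k' /negPf kk; rewrite mulr_sumr big1 // => l _.
      by rewrite -scalerAl -scalerAr UU eq_sym kk !scaler0.
    rewrite mulr_sumr; apply: eq_bigr => l _.
    by rewrite -scalerAl -scalerAr UU eqxx scalerA.
  rewrite star_sum exchange_big; apply: eq_bigr => i _; rewrite star_sum.
  apply: eq_bigr => j _; rewrite starZ !mxE star_sum; congr (_ *: _).
  by apply: eq_bigr => b _; rewrite starM starK.
pose W := (Num.sqrt q)^-1%:C *: \sum_i E i * star (U i (t i)).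
have qW x : (Num.sqrt q)^-1%:C *: ((Num.sqrt q)^-1%:C *: x) = q^-1%:C *: x :> A.
  by rewrite scalerA -rmorphM /= -invfM -expr2 sqr_sqrtr // ltW.
have sW : star W = (Num.sqrt q)^-1%:C *: \sum_i U i (t i) * star (E i).
  by rewrite starZr star_sum; congr (_ *: _); apply: eq_bigr => i _; rewrite starM starK.
have phiE X : W * theta X * star W = q^-1%:C *:
    \sum_i \sum_j X i j *: (if t i == t j then E i * star (E j) else 0).
  rewrite thetaE sW /W -!scalerAl -scalerAr qW; congr (_ *: _).
  rewrite !mulr_suml; apply: eq_bigr => i _.
  transitivity (\sum_j E i * star (U i (t i)) * (X i j *: \sum_b U i b * star (U j b)) * (U j (t j) * star (E j))).
    have -> : E i * star (U i (t i)) * theta0 X =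
        \sum_j E i * star (U i (t i)) * (X i j *: \sum_b U i b * star (U j b)).
      rewrite /theta0 mulr_sumr (bigD1 i) //= [X in _ + X]big1 ?addr0; last first.
        move=> k /negPf ki; rewrite mulr_sumr big1 // => j _.
        rewrite -scalerAr mulr_sumr big1 ?scaler0 // => b _.
        by rewrite mulrA -[_ * _ * U k b]mulrA U_orth eq_sym ki mulr0 mul0r.
      by rewrite mulr_sumr.
    rewrite mulr_suml; apply: eq_bigr => j _.
    rewrite mulr_sumr (bigD1 j) //= [X in _ + X]big1 ?addr0 // => k /negPf kj.
    rewrite -scalerAr -scalerAl mulr_sumr mulr_suml big1 ?scaler0 // => b _.
    rewrite -!mulrA [star (U j b) * _]mulrA U_orth eq_sym kj /=.
    by rewrite !(mul0r, mulr0).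
  apply: eq_bigr => j _; rewrite -scalerAr -scalerAl; congr (_ *: _).
  rewrite mulr_sumr mulr_suml (bigD1 (t i)) //= [X in _ + X]big1 ?addr0.
    have -> : E i * star (U i (t i)) * (U i (t i) * star (U j (t i))) * (U j (t j) * star (E j)) =
      E i * (star (U i (t i)) * U i (t i)) * (star (U j (t i)) * U j (t j)) * star (E j).
      by rewrite !mulrA.
    rewrite !U_orth !eqxx /= EV; case: eqP => [e|_]; last by rewrite mulr0 mul0r.
    by rewrite EV.
  move=> b /negPf bt.
  have -> : E i * star (U i (t i)) * (U i b * star (U j b)) * (U j (t j) * star (E j)) =
      E i * (star (U i (t i)) * U i b) * (star (U j b) * U j (t j)) * star (E j).
    by rewrite !mulrA.
  by rewrite (U_orth i i) eqxx [t i == b]eq_sym bt mulr0 !mul0r.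
have [phi phi_eq] : exists phi : {linear Mn -> A}, forall X, phi X = W * theta X * star W.
  apply: linear_ex => [X Y|c X]; first by rewrite linearD mulrDr mulrDl.
  by rewrite linearZ /= -scalerAr -scalerAl.
(* [W] is a coisometry by [E_sum]; its norm 1 and the contractivity of [theta] make [phi]
   contractive. *)
have WW : W * star W = 1.
  rewrite sW /W -scalerAl -scalerAr qW mulr_suml.
  transitivity (q^-1%:C *: \sum_i E i * star (E i)).
    congr (_ *: _); apply: eq_bigr => i _; rewrite mulr_sumr (bigD1 i) //= big1 ?addr0.
      by rewrite mulrA -[_ * _ * U i (t i)]mulrA U_orth !eqxx EV.
    move=> j /negPf ji; rewrite mulrA -[_ * _ * U j (t j)]mulrA U_orth eq_sym ji.
    by rewrite mulr0 mul0r.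
  by rewrite E_sum scalerA -rmorphM /= mulVf ?gt_eqF // rmorph1 scale1r.
have W1 : cnorm W = 1.
  apply/eqP; rewrite -(@eqrXn2 _ 2) ?cnorm_ge0 // -cnorm_mul_star WW cnorm1 expr1n //.
exists phi; split.
- by move=> X; rewrite phi_eq phiE.
- split.
    rewrite phi_eq phiE -[RHS](scale1r 1) -(rmorph1 (real_complex R)) -(mulVf (lt0r_neq0 q_gt0)).
    rewrite rmorphM -scalerA -E_sum /=; congr (_ *: _); apply: eq_bigr => i _.
    rewrite (bigD1 i) //= big1 ?addr0 => [|j /negPf ji]; first by rewrite mxE !eqxx scale1r.
    by rewrite mxE eq_sym ji scale0r.
  move=> p P [X ->]; exists (\matrix_(c, a) (theta (X c a) * star W)).
  apply/matrixP => a b; rewrite !mxE phi_eq linear_sum mulr_sumr mulr_suml.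
  apply: eq_bigr => c _; rewrite !mxE; case: theta_hom => hM hS.
  by rewrite hM hS starM starK !mulrA.
move=> X; rewrite phi_eq; apply: le_trans (cnormM_le _ _) _; rewrite cnorm_star W1 mulr1.
apply: le_trans (cnormM_le _ _) _; rewrite W1 mul1r.
exact: star_hom_contractive theta_hom.
Qed.

End Expansion.

(** * Upper bound for the rank *)

Section FolnerRatio.
Variable r : nat.
Implicit Types (alpha beta : degree r).

Definition ffun_degree (L : nat) (g : {ffun 'I_r -> 'I_L.+1}) : degree r := [ffun i => g i : nat].

(** A monomial [s_u s_v^*] with [u], [v] of shapes [alpha], [beta] can have nonzero matrix entries
    only between words of degrees [m + g] and [m + g'] for these pairs. *)
Definition matching_pairs (L : nat) alpha beta :=
  [set gg : {ffun 'I_r -> 'I_L.+1} * {ffun 'I_r -> 'I_L.+1} |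
    degreeD (ffun_degree gg.2) alpha == degreeD (ffun_degree gg.1) beta]%SET.

Lemma matching_pairs_le (L : nat) alpha beta : (#|matching_pairs L alpha beta| <= L.+1 ^ r)%N.
Proof.
have -> : (L.+1 ^ r)%N = #|{: {ffun 'I_r -> 'I_L.+1}}| by rewrite card_ffun !card_ord.
rewrite -(card_in_imset (f := fst) (D := matching_pairs L alpha beta)); first exact: max_card.
move=> [g1 g2] [h1 h2]; rewrite !inE /= => /eqP/ffunP e /eqP/ffunP e' gh; subst h1.
congr (_, _); apply/ffunP => i; apply: val_inj; have := e i; have := e' i; rewrite !ffunE /=; lia.
Qed.

(** Every [g] at distance at least [K] from the faces of the box has its partner [g + beta - alpha]
    inside the box. *)
Lemma matching_pairs_ge (L K : nat) alpha beta :
  (forall i, (alpha i <= K)%N) -> (forall i, (beta i <= K)%N) ->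
  ((L.+1 - K.*2) ^ r <= #|matching_pairs L alpha beta|)%N.
Proof.
move=> aK bK.
pose P : pred 'I_L.+1 := fun x => (K <= x)%N && (x + K <= L)%N.
have cP : (L.+1 - K.*2 <= #|P|)%N.
  have [LK|LK] := leqP (L.+1) K.*2; first by rewrite (eqP (_ : _ - _ == 0)%N) // subn_eq0.
  pose h (x : 'I_(L.+1 - K.*2)) : 'I_L.+1 := inord (K + x).
  have hE x : nat_of_ord (h x) = (K + x)%N by rewrite inordK //; have := ltn_ord x; lia.
  rewrite -[X in (X <= _)%N]card_ord -(card_imset (f := h)); last first.
    by move=> x y /(congr1 (@nat_of_ord _)); rewrite !hE => /addnI/val_inj.
  apply: subset_leq_card; apply/fintype.subsetP => _ /imsetP[x _ ->].
  by rewrite unfold_in /P hE; have := ltn_ord x; lia.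
apply: leq_trans (_ : #|(ffun_on P : pred {ffun 'I_r -> 'I_L.+1})| <= _)%N.
  by rewrite card_ffun_on card_ord; case: (posnP r) => [->//|r0]; rewrite leq_exp2r.
pose h (g : {ffun 'I_r -> 'I_L.+1}) :=
  (g, [ffun i => inord (g i + beta i - alpha i) : 'I_L.+1]).
rewrite -(card_imset (f := h)); last by move=> x y [].
apply: subset_leq_card; apply/fintype.subsetP => _ /imsetP[g /ffun_onP gP ->].
rewrite inE; apply/eqP/ffunP => i; rewrite !ffunE /= inordK; have := gP i; rewrite unfold_in /P /=;
  have := aK i; have := bK i; lia.
Qed.

Variable R : realType.

Definition folner_ratio (L : nat) alpha beta : R :=
  (L.+1 ^ r)%:R^-1 * #|matching_pairs L alpha beta|%:R.

Lemma bernoulli_le (x : R) (n : nat) : 0 <= x <= 1 -> 1 - n%:R * x <= (1 - x) ^+ n.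
Proof.
move=> /andP[x0 x1]; elim: n => [|n IH]; first by rewrite mul0r subr0 expr0.
rewrite exprS -natr1.
have : (1 - x) * (1 - n%:R * x) <= (1 - x) * (1 - x) ^+ n by rewrite ler_wpM2l //; lra.
have : 0 <= n%:R * x * x by rewrite !mulr_ge0.
lra.
Qed.

Lemma folner_ratio_limit alpha beta (delta : R) : 0 < delta ->
  exists L0, forall L, (L0 <= L)%N -> `|folner_ratio L alpha beta - 1| <= delta.
Proof.
move=> d0; pose K := (\sum_i (alpha i + beta i))%N.
have aK i : (alpha i <= K)%N by rewrite /K (bigD1 i) //=; lia.
have bK i : (beta i <= K)%N by rewrite /K (bigD1 i) //=; lia.
(* The first summand ensures [2K <= L + 1], the second [2rK / (L + 1) <= delta]; by Bernoulli's
   inequality the ratio is at least [1 - 2rK / (L + 1)]. *)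
exists (K.*2 + Num.truncn (r%:R * K.*2%:R / delta))%N => L hL.
have L0 : 0 < L.+1%:R :> R by [].
have le1 : folner_ratio L alpha beta <= 1.
  rewrite /folner_ratio mulrC ler_pdivrMr ?ltr0n ?expn_gt0 // mul1r ler_nat.
  exact: matching_pairs_le.
rewrite distrC ger0_norm ?subr_ge0 // lerBlDr -lerBlDl.
have KL : (K.*2 <= L.+1)%N by lia.
pose x : R := K.*2%:R / L.+1%:R.
have x01 : 0 <= x <= 1 by rewrite /x divr_ge0 //= ler_pdivrMr // mul1r ler_nat.
have := bernoulli_le r x01.
have xd : r%:R * x <= delta.
  rewrite /x mulrA ler_pdivrMr // [leRHS]mulrC -ler_pdivrMr //.
  apply: ltW; apply: lt_le_trans (truncnS_gt _) _; rewrite ler_nat ltnS.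
  exact: leq_trans (leq_addl _ _) hL.
suff : (1 - x) ^+ r <= folner_ratio L alpha beta by lra.
have -> : 1 - x = (L.+1 - K.*2)%:R / L.+1%:R.
  by rewrite natrB // mulrBl divff // gt_eqF.
rewrite exprMn exprVn /folner_ratio natrX mulrC ler_wpM2l ?invr_ge0 ?exprn_ge0 //.
by rewrite -natrX ler_nat matching_pairs_ge.
Qed.

End FolnerRatio.

Section UpperBound.
Variables (R : realType) (r : nat) (B : finType) (M : 'I_r -> rel B).
Hypotheses (r_gt0 : (0 < r)%N) (H0 : RS_H0 M) (H1 : RS_H1 M) (H2 : RS_H2 M) (H3 : RS_H3 M).
Variables (A : cstarAlgType R) (s : forall m : degree r, word M m -> A).
Hypothesis CK : is_CK_algebra s.
Implicit Types (k l m p : degree r) (a b : B) (x y : A).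
Local Notation word := (word M).
Local Notation S w := (s w).
Local Notation V a := (s (vertex M a)).
Local Notation Q w := (s w * star (s w)).
Local Notation Phi := (shift_map s).

Lemma path_from_ex b : exists xi, infinite_path M xi /\ xi (degree0 r) = b.
Proof.
have [xi xiP h] := infinite_path_ex H0 H1 H2 (vertex M b); exists xi; split=> //.
by rewrite -h ?degree_le0 // vertex_letter.
Qed.

Let xi b := sval (cid (path_from_ex b)).
Let xiP b : infinite_path M (xi b) := (svalP (cid (path_from_ex b))).1.
Let xi0 b : xi b (degree0 r) = b := (svalP (cid (path_from_ex b))).2.

(** A sum rather than a mean over the letters: every vertex projection gets the value 1, so distinct
    words become orthonormal and the compression is unital. *)
Definition vertex_weight x : R[i] := \sum_b path_state H1 H2 CK (xiP b) x.
Local Notation tau := vertex_weight.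

Lemma vertex_weightD x y : tau (x + y) = tau x + tau y.
Proof. by rewrite /tau -big_split; apply: eq_bigr => b _; rewrite path_stateD. Qed.

Lemma vertex_weightZ c x : tau (c *: x) = c * tau x.
Proof. by rewrite /tau mulr_sumr; apply: eq_bigr => b _; rewrite path_stateZ. Qed.

Lemma vertex_weight0 : tau 0 = 0.
Proof. by rewrite -(scale0r 0) vertex_weightZ mul0r. Qed.

Lemma vertex_weight_ge0 x : 0 <= tau (star x * x).
Proof. by apply: sumr_ge0 => b _; exact: path_state_ge0. Qed.

Lemma vertex_weightC x y : tau (star y * x) = (tau (star x * y))^*.
Proof.
rewrite /tau rmorph_sum; apply: eq_bigr => b _ /=.
apply: (state_conj (f := path_state H1 H2 CK (xiP b))); split.
- exact: path_stateD.
- exact: path_stateZ.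
- exact: path_state_ge0.
- exact: path_state1.
Qed.

Lemma vertex_weight_vertex a : tau (V a) = 1.
Proof.
rewrite /tau (bigD1 a) //= big1 ?addr0 => [|b /negPf ba].
  by rewrite path_state_vertex xi0 eqxx.
by rewrite path_state_vertex xi0 eq_sym ba.
Qed.

Lemma vertex_weight_eigen0 z x : gauge CK z x = - x -> tau x = 0.
Proof. by move=> e; rewrite /tau big1 // => b _; exact: path_state_eigen0 e. Qed.

(** The gauge-spectral subspace of degree [k - l], given by a pair because degrees are natural
    numbers. *)
Definition homogeneous k l x := forall z : torus R r,
  gauge CK z x = (zpow z k * (zpow z l)^*) *: x.

Lemma homogeneous_shift k l p x : homogeneous k l x -> homogeneous k l (Phi p x).
Proof.
move=> h z; rewrite /shift_map linear_sum scaler_sumr; apply: eq_bigr => w _.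
rewrite /= !gaugeM gauge_star !gaugeS h starZ -!(scalerAl, scalerAr) !scalerA.
congr (_ *: _); have := zpow_conjV z p; set u := zpow z p => uu.
by rewrite -[RHS]mul1r -uu; ring.
Qed.

Lemma vertex_weight_homogeneous k l x m n (w : word m) (w' : word n) :
  homogeneous k l x -> degreeD n k != degreeD m l -> tau (star (S w) * x * S w') = 0.
Proof.
move=> h /(torus_separates R) [z hz]; apply: (@vertex_weight_eigen0 z).
rewrite !gaugeM gauge_star !gaugeS h starZ -!(scalerAl, scalerAr) !scalerA -scaleN1r -hz.
by congr (_ *: _); rewrite !zpowD rmorphM /=; ring.
Qed.

Lemma vertex_weight_words m n (w : word m) (w' : word n) :
  tau (star (S w) * S w') = (Tagged word w == Tagged word w')%:R.
Proof.
have [e|ne] := eqVneq m n.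
  subst n; rewrite eq_Tagged /= (ck_starS CK); case: eqP => _; last exact: vertex_weight0.
  exact: vertex_weight_vertex.
have -> : (Tagged word w == Tagged word w') = false.
  by apply/negbTE; apply: contra ne => /eqP/(congr1 (@tag _ _))/= ->.
rewrite -[star (S w)]mulr1; apply: (@vertex_weight_homogeneous (degree0 r) (degree0 r)).
  move=> z; rewrite zpow0 rmorph1 mulr1 scale1r.
  rewrite -{1}(ck_one CK) linear_sum -[RHS](ck_one CK); apply: eq_bigr => b _ /=.
  by rewrite gaugeS zpow0 scale1r.
by rewrite !degreeD0 eq_sym.
Qed.

(** When all blocks of [x] are scalar multiples of vertex projections, [vertex_weight] recovers the
    scalars and nothing of [x] is lost; this makes the composition exact on shifted monomials, up to
    the ratio. *)
Definition block_scalar k l x := forall (w : word k) (w' : word l), exists c : R[i],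
  star (S w) * x * S w' = c *: V (terminus w) /\ (terminus w != terminus w' -> c = 0).

Lemma block_scalar_monomial k l m (u : word k) (v : word l) :
  block_scalar (degreeD k m) (degreeD l m) (S u * star (S v)).
Proof.
move=> w w'.
have [u1 [u2 c]] := cat_split w erefl; have [v1 [v2 c']] := cat_split w' erefl.
have -> : star (S w) * (S u * star (S v)) * S w' = (star (S w) * S u) * (star (S v) * S w').
  by rewrite !mulrA.
rewrite (ck_starS_cat CK _ c) (ck_starS_cat' CK _ c') (is_cat_terminus c) (is_cat_terminus c').
case: eqP => _; last by exists 0; rewrite mul0r scale0r.
case: eqP => _; last by exists 0; rewrite mulr0 scale0r.
rewrite (ck_starS CK); case: eqP => [<-|_]; last by exists 0; rewrite scale0r.
by exists 1; rewrite scale1r eqxx.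
Qed.

Lemma block_scalar_shift k l m x : block_scalar k l x ->
  block_scalar (degreeD m k) (degreeD m l) (Phi m x).
Proof.
move=> h w w'.
have [u1 [u2 c]] := cat_split w erefl; have [v1 [v2 c']] := cat_split w' erefl.
rewrite (shift_compress CK _ c c') (is_cat_terminus c) (is_cat_terminus c').
by case: eqP => _; [exact: h | exists 0; rewrite scale0r].
Qed.

Lemma block_scalar_iter (j : nat) k l p x : block_scalar k l x ->
  block_scalar (degreeD (degree_scale j p) k) (degreeD (degree_scale j p) l) (iter j (Phi p) x).
Proof.
move=> h; elim: j => [|j IH]; first by rewrite degree_scale0 !degree0D.
by rewrite degree_scaleS -!degreeDA; exact: block_scalar_shift.
Qed.

Lemma block_scalar_sum k l x : block_scalar k l x ->
  \sum_(w : word k) \sum_(w' : word l) tau (star (S w) * x * S w') *: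
    (if terminus w == terminus w' then S w * star (S w') else 0) = x.
Proof.
move=> h.
transitivity (\sum_(w : word k) \sum_(w' : word l) Q w * x * Q w'); last first.
  under eq_bigr do rewrite -mulr_sumr (ck_sum_Q CK) mulr1.
  by rewrite -mulr_suml (ck_sum_Q CK) mul1r.
apply: eq_bigr => w _; apply: eq_bigr => w' _.
have [c [e c0]] := h w w'.
have -> : Q w * x * Q w' = S w * (star (S w) * x * S w') * star (S w') by rewrite !mulrA.
rewrite e vertex_weightZ vertex_weight_vertex mulr1 -scalerAr -scalerAl (ck_terminusr CK).
by case: eqVneq c0 => // _ /(_ isT) ->; rewrite !scale0r.
Qed.

(** The closed form of the expansion after the compression. The normalization is the number of
    degrees in the box, each of which contributes [sum Q w = 1] to the unit. *)
Definition approx_map (L : nat) m x : A := (L.+1 ^ r)%:R^-1%:C *: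
  \sum_(g : {ffun 'I_r -> 'I_L.+1}) \sum_(g' : {ffun 'I_r -> 'I_L.+1})
    \sum_(w : word (degreeD m (ffun_degree g))) \sum_(w' : word (degreeD m (ffun_degree g')))
    tau (star (S w) * x * S w') *:
      (if terminus w == terminus w' then S w * star (S w') else 0).

Lemma approx_ex (L : nat) m : exists N (phi : {linear 'M[R[i]]_N.+1 -> A})
    (psi : {linear A -> 'M[R[i]]_N.+1}),
  [/\ ucp phi, ucp psi, forall x, phi (psi x) = approx_map L m x,
      forall x, cnorm (phi (psi x)) <= cnorm x
    & N.+1 = (\sum_(g : {ffun 'I_r -> 'I_L.+1}) #|{: word (degreeD m (ffun_degree g))}|)%N].
Proof.
pose F := {ffun 'I_r -> 'I_L.+1}.
pose J (g : F) : finType := word (degreeD m (ffun_degree g)).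
pose I : finType := {g : F & J g}.
have cardI : #|{: I}| = (\sum_g #|{: J g}|)%N.
  rewrite -sum1_card; under [RHS]eq_bigr do rewrite -sum1_card.
  by rewrite [RHS]sig_big_dep.
have [b0 _] : exists b : B, True.
  apply: contrapT => h; have := ck_one CK; rewrite big1 => [e|b _]; last by case: h; exists b.
  by move: (oner_neq0 A); rewrite -e eqxx.
have I0 : (0 < #|{: I}|)%N.
  pose g0 : F := [ffun=> ord0]; have [w _] := word_from H0 H1 H2 b0 (degreeD m (ffun_degree g0)).
  by apply/card_gt0P; exists (Tagged J (w : J g0)).
pose N := #|{: I}|.-1; have eN : N.+1 = #|{: I}| by rewrite prednK.
pose idx (i : 'I_N.+1) : I := enum_val (cast_ord eN i).
have idx_inj : injective idx by move=> i j /enum_val_inj/cast_ord_inj.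
have idx_sum (T : nmodType) (G : I -> T) : \sum_(i < N.+1) G (idx i) = \sum_ii G ii.
  rewrite [RHS](reindex idx) //=; exists (fun ii => cast_ord (esym eN) (enum_rank ii)) => ii _.
    by rewrite /idx enum_valK cast_ordK.
  by rewrite /idx cast_ordKV enum_rankK.
pose W (ii : I) : {d : degree r & word d} := Tagged word (tagged ii : word (degreeD m (ffun_degree (tag ii)))).
have W_inj : injective W.
  move=> [g w] [g' w'] e; have tg := congr1 (@tag _ _) e; rewrite /= in tg.
  have gg : g = g'.
    apply/ffunP => i; apply: val_inj; move/ffunP/(_ i): tg; rewrite !ffunE; exact: addnI.
  subst g'; congr existT; apply/eqP; rewrite -(@eq_Tagged _ word (Tagged word w)) //=.
  exact/eqP.
pose E i := S (tagged (W (idx i))).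
pose t i := terminus (tagged (W (idx i))).
have E_orth i j : tau (star (E i) * E j) = (i == j)%:R.
  rewrite vertex_weight_words; congr (nat_of_bool _)%:R.
  by apply/eqP/eqP => [|->//] e; apply/idx_inj/W_inj; move: e; case: (W _); case: (W _).
(* For each letter [b] this provides [N + 1] words ending at [b], hence the partial isometries
   [U i b]. The shape [D] depends on the matrix size but does not affect the rank. *)
have [D hD] := words_ending_unbounded H0 H1 H2 r_gt0 H3 N.+1.
have {}hD b : (N.+1 <= #|[set u : word D | terminus u == b]%SET|)%N := hD D b (degree_le_refl D).
pose u i b : word D := enum_val (widen_ord (hD b) i).
have ut i b : terminus (u i b) = b.
  by have := enum_valP (widen_ord (hD b) i); rewrite inE => /eqP.
have u_inj i j b c : (u i b == u j c) = (i == j) && (b == c).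
  apply/eqP/andP => [e|[/eqP -> /eqP -> //]].
  have bc : b = c by rewrite -(ut i b) e ut.
  subst c; split=> //; apply/eqP/val_inj.
  by have := enum_val_inj e => /(congr1 (@nat_of_ord _)).
pose U i b := S (u i b).
have U_orth i j b c : star (U i b) * U j c = if (i == j) && (b == c) then V b else 0.
  by rewrite /U (ck_starS CK) u_inj ut.
have UV i b : U i b * V b = U i b by rewrite /U -{2}(ut i b) (ck_terminusr CK).
have EV i : E i * V (t i) = E i by exact: (ck_terminusr CK).
have q0 : 0 < (L.+1 ^ r)%:R :> R by rewrite ltr0n expn_gt0.
have cF : #|{: F}| = (L.+1 ^ r)%N by rewrite card_ffun !card_ord.
have E_sum : \sum_i E i * star (E i) = ((L.+1 ^ r)%:R : R)%:C *: 1.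
  rewrite (idx_sum _ (fun ii => Q (tagged (W ii)))).
  rewrite -(sig_big_dep (fun=> true) (fun _ _ => true) (fun g (w : J g) => Q (w : word (degreeD m (ffun_degree g))))) /=.
  under eq_bigr do rewrite (ck_sum_Q CK).
  by rewrite sumr_const cF rmorph_nat scaler_nat.
have [psi [psiE psi_ucp psi_le]] := compression_ex vertex_weightD vertex_weightZ vertex_weightC
  vertex_weight_ge0 E_orth.
have [phi [phiE phi_ucp phi_le]] := expansion_ex EV q0 E_sum U_orth UV.
exists N, phi, psi; split=> //; last by rewrite eN cardI.
  move=> x; rewrite phiE /approx_map; congr (_ *: _).
  under eq_bigr => i _ do under eq_bigr => j _ do rewrite psiE.
  pose G (ii jj : I) := tau (star (S (tagged (W ii))) * x * S (tagged (W jj))) *: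
    (if terminus (tagged (W ii)) == terminus (tagged (W jj))
     then S (tagged (W ii)) * star (S (tagged (W jj))) else 0).
  transitivity (\sum_ii \sum_jj G ii jj).
    rewrite -(idx_sum _ (fun ii => \sum_jj G ii jj)); apply: eq_bigr => i _.
    by rewrite -idx_sum.
  have spl (T : I -> A) : \sum_ii T ii = \sum_g \sum_(w : J g) T (Tagged J w).
    rewrite [RHS](sig_big_dep (fun=> true) (fun _ _ => true) (fun g (w : J g) => T (Tagged J w))) /=.
    by apply: eq_bigr => -[].
  rewrite spl; apply: eq_bigr => g _; rewrite [RHS]exchange_big; apply: eq_bigr => w _.
  by rewrite spl.
by move=> x; exact: le_trans (phi_le _) (psi_le _).
Qed.

(** Each matching pair of degrees reproduces the whole shifted monomial by [block_scalar_sum]; every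
    other pair contributes zero by its degree. *)
Lemma approx_map_monomial (L : nat) m k l p (j : nat) (u : word k) (v : word l) :
  degree_le (degreeD (degree_scale j p) (degreeD k l)) m ->
  approx_map L m (iter j (Phi p) (S u * star (S v))) =
    (folner_ratio R L k l)%:C *: iter j (Phi p) (S u * star (S v)).
Proof.
move=> /degree_leP hm; set y := iter j _ _.
have hy : homogeneous k l y.
  rewrite /y; elim: (j) => [|i IH]; last by rewrite iterS; exact: homogeneous_shift.
  by move=> z; rewrite /= gauge_mono.
rewrite /approx_map /folner_ratio rmorphM /= -scalerA; congr (_ *: _).
rewrite pair_big /= (bigID (mem (matching_pairs L k l))) /= [X in _ + X]big1 ?addr0.
  rewrite rmorph_nat scaler_nat -sumr_const; apply: eq_bigr => -[g g'].
  rewrite inE /= => /eqP/ffunP e.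
  apply: block_scalar_sum.
  (* The length left over after [j p] and [k]. The hypothesis on [m] prevents truncation, and for a
     matching pair the same [d] is left over for [g'] and [l]. *)
  pose d : degree r := [ffun i => (m i + g i - j * p i - k i)%N].
  have -> : degreeD m (ffun_degree g) = degreeD (degree_scale j p) (degreeD k d).
    by apply/ffunP => i; rewrite !ffunE; have := hm i; rewrite !ffunE; lia.
  have -> : degreeD m (ffun_degree g') = degreeD (degree_scale j p) (degreeD l d).
    by apply/ffunP => i; rewrite !ffunE; have := hm i; have := e i; rewrite !ffunE /=; lia.
  exact/block_scalar_iter/block_scalar_monomial.
move=> [g g']; rewrite inE /= => ne; rewrite big1 // => w _; rewrite big1 // => w' _.
rewrite (vertex_weight_homogeneous (k := k) (l := l)) ?scale0r //.
apply: contra ne => /eqP/ffunP e; apply/eqP/ffunP => i; have := e i; rewrite !ffunE; lia.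
Qed.

Lemma approx_mapD (L : nat) m x y : approx_map L m (x + y) = approx_map L m x + approx_map L m y.
Proof. by have [N [phi [psi [_ _ e _ _]]]] := approx_ex L m; rewrite -!e !linearD. Qed.

Lemma approx_mapZ (L : nat) m c x : approx_map L m (c *: x) = c *: approx_map L m x.
Proof. by have [N [phi [psi [_ _ e _ _]]]] := approx_ex L m; rewrite -!e !linearZ. Qed.

Lemma approx_map_le (L : nat) m x : cnorm (approx_map L m x) <= cnorm x.
Proof. by have [N [phi [psi [_ _ e h _]]]] := approx_ex L m; rewrite -e. Qed.

(** The point is uniformity in [j]: the ratio does not see the shift, and the shifts and the
    composition are contractive, so [c] and [L0] depend only on [x], [p] and [delta], while [m]
    grows with [j]. *)
Lemma approx_map_limit p x (delta : R) : 0 < delta ->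
  exists c L0, forall L m j, (L0 <= L)%N -> degree_le (degreeD (degree_scale j p) c) m ->
    cnorm (approx_map L m (iter j (Phi p) x) - iter j (Phi p) x) <= delta.
Proof.
pose P y := forall delta : R, 0 < delta ->
  exists c L0, forall L m j, (L0 <= L)%N -> degree_le (degreeD (degree_scale j p) c) m ->
    cnorm (approx_map L m (iter j (Phi p) y) - iter j (Phi p) y) <= delta.
rewrite -/(P x) => d0; suff: P x by apply.
move: x; apply: (ck_ind H1 CK).
- move=> k l u v d {}d0; set y := S u * star (S v).
  have n0 : 0 < cnorm y + 1 by have := cnorm_ge0 y; lra.
  have [|L0 hL] := @folner_ratio_limit r R k l (d / (cnorm y + 1)); first by rewrite divr_gt0.
  exists (degreeD k l), L0 => L m j /hL {}hL hm.
  rewrite approx_map_monomial // -[X in _ - X]scale1r -(rmorph1 (real_complex R)).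
  rewrite -scalerBl -rmorphB /= cnormZr.
  have yj := iter_shift_le H1 H2 CK j p y; have y0 := cnorm_ge0 (iter j (Phi p) y).
  move: hL; rewrite ler_pdivlMr // => hL; apply: le_trans hL.
  by rewrite ler_wpM2l //; lra.
- move=> x y hx hy d {}d0; have d20 : 0 < d / 2 by lra.
  have [c1 [L1 h1]] := hx _ d20; have [c2 [L2 h2]] := hy _ d20.
  exists (degreeD c1 c2), (maxn L1 L2) => L m j; rewrite geq_max => /andP[l1 l2] hm.
  have {}h1 := h1 L m j l1; have {}h2 := h2 L m j l2.
  rewrite iter_shiftD approx_mapD opprD addrACA; apply: le_trans (cnormD_le _ _) _.
  have {}h1 : cnorm (approx_map L m (iter j (Phi p) x) - iter j (Phi p) x) <= d / 2.
    apply/h1/(degree_le_trans _ hm).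
    by rewrite degree_le_add2l degree_leDl.
  have {}h2 : cnorm (approx_map L m (iter j (Phi p) y) - iter j (Phi p) y) <= d / 2.
    apply/h2/(degree_le_trans _ hm).
    by rewrite degree_le_add2l degree_leDr.
  lra.
- move=> q x hx d {}d0; have q0 := nrmc_ge0 q; have q1 : 0 < nrmc q + 1 by lra.
  have [|c [L0 h]] := hx (d / (nrmc q + 1)); first by rewrite divr_gt0.
  exists c, L0 => L m j lL hm; have := h L m j lL hm.
  rewrite iter_shiftZ approx_mapZ -scalerBr cnormZE ler_pdivlMr //.
  by have := cnorm_ge0 (approx_map L m (iter j (Phi p) x) - iter j (Phi p) x); nra.
move=> x h d {}d0; have d30 : 0 < d / 3 by lra.
have [y hy yx] := h _ d30; have [c [L0 {}hy]] := hy _ d30.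
exists c, L0 => L m j lL hm; have {}hy := hy L m j lL hm.
set T := approx_map L m in hy *; set F := iter j (Phi p) in hy *.
have -> : T (F x) - F x = T (F (x - y)) + (T (F y) - F y) - F (x - y).
  have -> : T (F x) = T (F (x - y)) + T (F y).
    by rewrite /T -approx_mapD /F -iter_shiftD subrK.
  have -> : F x = F (x - y) + F y by rewrite /F -iter_shiftD subrK.
  by rewrite opprD [- _ - _]addrC !addrA.
have e1 : cnorm (F (x - y)) <= cnorm (x - y) by exact: iter_shift_le.
have e2 : cnorm (T (F (x - y))) <= cnorm (F (x - y)) by exact: approx_map_le.
have := cnormB_le (T (F (x - y)) + (T (F y) - F y)) (F (x - y)).
have := cnormD_le (T (F (x - y))) (T (F y) - F y).
lra.
Qed.

Lemma card_word_add k l : (#|{: word (degreeD k l)}| <= #|{: word k}| * #|{: word l}|)%N.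
Proof.
have sp (w : word (degreeD k l)) : {uv : word k * word l | is_cat uv.1 uv.2 w}.
  by apply: cid; have [u [v c]] := cat_split w erefl; exists (u, v).
rewrite -card_prod; apply: (leq_card (fun w => sval (sp w))) => w w' e.
by apply: (is_cat_uniq H1 (svalP (sp w))); rewrite e; exact: svalP (sp w').
Qed.

(** With [m = n p + c] one box serves the whole orbit. Splitting off the prefix of shape [n p]
    leaves words of the shapes [c + g], whose number is the constant [K]. *)
Lemma rcp_upper_bound p (Omega : set A) (eps : R) : finite_set Omega -> 0 < eps ->
  exists K : nat, forall n, (rcp (orbit_upto (Phi p) Omega n) eps <=
    ((K * #|{: word (degree_scale n p)}|)%:R)%:E)%E.
Proof.
move=> fO e0.
have e20 : 0 < eps / 2 by lra.
have [c [L hL]] : exists c L, forall x, Omega x -> forall m j,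
    degree_le (degreeD (degree_scale j p) c) m ->
    cnorm (approx_map L m (iter j (Phi p) x) - iter j (Phi p) x) <= eps / 2.
  have /finite_seqP [sq sqE] := fO.
  suff [c [L0 h]] : exists c L0, forall x, x \in sq -> forall L m j, (L0 <= L)%N ->
      degree_le (degreeD (degree_scale j p) c) m ->
      cnorm (approx_map L m (iter j (Phi p) x) - iter j (Phi p) x) <= eps / 2.
    by exists c, L0 => x; rewrite sqE => /= xs m j; exact: h.
  elim: (sq) => [|x t [c [L0 h]]]; first by exists (degree0 r), 0%N.
  have [c' [L1 h']] := approx_map_limit p x e20.
  exists (degreeD c c'), (maxn L0 L1) => y; rewrite inE => /orP[/eqP -> |yt] L m j;
    rewrite geq_max => /andP[l0 l1] hm.
    by apply: h' => //; apply: degree_le_trans hm; rewrite degree_le_add2l degree_leDr.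
  by apply: h => //; apply: degree_le_trans hm; rewrite degree_le_add2l degree_leDl.
exists (\sum_(g : {ffun 'I_r -> 'I_L.+1}) #|{: word (degreeD c (ffun_degree g))}|)%N => n.
have [N [phi [psi [hphi hpsi pE _ NE]]]] := approx_ex L (degreeD (degree_scale n p) c).
apply: (@le_trans _ _ (N.+1%:R)%:E).
  apply: ereal_inf_lbound; exists ('M[R[i]]_N.+1 : cstarAlgType R), phi, psi, N.+1; split=> //.
    split=> //; first exact: mx_finite_dimensional.
    move=> _ [j /= jn [x Ox <-]]; rewrite pE; apply: le_lt_trans (hL x Ox _ j _) _; last by lra.
    apply/degree_leP => i; rewrite !ffunE leq_add2r leq_mul2r jn orbT //.
  exact: mx_has_rank.
rewrite lee_fin ler_nat NE big_distrl /=; apply: leq_sum => g _.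
rewrite -degreeDA mulnC; exact: card_word_add.
Qed.

End UpperBound.

(** * Growth of the number of words *)

Section MatrixGrowth.
Variable R : realType.
Local Notation C := R[i].

(** An induction on the roots in place of the Jordan form: in [x^(k+1) y = z x^k y + x^k (x - z) y]
    the last term is bounded by the induction hypothesis, and the gap between [rho] and [theta]
    absorbs it. *)
Lemma powers_growth (A : cstarAlgType R) (x y : A) (t : seq C) (rho theta : R) :
  0 <= rho < theta -> (forall z, z \in t -> nrmc z <= rho) ->
  (\prod_(z <- t) (x - z *: 1)) * y = 0 ->
  exists K, forall k : nat, cnorm (x ^+ k * y) <= K * theta ^+ k.
Proof.
move=> /andP[rho0 rt].
have th0 : 0 < theta by lra.
elim: t y => [|z t IH] y tr.
  by rewrite big_nil mul1r => ->; exists 0 => k; rewrite mulr0 cnorm0 mul0r.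
have zr : nrmc z <= rho by apply: tr; rewrite mem_head.
rewrite big_cons => zy.
have comm : (x - z *: 1) * \prod_(a <- t) (x - a *: 1) = \prod_(a <- t) (x - a *: 1) * (x - z *: 1).
  have cz (c : C) (w : A) : GRing.comm w (c *: 1).
    by rewrite /GRing.comm -scalerAr -scalerAl mulr1 mul1r.
  apply: commr_prod => a _; apply: commrB; last exact: cz.
  by apply/commr_sym/commrB; [exact: commr_refl | exact: cz].
have [||K hK] := IH ((x - z *: 1) * y).
- by move=> a at_; apply: tr; rewrite inE at_ orbT.
- by rewrite mulrA -comm.
(* The choice gives [rho K1 + |K| <= theta K1], which closes the recursion, and covers [k = 0]. *)
pose K1 := Num.max (cnorm y) (`|K| / (theta - rho)).
have K1y : cnorm y <= K1 by rewrite le_max lexx.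
have K1K : `|K| <= K1 * (theta - rho) by rewrite -ler_pdivrMr ?subr_gt0 // le_max lexx orbT.
exists K1; elim=> [|k IHk]; first by rewrite !expr0 mul1r mulr1.
have -> : x ^+ k.+1 * y = z *: (x ^+ k * y) + x ^+ k * ((x - z *: 1) * y).
  by rewrite mulrBl mulrBr -scalerAl mul1r -scalerAr addrC subrK exprSr mulrA.
apply: le_trans (cnormD_le _ _) _; rewrite cnormZE.
have p0 : 0 <= theta ^+ k by rewrite exprn_ge0 // ltW.
have h1 : nrmc z * cnorm (x ^+ k * y) <= rho * (K1 * theta ^+ k).
  by apply: ler_pM; rewrite ?nrmc_ge0 ?cnorm_ge0.
have h2 : K * theta ^+ k <= K1 * (theta - rho) * theta ^+ k.
  by rewrite ler_wpM2r //; apply: le_trans K1K; exact: ler_norm.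
have := hK k; rewrite exprS; nra.
Qed.

Section Eigen.
Variable n : nat.
Implicit Types (X : 'M[C]_n) (z : C).

(** Compare both sides of [v X^k = z^k v] at a coordinate where the left eigenvector [v] is largest
    in modulus. *)
Lemma eigenvalue_power X z (k : nat) : eigenvalue X z ->
  nrmc z ^+ k <= \sum_i \sum_j nrmc ((X ^+ k) i j).
Proof.
move=> /eigenvalueP [v vX vn].
have vXk : v *m (X ^+ k) = z ^+ k *: v.
  elim: k => [|k IH]; first by rewrite !expr0 mulmx1 scale1r.
  by rewrite exprSr -mulmxE mulmxA IH -scalemxAl vX scalerA -exprSr.
have [j0 vj0] : exists j, v 0 j != 0.
  apply/existsP; apply: contraNT vn => /existsPn h; apply/eqP/rowP => j.
  by rewrite mxE; apply/eqP/negPn/h.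
case: (@arg_maxP _ _ _ j0 predT (fun j => nrmc (v 0 j)) isT) => j _ jmax.
have vj : 0 < nrmc (v 0 j).
  apply: lt_le_trans (jmax j0 isT); rewrite -ltcR nrmcE normr_gt0 //.
rewrite -(ler_pM2r vj).
have -> : nrmc z ^+ k * nrmc (v 0 j) = nrmc (\sum_i v 0 i * (X ^+ k) i j).
  have /rowP /(_ j) := vXk; rewrite !mxE => ->; rewrite nrmcM; congr (_ * _).
  by elim: (k) => [|q IH]; [rewrite !expr0 (nrmcR 1) normr1 | rewrite !exprS nrmcM IH].
apply: le_trans (_ : \sum_i nrmc (v 0 i * (X ^+ k) i j) <= _).
  elim/big_rec2: _ => [|i y1 y2 _ h]; first by rewrite /nrmc normr0.
  by apply: le_trans (nrmcD _ _) _; rewrite lerD2l.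
rewrite mulr_suml; apply: ler_sum => i _.
rewrite nrmcM mulrC; apply: ler_pM; rewrite ?nrmc_ge0 //; last exact: jmax.
by rewrite (bigD1 j) //= lerDl sumr_ge0 // => l _; exact: nrmc_ge0.
Qed.

Lemma spectral_radius_has_ubound X :
  has_ubound [set complex.Re `|z| | z in [set z : C | eigenvalue X z]].
Proof.
exists (\sum_i \sum_j nrmc (X i j)) => _ [z /= zX <-].
by have := eigenvalue_power 1 zX; rewrite !expr1.
Qed.

Lemma spectral_radius_ub X z : eigenvalue X z -> nrmc z <= spectral_radius X.
Proof.
by move=> zX; apply: ub_le_sup; [exact: spectral_radius_has_ubound | exists z].
Qed.

End Eigen.

(** By Cayley-Hamilton the product of the [X - z] over the roots of the characteristic polynomial
    vanishes, so [powers_growth] applies with [y = 1]. *)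
Lemma matrix_power_growth n (X : 'M[C]_n.+1) (theta : R) : spectral_radius X < theta ->
  exists K, forall (k : nat), \sum_i \sum_j nrmc ((X ^+ k) i j) <= K * theta ^+ k.
Proof.
move=> rt.
have [z0 z0X] := eigenvalue_closed X (ltn0Sn n).
have rho0 : 0 <= spectral_radius X by apply: le_trans (nrmc_ge0 _) (spectral_radius_ub z0X).
have [t tE] := closed_field_poly_normal (char_poly X).
rewrite (monicP (char_poly_monic X)) scale1r in tE.
have [|||K hK] := @powers_growth _ (X : ('M[C]_n.+1 : cstarAlgType R)) 1 t (spectral_radius X) theta.
- by rewrite rho0.
- move=> z zt; apply: spectral_radius_ub.
  by rewrite eigenvalue_root_char tE root_prod_XsubC.
- rewrite mulr1; have := Cayley_Hamilton X; rewrite tE rmorph_prod => e; rewrite -[RHS]e.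
  apply: eq_bigr => z _.
  by rewrite rmorphB /= horner_mx_X horner_mx_C -scalemx1.
exists ((n.+1 * n.+1)%:R * K) => k.
have hk : opnorm (X ^+ k) <= K * theta ^+ k by have := hK k; rewrite mulr1.
apply: le_trans (_ : \sum_(i < n.+1) \sum_(j < n.+1) K * theta ^+ k <= _).
  apply: ler_sum => i _; apply: ler_sum => j _; apply: le_trans hk; exact: entry_le_opnorm.
by rewrite !sumr_const !card_ord -mulrnA -[leLHS]mulr_natl mulrA.
Qed.

End MatrixGrowth.

(** * Counting words by matrix products *)

Section Counting.
Variables (R : realType) (r : nat) (B : finType) (M : 'I_r -> rel B).
Hypotheses (r_gt0 : (0 < r)%N) (H0 : RS_H0 M) (H1 : RS_H1 M) (H2 : RS_H2 M).
Implicit Types (k l m p : degree r) (a b : B).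
Local Notation word := (word M).

Definition word_count m a b : nat :=
  (\sum_(w : word m) (origin w == a) * (terminus w == b))%N.

Definition word_mx m : 'M[R[i]]_#|B| :=
  \matrix_(i, j) (word_count m (enum_val i) (enum_val j))%:R.

Lemma sum_indicator (T : finType) (c : T) (F : T -> nat) : (\sum_a (c == a) * F a = F c)%N.
Proof.
rewrite (bigD1 c) //= eqxx mul1n big1 ?addn0 // => a /negPf; rewrite eq_sym => ->.
by rewrite mul0n.
Qed.

Lemma word_count_add m n a b :
  word_count (degreeD m n) a b = (\sum_c word_count m a c * word_count n c b)%N.
Proof.
rewrite /word_count (cat_reindex (G := fun u v => (origin u == a) * (terminus v == b))%N H1 erefl);
  last by move=> u v w c; rewrite (is_cat_origin c) (is_cat_terminus c).
under [RHS]eq_bigr do rewrite big_distrl /=.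
rewrite [RHS]exchange_big; apply: eq_bigr => u _ /=.
under [RHS]eq_bigr => c _ do rewrite mulnAC mulnC.
rewrite (sum_indicator _ (fun c => (origin u == a) * \sum_(w : word n) (origin w == c) * (terminus w == b)))%N.
rewrite big_distrr big_mkcond; apply: eq_bigr => v _ /=.
by case: eqP => _; rewrite ?mul1n ?mul0n ?muln0.
Qed.

Lemma word_mx_add m n : word_mx (degreeD m n) = word_mx m * word_mx n.
Proof.
apply/matrixP => i j; rewrite -mulmxE !mxE word_count_add natr_sum.
rewrite (reindex (fun c : 'I_#|B| => enum_val c)) /=; last first.
  by exists enum_rank => c _; rewrite ?enum_valK ?enum_rankK.
by apply: eq_bigr => c _; rewrite natrM !mxE.
Qed.

Lemma word_mx0 : word_mx (degree0 r) = 1.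
Proof.
apply/matrixP => i j; rewrite !mxE -(inj_eq enum_val_inj); congr (_%:R).
rewrite /word_count (bigD1 (vertex M (enum_val i))) //= big1 => [|w].
  by rewrite origin_vertex terminus_vertex eqxx mul1n addn0.
move/negP => ne; case: (eqVneq (origin w) (enum_val i)) => [ow|_]; last by rewrite mul0n.
by case: ne; rewrite -ow -word0E.
Qed.

Lemma word_mx_basis j : word_mx (degree_basis j) = rel_mx R (M j).
Proof.
apply/matrixP => i i'; rewrite !mxE; congr (_%:R); rewrite /word_count.
set a := enum_val i; set b := enum_val i'.
case ab: (M j a b); last first.
  rewrite big1 // => w _; case: eqP => [oa|]; case: eqP => [tb|] //.
  by have := word_edge w; rewrite oa tb ab.
have [w ow tw] := edge_word ab.
rewrite (bigD1 w) //= ow tw !eqxx big1 ?addn0 // => w' ne.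
case: eqP => [oa|]; case: eqP => [tb|] //.
by move/negP: ne; case; apply/eqP/edge_word_inj; rewrite ?ow ?tw.
Qed.

Lemma word_mx_scale n p : word_mx (degree_scale n p) = word_mx p ^+ n.
Proof.
elim: n => [|n IH]; first by rewrite degree_scale0 word_mx0 expr0.
by rewrite degree_scaleS word_mx_add IH exprS.
Qed.

Lemma word_mxE p : word_mx p = \prod_(j < r) rel_mx R (M j) ^+ p j.
Proof.
have {1}-> : p = \big[@degreeD r/degree0 r]_j degree_scale (p j) (degree_basis j).
  apply/ffunP => i.
  have -> (F : 'I_r -> degree r) : (\big[@degreeD r/degree0 r]_j F j) i = (\sum_j F j i)%N.
    by elim/big_rec2: _ => [|j y1 y2 _ e]; rewrite ffunE // e.
  rewrite (bigD1 i) //= !ffunE eqxx muln1 big1 ?addn0 // => j /negPf ji.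
  by rewrite !ffunE eq_sym ji muln0.
rewrite (big_morph _ word_mx_add word_mx0); apply: eq_bigr => j _.
by rewrite word_mx_scale word_mx_basis.
Qed.

Lemma card_word_mx n p : (#|{: word (degree_scale n p)}|%:R : R) =
  \sum_i \sum_j nrmc ((word_mx p ^+ n) i j).
Proof.
rewrite -word_mx_scale; set m := degree_scale n p.
have -> : #|{: word m}| = (\sum_a \sum_b word_count m a b)%N.
  rewrite -sum1_card /word_count; under [RHS]eq_bigr do rewrite exchange_big.
  rewrite exchange_big; apply: eq_bigr => w _ /=.
  under eq_bigr do rewrite -big_distrr /=.
  rewrite (sum_indicator _ (fun=> \sum_i (terminus w == i)))%N.
  by rewrite -(sum_indicator (terminus w) (fun=> 1%N)); apply: eq_bigr => b _; rewrite muln1.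
have reix (F : B -> R) : \sum_a F a = \sum_(i < #|B|) F (enum_val i).
  rewrite (reindex (fun c : 'I_#|B| => enum_val c)) //.
  by exists enum_rank => c _; rewrite ?enum_valK ?enum_rankK.
rewrite natr_sum reix; apply: eq_bigr => i _; rewrite natr_sum reix; apply: eq_bigr => j _.
by rewrite mxE -(rmorph_nat (real_complex R)) nrmcR normr_nat.
Qed.

End Counting.

(** * Limits superior and the entropy *)

Section LimSup.
Variable R : realType.
Local Open Scope ereal_scope.

Lemma limn_esup_ge (u : nat -> \bar R) (x : \bar R) (N : nat) :
  (forall n, (N <= n)%N -> x <= u n) -> x <= limn_esup u.
Proof.
move=> h; apply: le_ereal_inf_tmp => _ [V [N' _ hV] <-].
apply: le_trans (h (maxn N N') (leq_maxl _ _)) _.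
by apply: ereal_sup_ubound; exists (maxn N N') => //; apply: hV; rewrite /= leq_maxr.
Qed.

Lemma limn_esup_le (u : nat -> \bar R) (x : \bar R) (N : nat) :
  (forall n, (N <= n)%N -> u n <= x) -> limn_esup u <= x.
Proof.
move=> h; apply: (@le_trans _ _ (ereal_sup [set u n | n in [set n | (N <= n)%N]])).
  by apply: ereal_inf_lbound; exists [set n | (N <= n)%N] => //; exists N.
by apply: ge_ereal_sup => _ [n /= Nn <-]; exact: h.
Qed.

End LimSup.

Section Entropy.
Variables (R : realType) (r : nat) (B : finType) (M : 'I_r -> rel B).
Hypotheses (r_gt0 : (0 < r)%N) (H0 : RS_H0 M) (H1 : RS_H1 M) (H2 : RS_H2 M) (H3 : RS_H3 M).
Variables (A : cstarAlgType R) (s : forall m : degree r, word M m -> A).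
Hypothesis CK : is_CK_algebra s.
Variable p : degree r.
Local Notation word := (word M).
Local Notation rho := (spectral_radius (word_mx R M p)).
Local Notation N n := #|{: word (degree_scale n p)}|.

Lemma card_word_gt0 m : (0 < #|{: word m}|)%N.
Proof.
have [a [b _]] := H0 (Ordinal r_gt0); have [w _] := word_from H0 H1 H2 a m.
by apply/card_gt0P; exists w.
Qed.

Lemma card_B_gt0 : (0 < #|B|)%N.
Proof. by have [a _] := H0 (Ordinal r_gt0); apply/card_gt0P; exists a. Qed.

Lemma spectral_radius_le_card n : (0 < n)%N -> rho ^+ n <= (N n)%:R.
Proof.
move=> n0.
have N0 : 0 < (N n)%:R :> R by rewrite ltr0n card_word_gt0.
(* The [n]-th root of the number of words: [rho] is a supremum, so it is bounded through the modulus
   of each eigenvalue before taking [n]-th powers. *)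
pose y := expR (ln (N n)%:R / n%:R) : R.
have yn : y ^+ n = (N n)%:R.
  by rewrite /y -expRM_natl mulrC divfK ?lnK // pnatr_eq0 -lt0n.
have [z0 z0X] := eigenvalue_closed (word_mx R M p) card_B_gt0.
have rho0 : 0 <= rho by apply: le_trans (nrmc_ge0 _) (spectral_radius_ub z0X).
rewrite -yn lerXn2r ?nnegrE ?expR_ge0 //.
apply: ge_sup; first by exists (complex.Re `|z0|), z0.
move=> _ [z /= zX <-]; rewrite -/(nrmc z) -(ler_pXn2r n0) ?nnegrE ?nrmc_ge0 ?expR_ge0 //.
by rewrite yn (card_word_mx R H1); exact: eigenvalue_power.
Qed.

Lemma card_word_growth (theta : R) : rho < theta ->
  exists2 K : R, 0 < K & forall n, (N n)%:R <= K * theta ^+ n.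
Proof.
move=> rt.
have [K hK] : exists K : R, forall n, (N n)%:R <= K * theta ^+ n.
  suff [K hK] : exists K : R, forall n : nat,
      \sum_i \sum_j nrmc ((word_mx R M p ^+ n) i j) <= K * theta ^+ n.
    by exists K => n; rewrite (card_word_mx R H1).
  move: (word_mx R M p) rt; move: (card_B_gt0); case: #|B| => // b _ X rt.
  exact: matrix_power_growth.
exists K => //; have := hK 0%N; rewrite expr0 mulr1; apply: lt_le_trans.
by rewrite ltr0n card_word_gt0.
Qed.

(** If [rho < 1], the number of words of shape [n p] would tend to 0, yet it is at least 1.
    Positivity of [rho] identifies [lne] with the real logarithm. *)
Lemma spectral_radius_ge1 : 1 <= rho.
Proof.
rewrite leNgt; apply/negP => r1.
have [z0 z0X] := eigenvalue_closed (word_mx R M p) card_B_gt0.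
have rho0 : 0 <= rho by apply: le_trans (nrmc_ge0 _) (spectral_radius_ub z0X).
have [|K K0 hK] := @card_word_growth ((rho + 1) / 2); first by lra.
have [|n hn] := @geometric_small R K ((rho + 1) / 2) 1 _ ltr01; first by lra.
by have := le_lt_trans (hK n) hn; rewrite ltrn1 ltnNge card_word_gt0.
Qed.

Let rho_gt0 : 0 < rho. Proof. exact: lt_le_trans ltr01 spectral_radius_ge1. Qed.

Lemma ht_shift_le : (ht (shift_map s p) <= (ln rho)%:E)%E.
Proof.
apply: ge_ereal_sup => _ [eps [Om [e0 fO ->]]].
have [K0 hK0] := rcp_upper_bound r_gt0 H0 H1 H2 H3 CK p fO e0.
apply/lee_addgt0Pr => d d0.
(* Half of [d] pays for passing from [rho] to [theta], the other half for the constant [K], once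
   [|ln K| / n <= d / 2]. *)
pose theta := rho * expR (d / 2).
have d20 : 0 < d / 2 by lra.
have rt : rho < theta by rewrite -[ltLHS]mulr1 ltr_pM2l // expR_gt1.
have t0 : 0 < theta by exact: lt_trans rt.
have lnt : ln theta = ln rho + d / 2 by rewrite /theta lnM ?posrE ?expR_gt0 // expRK.
have [K1 K10 hK1] := card_word_growth rt.
pose K : R := (K0%:R + 1) * K1.
have Kpos : 0 < K by rewrite mulr_gt0 // ltr_wpDl.
apply: (@limn_esup_le _ _ _ (Num.truncn (`|ln K| / (d / 2))).+1) => n hn.
have n0 : 0 < n%:R :> R by rewrite ltr0n (leq_ltn_trans (leq0n _) hn).
have rle : (rcp (orbit_upto (shift_map s p) Om n) eps <= (K * theta ^+ n)%:E)%E.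
  apply: le_trans (hK0 n) _; rewrite lee_fin natrM.
  have p0 : 0 <= (N n)%:R :> R by [].
  have := hK1 n; have : 0 <= K0%:R :> R by [].
  rewrite /K; nra.
have rge : (0 <= rcp (orbit_upto (shift_map s p) Om n) eps)%E.
  by apply: le_ereal_inf_tmp => _ [C [phi [psi [k [_ _ ->]]]]]; rewrite lee_fin.
have Kt : 0 < K * theta ^+ n by rewrite mulr_gt0 // exprn_gt0.
apply: le_trans (_ : (n%:R^-1)%:E * lne (K * theta ^+ n)%:E <= _)%E.
  apply: lee_wpmul2l; first by rewrite lee_fin invr_ge0 ltW.
  by rewrite lee_lne // in_itv /= leey ?rge // andbT lee_fin ltW.
rewrite lne_EFin // -EFinM -EFinD lee_fin lnM ?posrE ?exprn_gt0 // lnXn // lnt.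
rewrite mulrDr -(mulr_natl (ln rho + d / 2)) mulKf ?gt_eqF // addrC -addrA lerD2l.
have : n%:R^-1 * ln K <= d / 2.
  rewrite mulrC ler_pdivrMr // [leRHS]mulrC -ler_pdivrMr //.
  apply: le_trans (_ : `|ln K| / (d / 2) <= _).
    by rewrite ler_wpM2r ?invr_ge0 ?ler_norm // ltW.
  by apply: ltW; apply: lt_le_trans (truncnS_gt _) _; rewrite ler_nat.
lra.
Qed.

Lemma ht_shift_ge : ((ln rho)%:E <= ht (shift_map s p))%E.
Proof.
apply/lee_addgt0Pr => d d0.
pose K : R := #|{: word p}|%:R + 1.
have K0 : 0 < K by rewrite ltr_wpDl.
(* Large enough for [K e^(-t) <= d / 2]; the absolute value and the 1 also make [t] positive. *)
pose t := ln (K / (d / 2)) + `|ln (K / (d / 2))| + 1.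
have d20 : 0 < d / 2 by lra.
have Kd : 0 < K / (d / 2) by rewrite divr_gt0.
have t0 : 0 < t.
  by have := ler_norm (- ln (K / (d / 2))); rewrite normrN /t; lra.
have Kt : K * expR (- t) <= d / 2.
  rewrite expRN ler_pdivrMr ?expR_gt0 // mulrC -ler_pdivrMr //.
  rewrite -{1}[K / (d / 2)]lnK ?posrE // ler_expR.
  by have := normr_ge0 (ln (K / (d / 2))); rewrite /t; lra.
(* With [t eps = d / 2] the two losses in the exponential rate, [t eps] and [K e^(-t)], together are
   at most [d]. *)
pose eps := d / 2 / t.
have e0 : 0 < eps by rewrite divr_gt0.
have te : t * eps = d / 2 by rewrite /eps mulrC divfK // gt_eqF.
pose Om : set A := [set s w * star (s w) | w in [set: word p]].
pose u n : \bar R := ((n%:R^-1)%:E * lne (rcp (orbit_upto (shift_map s p) Om n) eps))%E.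
have uht : (limn_esup u <= ht (shift_map s p))%E.
  apply: ereal_sup_ubound; exists eps, Om; split=> //.
  by apply: finite_image; exact: finite_finset.
rewrite -leeBlDr //; apply: le_trans uht; rewrite -EFinB.
apply: (@limn_esup_ge _ _ _ 1%N) => n n1.
have n0 : 0 < n%:R :> R by rewrite ltr0n.
pose x : R := n%:R * (ln rho - d).
have xr : ((expR x)%:E <= rcp (orbit_upto (shift_map s p) Om n) eps)%E.
  apply: le_ereal_inf_tmp => _ [C [phi [psi [k [cpa rk ->]]]]]; rewrite lee_fin.
  have lb := rank_lower_bound H0 H1 H2 CK n1 (ltW t0) rk cpa.
  have {}lb := le_trans (ler_wpM2r (expR_ge0 _) (spectral_radius_le_card n1)) lb.
  have ub : (1 + #|{: word p}|%:R * expR (- t)) ^+ n <= expR (n%:R * (d / 2)).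
    rewrite expRM_natl lerXn2r ?nnegrE ?expR_ge0 ?addr_ge0 ?mulr_ge0 ?expR_ge0 //.
    apply: le_trans (expR_ge1Dx _) _; rewrite ler_expR; apply: le_trans Kt.
    by rewrite ler_wpM2r ?expR_ge0 // /K lerDl.
  have {}lb := le_trans lb (ler_wpM2l (ler0n R k) ub).
  have xE : expR x = rho ^+ n * expR (- t * (n%:R * eps)) * expR (- (n%:R * (d / 2))).
    have -> : rho ^+ n = expR (n%:R * ln rho) by rewrite expRM_natl lnK // posrE.
    rewrite -!expRD /x; congr expR.
    have -> : - t * (n%:R * eps) = - (n%:R * (t * eps)) by ring.
    by rewrite te; field.
  rewrite xE expRN ler_pdivrMr ?expR_gt0 //.
rewrite /u; apply: le_trans (_ : (n%:R^-1)%:E * lne (expR x)%:E <= _)%E.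
  rewrite lne_EFin ?expR_gt0 // expRK -EFinM lee_fin /x mulKf // gt_eqF //.
apply: lee_wpmul2l; first by rewrite lee_fin invr_ge0 ltW.
rewrite lee_lne // in_itv /= leey andbT ?lee_fin ?expR_ge0 //.
by apply: le_trans xr; rewrite lee_fin expR_ge0.
Qed.

Lemma ht_shift : ht (shift_map s p) = lne rho%:E.
Proof.
by rewrite lne_EFin //; apply/eqP; rewrite eq_le ht_shift_le ht_shift_ge.
Qed.

End Entropy.

Theorem corollary2p5 (R : realType) (r : nat) (r_gt0 : (0 < r)%N)
    (B : finType) (M : 'I_r -> rel B)
    (M_H0 : RS_H0 M) (M_H1 : RS_H1 M) (M_H2 : RS_H2 M) (M_H3 : RS_H3 M)
    (O_M : cstarAlgType R) (s : forall m : degree r, word M m -> O_M)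
    (O_M_universal : is_CK_algebra s) :
  (forall p : degree r,
     ht (shift_map s p) =
     lne (spectral_radius (\prod_(j < r) rel_mx R (M j) ^+ p j))%:E) /\
  (forall j : 'I_r,
     ht (shift_map s (degree_basis j)) =
     lne (spectral_radius (rel_mx R (M j)))%:E).
Proof.
have h p := ht_shift r_gt0 M_H0 M_H1 M_H2 M_H3 O_M_universal p.
split=> [p|j]; first by rewrite h (word_mxE R M_H1).
by rewrite h word_mx_basis.
Qed.
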